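(* Let $m,m_0$ be nonnegative integers, let $G$ be a graph with a vertex $z$, let $k\ge 2$ be an integer, and let $f:V(G)\rightarrow \mathbb{Z}_k$ be a mapping compatible with $G$. If $G$ is $(m+m_0+4k-4)$-tree-connected, then $G$ has an $m$-tree-connected factor $H$ with $d_H(v)\equiv f(v)\pmod k$ for every vertex $v$, such that $G\setminus E(H)$ is $m_0$-tree-connected and $d_H(v)\le d_G(v)-(k-1)$ for each $v\in V(G)\setminus \{z\}$. If $G$ is bipartite, the same conclusion holds under the weaker assumption that $G$ is $(m+m_0+2k-2)$-tree-connected.
   Context: Graphs may have loops and multiple edges. A factor is a spanning subgraph. A graph is $m$-tree-connected if it contains $m$ edge-disjoint spanning trees. For $A\subseteq V(G)$, $e_G(A)$ is the number of edges with both ends in $A$. A mapping $f:V(G)\to\mathbb{Z}_k$ is compatible with $G$ with respect to a partition $X,Y$ of $V(G)$ if either $\sum_{v\in X} f(v)-2x\equiv \sum_{v\in Y}f(v) \pmod k$ for some integer $0\le x\le e_G(X)$, or $\sum_{v\in X} f(v)\equiv \sum_{v\in Y}f(v)-2y \pmod k$ for some integer $0\le y\le e_G(Y)$; $f$ is compatible with $G$ if it is compatible with respect to every partition $X,Y$ of $V(G)$. *)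

(* Defs.v *)
From mathcomp Require Import all_boot all_order all_algebra.

Set Implicit Arguments.
Unset Strict Implicit.
Unset Printing Implicit Defensive.

Import GRing.Theory.
Local Open Scope ring_scope.

(* Finite multigraphs: a loop at v is an edge with [ends e = [set v]], and
   parallel edges are distinct edges with the same set of ends. *)
Record mgraph := MGraph {
  vertex :> finType;
  edge : finType;
  ends : edge -> {set vertex};
  ends_card : forall e, (0 < #|ends e| <= 2)%N }.

Section Multigraphs.
Variable G : mgraph.
(* A factor (spanning subgraph) of G is given by its edge set; G itself is
   [setT], and G \ E(H) is [~: H]. *)
Implicit Types (F T : {set edge G}) (A X : {set G}) (v : G).

(* A loop contributes 2 to the degree. *)
Definition deg F v : nat :=
  (#|[set e in F | v \in ends e]| + #|[set e in F | ends e == [set v]]|)%N.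

Definition nb_edges_in A : nat := #|[set e : edge G | ends e \subset A]|.

Definition adj F : rel G :=
  [rel u v | [exists e in F, ends e == [set u; v]]].

Definition connected F : Prop := forall u v : G, connect (adj F) u v.

(* [ordS] is the cyclic successor of 'I_n; n = 1 gives the loops and n = 2 the
   pairs of parallel edges. *)
Definition is_cycle F n (vs : 'I_n -> G) (es : 'I_n -> edge G) : Prop :=
  [/\ injective vs, injective es, forall i, es i \in F
    & forall i, ends (es i) = [set vs i; vs (ordS i)]].

Definition acyclic F : Prop :=
  forall n (vs : 'I_n -> G) (es : 'I_n -> edge G),
    (0 < n)%N -> ~ is_cycle F vs es.

Definition spanning_tree T : Prop := connected T /\ acyclic T.

Definition tree_connected (m : nat) F : Prop :=
  exists T : 'I_m -> {set edge G},
    (forall i, T i \subset F /\ spanning_tree (T i)) /\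
    (forall i j, i != j -> [disjoint T i & T j]).

Definition bipartite : Prop :=
  exists X : {set G}, forall e : edge G,
    #|ends e :&: X| = 1%N /\ #|ends e :&: ~: X| = 1%N.

(* The partition is (X, ~: X), possibly with an empty part. 'Z_k is the ring
   of integers modulo k only for k >= 2. *)
Definition compatible_wrt k (f : G -> 'Z_k) X : Prop :=
  (exists2 x : nat, (x <= nb_edges_in X)%N &
     \sum_(v in X) f v - (2 * x)%:R = \sum_(v in ~: X) f v) \/
  (exists2 y : nat, (y <= nb_edges_in (~: X))%N &
     \sum_(v in X) f v = \sum_(v in ~: X) f v - (2 * y)%:R).

Definition compatible k (f : G -> 'Z_k) : Prop :=
  forall X : {set G}, compatible_wrt f X.

End Multigraphs.

Arguments bipartite : clear implicits.

(* Main.v *)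
Require Import Defs.
From mathcomp Require Import all_boot all_order all_algebra.
From mathcomp Require Import zify.

Set Implicit Arguments.
Unset Strict Implicit.
Unset Printing Implicit Defensive.

Import Order.TTheory GRing.Theory Num.Theory.

(* In a bipartite graph with parts [X] and [Y] a factor is the set of edges
   directed from [X] to [Y] in an orientation, so degrees modulo [k] become
   in- and outdegrees modulo [k], that is, net outdegrees modulo [2k].

   Orientations with prescribed net outdegrees modulo [2k] are constructed by the
   method of Lovasz, Thomassen, Wu and Zhang: one proves by induction a statement
   about graphs in which some edges ("stubs") lead to an already oriented
   outside, assuming [d(A) >= 2k - 2 + |t(A)|] for all vertex sets [A], where
   [|t(A)|] is the distance of the demand of [A] to [2kZ].  Tight sets are
   contracted; vertices of too large degree and vertices of demand 0 are lifted;
   an edge joining vertices of opposite sign is deleted.  If all demands have the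
   same sign, one vertex trades its in-stubs for [k - 1] out-stubs: this changes
   its sign and costs at most the slack 2 that every nontrivial set has.

   A union of [2k - 2] spanning trees is brought into this form by deleting
   vertices [v] of small degree, reconnecting each tree by splitting off pairs of
   edges at [v]; whenever [v] cannot be deleted with the required indegree, every
   orientation with net outdegree smaller than [2k] in absolute value satisfies
   the degree bound at [v].

   In the nonbipartite case a maximum cut of [4k - 4] of the trees contains
   [2k - 2] edge-disjoint spanning trees, by the tree packing theorem, and the
   edges inside the parts correct the parity of the degree sums. *)

(** Spanning trees supply only [d(A) >= 2k - 2], whereas the induction on graphs with stubs asks for
    the additional [|t(A)|]. The way out is that a set violating this lower bound satisfies
    [d(A) < 2k - 2 + |t(A)|], which is the upper bound that the boundary of a graph with stubs must
    obey. So an inclusion-minimal violating set is contracted, the rest is oriented by induction,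
    and the arcs at the set become the stubs of an instance inside it, whose proper subsets obey the
    lower bound by minimality. Tight sets are treated by the same exchange. The vertex [z] is never
    deleted and never put into a violating set (complements have the same cut and the opposite
    demand); no degree bound is claimed there.

    The number [4k - 4] serves two alternatives. If [k - 1] edges of these trees lie inside the
    parts of the cut, they correct any residue. Otherwise at most [k - 2] of the trees leave the
    cut, and [2k - 2] others lie in it. The exact counts in the compatibility condition enter when
    all of [G] has fewer than [k - 1] edges inside the parts; all these edges are then held in
    reserve. *)

Section Lists.

(** * Multigraphs and orientations as lists of pairs: cuts and net outdegrees *)

Variable T : finType.
Implicit Types (E D : seq (T * T)) (A B S : {set T}) (e : T * T).

Definition unordered e : {set T} := [set e.1; e.2].
(* Edges and arcs are both pairs; [eqv D E] says that [D] is an orientation of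
   the multigraph with edge list [E], up to the order of the list. *)
Definition eqv E D := perm_eq (map unordered E) (map unordered D).
Definition cross A e : bool := (e.1 \in A) (+) (e.2 \in A).
Definition cut E A : nat := count (cross A) E.
Definition outd D A : nat := count (fun a => a.1 \in A) D.
Definition ind D A : nat := count (fun a => a.2 \in A) D.
Definition net D A : int := (outd D A)%:Z - (ind D A)%:Z.

Lemma eqv_refl E : eqv E E. Proof. exact: perm_refl. Qed.
Lemma eqv_sym E D : eqv E D = eqv D E. Proof. exact: perm_sym. Qed.
Lemma eqv_trans E D F : eqv E D -> eqv D F -> eqv E F.
Proof. exact: perm_trans. Qed.
Lemma perm_eqv E D : perm_eq E D -> eqv E D.
Proof. exact: perm_map. Qed.
Lemma eqv_cat E E' D D' : eqv E E' -> eqv D D' -> eqv (E ++ D) (E' ++ D').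
Proof. by move=> h1 h2; rewrite /eqv !map_cat perm_cat. Qed.
Lemma eqv_cons e E D : eqv E D -> eqv (e :: E) (e :: D).
Proof. by move=> h; rewrite /eqv /= perm_cons. Qed.
Lemma uo_swap x y : unordered (x, y) = unordered (y, x).
Proof. by rewrite /unordered /= setUC. Qed.
Lemma eqv_swap x y E D : eqv E D -> eqv ((x, y) :: E) ((y, x) :: D).
Proof. by move=> h; rewrite /eqv /= uo_swap perm_cons. Qed.
Lemma eqv_size E D : eqv E D -> size E = size D.
Proof. by move/perm_size; rewrite !size_map. Qed.

Lemma uo_eq e e' : unordered e = unordered e' -> e' = e \/ e' = (e.2, e.1).
Proof.
case: e => a b; case: e' => c d; rewrite /unordered /= => h.
have ha : a \in [set c; d] by rewrite -h !inE eqxx.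
have hb : b \in [set c; d] by rewrite -h !inE eqxx orbT.
have hc : c \in [set a; b] by rewrite h !inE eqxx.
have hd : d \in [set a; b] by rewrite h !inE eqxx orbT.
move: ha hb hc hd; rewrite !inE.
case/orP=> /eqP ha; case/orP=> /eqP hb; rewrite {}ha {}hb ?eqxx ?orbT ?orbb.
- by move=> _ /eqP ->; left.
- by move=> _ _; left.
- by move=> _ _; right.
- by move=> /eqP -> _; left.
Qed.

Lemma cross_uo A e e' : unordered e = unordered e' -> cross A e = cross A e'.
Proof. by case/uo_eq=> -> //; rewrite /cross addbC. Qed.

Lemma mem_uo e E : unordered e \in map unordered E -> e \in E \/ (e.2, e.1) \in E.
Proof.
case/mapP=> e' he' /uo_eq [<-|h]; first by left.
by right; rewrite -h.
Qed.

Lemma eqv_mem E D e : eqv E D -> e \in E -> e \in D \/ (e.2, e.1) \in D.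
Proof.
by move=> h he; apply: mem_uo; rewrite -(perm_mem h); apply: map_f.
Qed.

Lemma count_eqv (p : pred (T * T)) E D :
  (forall e e', unordered e = unordered e' -> p e = p e') -> eqv E D -> count p E = count p D.
Proof.
move=> hp; elim: E D => [|e E IH] D h.
  by move/eqv_size: h; case: D.
have : unordered e \in map unordered D by rewrite -(perm_mem h) /= inE eqxx.
case/mapP=> e' he' heq.
have hD := perm_to_rem he'.
rewrite (permP hD) /= (hp _ _ heq); congr (_ + _)%N; apply: IH.
have := eqv_trans h (perm_eqv hD).
by rewrite /eqv /= heq perm_cons.
Qed.

Lemma cut_eqv E D A : eqv E D -> cut E A = cut D A.
Proof. by apply: count_eqv => e e'; apply: cross_uo. Qed.

Lemma cut_cat E D A : cut (E ++ D) A = (cut E A + cut D A)%N.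
Proof. exact: count_cat. Qed.
Lemma cut_cons e E A : cut (e :: E) A = (cross A e + cut E A)%N.
Proof. by []. Qed.

Lemma net_perm D D' A : perm_eq D D' -> net D A = net D' A.
Proof. by move=> h; rewrite /net /outd /ind !(permP h). Qed.
Lemma net_cat D D' A : (net (D ++ D') A = net D A + net D' A)%R.
Proof. by rewrite /net /outd /ind !count_cat; lia. Qed.
Lemma net_cons a D A :
  (net (a :: D) A = (a.1 \in A)%:Z - (a.2 \in A)%:Z + net D A)%R.
Proof. by rewrite /net /outd /ind /=; lia. Qed.

Lemma net_le D A : (`|net D A| <= cut D A)%N.
Proof.
elim: D => [|a D IH] //; rewrite net_cons cut_cons /cross.
by case: (a.1 \in A); case: (a.2 \in A); rewrite /=; lia.
Qed.

Lemma net_par D A : exists j, (net D A = (cut D A)%:Z + 2 * j)%R.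
Proof.
elim: D => [|a D [j IH]]; first by exists 0%R.
rewrite net_cons cut_cons /cross IH.
case: (a.1 \in A); case: (a.2 \in A); rewrite /=;
 [exists j|exists j|exists (j - 1)%R|exists j]; lia.
Qed.

Lemma big_mem1 (R : nmodType) A x (c : R) :
  (\sum_(u in A) (if u == x then c else 0) = if x \in A then c else 0)%R.
Proof.
case: ifP => hx.
  rewrite (bigD1 x) //= eqxx big1 ?addr0 // => u /andP [_ /negPf ->] //.
by rewrite big1 // => u hu; case: eqP => // hux; rewrite -hux hu in hx.
Qed.

Lemma sum_mem (A : {set T}) (y : T) :
  (\sum_(x in A) ((y == x)%:Z) = (y \in A)%:Z)%R.
Proof.
transitivity (\sum_(x in A) (if x == y then 1 else 0 : int))%R.
  by apply: eq_bigr => x _; rewrite eq_sym; case: eqP.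
by rewrite big_mem1; case: (y \in A).
Qed.

Lemma net_sum D A : (net D A = \sum_(x in A) net D [set x])%R.
Proof.
elim: D => [|a D IH].
  by rewrite big1 // /net /outd /ind.
rewrite net_cons IH.
rewrite -!sum_mem -sumrB -big_split /=.
by apply: eq_bigr => x _; rewrite net_cons !inE.
Qed.

(** Both sides are compared with the net outdegree of the listed orientation, which has the parity
    of the cut and is additive over vertices. *)
Lemma cut_par E A :
  exists j, ((cut E A)%:Z = \sum_(x in A) (cut E [set x])%:Z + 2 * j)%R.
Proof.
have [j hj] := net_par E A.
have : exists i, (net E A = \sum_(x in A) (cut E [set x])%:Z + 2 * i)%R.
  rewrite net_sum.
  apply: (big_rec2 (fun u v => exists i, (u = v + 2 * i)%R)); first by exists 0%R.
  move=> x u v _ [i hi]; have [i' hi'] := net_par E [set x].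
  by exists (i + i')%R; rewrite hi hi'; lia.
by case=> i hi; exists (i - j)%R; lia.
Qed.

Lemma cut_compl E S A :
  all (fun e => (e.1 \in S) && (e.2 \in S)) E -> cut E (S :\: A) = cut E A.
Proof.
move=> h; apply: eq_in_count => e he.
have /andP [h1 h2] := allP h _ he.
by rewrite /cross !inE h1 h2 !andbT; case: (_ \in A); case: (_ \in A).
Qed.

Lemma pick_edge E A : (0 < cut E A)%N ->
  exists x y E0, [/\ x \in A, y \notin A & eqv E ((x, y) :: E0)].
Proof.
rewrite -has_count => /hasP [[a b] he].
have hE := perm_to_rem he.
rewrite /cross /=; case ha: (a \in A); case hb: (b \in A) => // _.
  exists a, b, (rem (a, b) E); split; rewrite ?ha ?hb //.
  exact: perm_eqv.
exists b, a, (rem (a, b) E); split; rewrite ?ha ?hb //.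
apply: eqv_trans (perm_eqv hE) _; apply: eqv_swap; exact: eqv_refl.
Qed.

(** Used to undo contractions: [g] need not be injective, so each arc of [D] is traced back to one
    edge of [E], reversed if [D] reverses its image. *)
Lemma ori_map (g : T -> T) E D :
  eqv D [seq (g e.1, g e.2) | e <- E] ->
  exists D0, eqv D0 E /\ perm_eq D [seq (g e.1, g e.2) | e <- D0].
Proof.
elim: E D => [|e E IH] D /= h.
  exists [::]; move/eqv_size/size0nil: h => ->; split; exact: perm_refl.
have : unordered (g e.1, g e.2) \in map unordered D by rewrite (perm_mem h) /= inE eqxx.
case/mapP=> a ha heq.
have hD := perm_to_rem ha.
have /IH [D0 [h1 h2]] : eqv (rem a D) [seq (g e.1, g e.2) | e <- E].
  have hD' : perm_eq (a :: rem a D) D by rewrite perm_sym.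
  have := eqv_trans (perm_eqv hD') h.
  by rewrite /eqv /= heq perm_cons.
case: (uo_eq heq) => /= ha'.
  exists (e :: D0); split; first exact: eqv_cons.
  by apply: perm_trans hD _; rewrite /= -ha' perm_cons.
exists ((e.2, e.1) :: D0); split.
  by case: (e) => x y; apply: eqv_swap.
by apply: perm_trans hD _; rewrite /= -ha' perm_cons.
Qed.

Lemma ori_cat E1 E2 D : eqv D (E1 ++ E2) ->
  exists D1 D2, [/\ eqv D1 E1, eqv D2 E2 & perm_eq D (D1 ++ D2)].
Proof.
elim: E1 D => [|e E IH] D /= h; first by exists [::], D.
have : unordered e \in map unordered D by rewrite (perm_mem h) /= inE eqxx.
case/mapP=> a ha heq.
have hD := perm_to_rem ha.
have /IH [D1 [D2 [h1 h2 h3]]] : eqv (rem a D) (E ++ E2).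
  have hD' : perm_eq (a :: rem a D) D by rewrite perm_sym.
  have := eqv_trans (perm_eqv hD') h.
  by rewrite /eqv /= heq perm_cons.
exists (a :: D1), D2; split=> //.
  by rewrite /eqv /= heq perm_cons.
by apply: perm_trans hD _; rewrite /= perm_cons.
Qed.

End Lists.

(** * The distance of an integer to the multiples of [2k] *)

Section Norm.
Variable k : nat.
Hypothesis hk : 2 <= k.
Local Notation K := (2 * k).
Local Notation Kz := (Posz (2 * k)).

(** The [|t(A)|] of the overview: the least absolute value in the class of [x] modulo [2k], hence at
    most [k]. *)
Definition nrm (x : int) : nat :=
  minn `|(x %% Kz)%Z| (K - `|(x %% Kz)%Z|).

Arguments nrm x%_R.

Definition divK (x : int) : bool := (Kz %| x)%Z.
Arguments divK x%_R.

Lemma divKD x y : divK x -> divK y -> divK (x + y).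
Proof. exact: rpredD. Qed.
Lemma divKN x : divK (- x) = divK x.
Proof. exact: rpredN. Qed.
Lemma divKB x y : divK x -> divK y -> divK (x - y).
Proof. exact: rpredB. Qed.
Lemma divKK : divK Kz. Proof. exact: dvdzz. Qed.

Lemma nrm_div x : exists q r : int,
  [/\ x = (q * Kz + r)%R, (0 <= r)%R, (r < Kz)%R & nrm x = minn `|r| (K - `|r|)].
Proof.
have h0 : Kz != 0%R by lia.
exists (x %/ Kz)%Z, (x %% Kz)%Z; split=> //.
- exact: divz_eq.
- exact: modz_ge0.
- by have := ltz_mod x h0; lia.
Qed.

Lemma nrm_ex x : exists j : int, nrm x = `|(x - j * Kz)%R|.
Proof.
have [q [r [-> h1 h2 ->]]] := nrm_div x.
case: (leqP `|r| (K - `|r|)) => h.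
  exists q; have -> : (q * Kz + r - q * Kz = r)%R by lia.
  lia.
exists (q + 1)%R.
have -> : (q * Kz + r - (q + 1) * Kz = r - Kz)%R by rewrite mulrDl; lia.
lia.
Qed.

Lemma nrm_le x (j : int) : nrm x <= `|(x - j * Kz)%R|.
Proof.
have [q [r [-> h1 h2 ->]]] := nrm_div x.
have -> : (q * Kz + r - j * Kz = (q - j) * Kz + r)%R by rewrite mulrBl; lia.
move: (q - j)%R => u.
case: (ltrgtP u 0%R) => hu; last by rewrite hu mul0r add0r; lia.
  case: (eqVneq u (-1)%R) => [->|hu1]; first by lia.
  have : (u * Kz <= -2 * Kz)%R by apply: ler_wpM2r; lia.
  lia.
have : (1 * Kz <= u * Kz)%R by apply: ler_wpM2r; lia.
lia.
Qed.

Lemma nrm_abs x : nrm x <= `|x|.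
Proof. by have := nrm_le x 0; rewrite mul0r subr0. Qed.
Lemma nrm_absB x : nrm x <= `|(x - Kz)%R|.
Proof. by have := nrm_le x 1; rewrite mul1r. Qed.
Lemma nrm_absD x : nrm x <= `|(x + Kz)%R|.
Proof. by have := nrm_le x (-1); rewrite mulN1r opprK. Qed.

Lemma nrm_cong x y : divK (x - y) -> nrm x = nrm y.
Proof.
case/dvdzP=> q hq; apply/eqP; rewrite eqn_leq; apply/andP; split.
  have [j ->] := nrm_ex y; apply: leq_trans (nrm_le x (j + q)) _.
  by rewrite mulrDl -hq; lia.
have [j ->] := nrm_ex x; apply: leq_trans (nrm_le y (j - q)) _.
by rewrite mulrBl -hq; lia.
Qed.

Lemma nrmD x y : nrm (x + y) <= nrm x + nrm y.
Proof.
have [i ->] := nrm_ex x; have [j ->] := nrm_ex y.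
by apply: leq_trans (nrm_le _ (i + j)) _; rewrite mulrDl; lia.
Qed.

Lemma nrmN x : nrm (- x) = nrm x.
Proof.
have aux u : nrm (- u) <= nrm u.
  have [i ->] := nrm_ex u; apply: leq_trans (nrm_le _ (- i)) _.
  by rewrite mulNr; lia.
by apply/eqP; rewrite eqn_leq aux /= -{1}[x]opprK aux.
Qed.

Lemma nrm_lek x : nrm x <= k.
Proof. have [q [r [_ h1 h2 ->]]] := nrm_div x; lia. Qed.

Lemma nrm_rep x : exists y : int, divK (x - y) /\ `|y| = nrm x.
Proof.
have [j hj] := nrm_ex x; exists (x - j * Kz)%R; split => //.
by rewrite /divK opprB addrC subrK dvdz_mull.
Qed.

Lemma nrm_par x : exists i : int, x = (Posz (nrm x) + 2 * i)%R.
Proof.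
have [j hj] := nrm_ex x; rewrite hj.
case: (lerP 0 (x - j * Kz)%R) => h.
  by exists (j * Posz k)%R; lia.
by exists (x - j * Posz k)%R; lia.
Qed.

Lemma nrm_eq0 x : nrm x = 0 -> divK x.
Proof.
have [y [h1 <-]] := nrm_rep x.
by move/eqP; rewrite absz_eq0 => /eqP hy; rewrite hy subr0 in h1.
Qed.

Lemma nrm0 x : divK x -> nrm x = 0.
Proof.
move=> h; rewrite (@nrm_cong x 0) ?subr0 //.
by apply/eqP; rewrite -leqn0; exact: (nrm_abs 0).
Qed.

(** If [|w| >= 2k], shifting [w] by [2k] towards 0 gives [nrm w <= |w| - 2k], and the two bounds on
    [d] contradict each other. So at a vertex of degree at most [2k - 2 + nrm] the bound on the net
    outdegree comes for free. *)
Lemma nrm_lt (w : int) d : `|w| <= d -> d <= 2 * k - 2 + nrm w -> `|w| < K.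
Proof.
move=> h1 h2; rewrite ltnNge; apply/negP => h3.
by have := nrm_absB w; have := nrm_absD w; lia.
Qed.

(** Equivalent to [a + c <= 2k - 2 + nrm (c - a)], the upper bound on the stubs of an instance with
    [a] in-stubs and [c] out-stubs. In this form it visibly survives the removal of stubs. *)
Definition region a c := (minn a c <= k - 1) && (maxn a c <= K - 1).

Lemma regionP a c : a + c <= 2 * k - 2 + nrm (Posz c - Posz a) -> region a c.
Proof.
have := nrm_abs (Posz c - Posz a); have := nrm_absB (Posz c - Posz a).
have := nrm_absD (Posz c - Posz a); rewrite /region; lia.
Qed.

Lemma region_le a c : region a c -> a + c <= 2 * k - 2 + nrm (Posz c - Posz a).
Proof.
rewrite /region => /andP [h1 h2].
have [j ->] := nrm_ex (Posz c - Posz a).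
case: (ltrgtP j 0%R) => hj; last by rewrite hj; lia.
  have : (j * Kz <= -1 * Kz)%R by apply: ler_wpM2r; lia.
  lia.
have : (1 * Kz <= j * Kz)%R by apply: ler_wpM2r; lia.
lia.
Qed.

Lemma nrm_step x : 0 < nrm x -> nrm (x - 1) < nrm x \/ nrm (x + 1) < nrm x.
Proof.
have [y [h1 h2]] := nrm_rep x; rewrite -h2 => h3.
case: (lerP 0 y) => hy.
  left; rewrite (@nrm_cong _ (y - 1)); first by have := nrm_abs (y - 1); lia.
  by have -> : (x - 1 - (y - 1) = x - y)%R by lia.
right; rewrite (@nrm_cong _ (y + 1)); first by have := nrm_abs (y + 1); lia.
by have -> : (x + 1 - (y + 1) = x - y)%R by lia.
Qed.

End Norm.

Arguments nrm k x%_R.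
Arguments divK k x%_R.

(** * Edges at a vertex, and contraction of a vertex set *)

Section Graphs.
Variable T : finType.
Implicit Types (E D : seq (T * T)) (A B S : {set T}) (e : T * T).

Lemma sum_chgN (f g : T -> nat) x A : (forall u, u != x -> f u = g u) ->
  (\sum_(u in A) f u + (x \in A) * g x = \sum_(u in A) g u + (x \in A) * f x)%N.
Proof.
move=> h; case hx: (x \in A).
  rewrite (bigD1 x) //= [in RHS](bigD1 x) //=.
  rewrite (eq_bigr g); first by lia.
  by move=> u /andP [_ hu]; apply: h.
rewrite !mul0n !addn0; apply: eq_bigr => u hu; apply: h.
by apply: contraFneq hx => <-.
Qed.

Lemma sum_chgZ (f g : T -> int) x A : (forall u, u != x -> f u = g u) ->
  (\sum_(u in A) f u = \sum_(u in A) g u + (if x \in A then f x - g x else 0))%R.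
Proof.
move=> h; case: ifP => hx.
  rewrite (bigD1 x) //= [in RHS](bigD1 x) //=.
  rewrite (eq_bigr g); first by lia.
  by move=> u /andP [_ hu]; apply: h.
rewrite addr0; apply: eq_bigr => u hu; apply: h.
by apply: contraFneq hx => <-.
Qed.

Definition good S E := all (fun e => [&& e.1 \in S, e.2 \in S & e.1 != e.2]) E.

Lemma good_eqv S E E' : eqv E E' -> good S E -> good S E'.
Proof.
move=> h /allP hg; apply/allP => e he.
rewrite eqv_sym in h.
case: (eqv_mem h he) => /hg //= /and3P [h1 h2 h3].
by rewrite h1 h2 eq_sym h3.
Qed.

Lemma good_cat S E E' : good S (E ++ E') = good S E && good S E'.
Proof. exact: all_cat. Qed.

Lemma good_all2 S E : good S E -> all (fun e => (e.1 \in S) && (e.2 \in S)) E.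
Proof. by apply: sub_all => e /and3P [-> ->]. Qed.

Definition touch x e : bool := (e.1 == x) || (e.2 == x).
Definition nbrs x E : seq T :=
  [seq if e.1 == x then e.2 else e.1 | e <- E & touch x e].
Definition rest x E := [seq e <- E | ~~ touch x e].

Lemma split_vertex x E : eqv E ([seq (x, y) | y <- nbrs x E] ++ rest x E).
Proof.
elim: E => [|[a b] E IH] //; rewrite /nbrs /rest /touch /=.
case: (a =P x) => [->|ha] /=; first by rewrite eqxx; apply: eqv_cons.
case: (b =P x) => [->|hb] /=.
  by rewrite (introF eqP ha); apply: eqv_swap.
have := eqv_cons (a, b) IH => h; apply: eqv_trans h _; apply: perm_eqv.
by rewrite -cat1s perm_catCA.
Qed.

Lemma nbrs_size S x E : good S E -> size (nbrs x E) = cut E [set x].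
Proof.
move=> h; rewrite size_map size_filter; apply: eq_in_count => e he.
have /and3P [_ _ h3] := allP h _ he; rewrite /touch /cross !inE.
by case: (e.1 =P x) => [h1|_]; case: (e.2 =P x) => [h2|_] //; rewrite h1 h2 eqxx in h3.
Qed.

Lemma nbrs_mem S x E y : good S E -> y \in nbrs x E -> y \in S /\ y != x.
Proof.
move=> h /mapP [e]; rewrite mem_filter => /andP [ht he] ->.
have /and3P [h1 h2 h3] := allP h _ he.
case: (e.1 =P x) => [hx|hx]; first by rewrite -hx eq_sym.
by split=> //; apply/eqP.
Qed.

Lemma rest_good S x E : good S E -> good (S :\ x) (rest x E).
Proof.
move=> h; apply/allP => e; rewrite mem_filter /touch negb_or => /andP [/andP [h1 h2] he].
have /and3P [h3 h4 h5] := allP h _ he.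
by rewrite !inE h1 h2 h3 h4 h5.
Qed.

Section Contract.
Variables (S A : {set T}) (a : T).
Hypotheses (hAS : A \subset S) (ha : a \in A).

Definition gc u := if u \in A then a else u.
Definition gcE E := [seq (gc e.1, gc e.2) | e <- E].
Definition inside e := (e.1 \in A) && (e.2 \in A).
Definition inE_ E := [seq e <- E | inside e].
Definition outE E := [seq e <- E | ~~ inside e].
Definition cS := a |: (S :\: A).
(** The set of original vertices that a set [B] of the contracted graph stands for. *)
Definition bx B := if a \in B then B :|: A else B.

Lemma cS_card : #|cS| = (#|S| - #|A|).+1.
Proof.
by rewrite cardsU1 !inE ha /= add1n cardsD (setIidPr hAS).
Qed.

Lemma gc_bx B u : B \subset cS -> (gc u \in B) = (u \in bx B).
Proof.
move=> hB; rewrite /gc /bx; case hu: (u \in A); case haB: (a \in B);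
  rewrite ?inE ?hu ?orbT ?orbF //.
apply/esym/negbTE/negP => hub; have := subsetP hB _ hub.
rewrite !inE hu /= orbF => /eqP hua; by rewrite hua haB in hub.
Qed.

Lemma split_inside E : perm_eq E (inE_ E ++ outE E).
Proof. by rewrite perm_sym; apply/permPl/perm_filterC. Qed.

Lemma contract_cut E B : B \subset cS -> cut (gcE (outE E)) B = cut E (bx B).
Proof.
move=> hB; rewrite (cut_eqv _ (perm_eqv (split_inside E))) cut_cat.
have -> : cut (inE_ E) (bx B) = 0.
  apply/eqP; rewrite -leqn0 leqNgt -has_count; apply/hasPn => e.
  rewrite mem_filter /inside /cross => /andP [/andP [h1 h2] _].
  by rewrite -!gc_bx // /gc h1 h2 addbb.
rewrite add0n /cut count_map; apply: eq_count => e /=.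
by rewrite /cross /= !gc_bx.
Qed.

Lemma contract_good E : good S E -> good cS (gcE (outE E)).
Proof.
move=> /allP h; apply/allP => e /mapP [e' ]; rewrite mem_filter => /andP [hi he] ->.
have /and3P [h1 h2 h3] := h _ he.
move: hi; rewrite /inside /= /gc /cS.
case ha1: (e'.1 \in A); case ha2: (e'.2 \in A) => //= _;
  rewrite !inE ?eqxx ?ha1 ?ha2 ?h1 ?h2 ?orbT //=.
- by apply: contraFneq ha2 => <-.
- by apply: contraFneq ha1 => ->.
Qed.

Lemma in_good E : good S E -> good A (inE_ E).
Proof.
move=> /allP h; apply/allP => e; rewrite mem_filter => /andP [/andP [h1 h2] he].
by have /and3P [_ _ h3] := h _ he; rewrite h1 h2 h3.
Qed.

Lemma bx_sub B : B \subset cS -> bx B \subset S.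
Proof.
move=> hB; apply/subsetP => u; rewrite -gc_bx // /gc.
case hu: (u \in A); first by move=> _; apply: (subsetP hAS).
move=> hu'; have := subsetP hB _ hu'; rewrite !inE hu /=.
by case/orP=> // /eqP h; rewrite h ha in hu.
Qed.

Lemma bx_neq0 B : B != set0 -> bx B != set0.
Proof.
case/set0Pn=> u hu; apply/set0Pn; exists u; rewrite /bx; case: ifP => //.
by rewrite inE hu.
Qed.

Lemma bx_neqS B : B \subset cS -> B != cS -> bx B != S.
Proof.
move=> hB; apply: contraNneq => h; rewrite eqEsubset hB /=.
apply/subsetP => u; rewrite !inE => hu.
have : gc u \in B.
  rewrite gc_bx // h; case/orP: hu => [/eqP ->|/andP [] //].
  exact: (subsetP hAS).
rewrite /gc; case/orP: hu => [/eqP ->|/andP [hu _]]; first by rewrite ha.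
by rewrite (negPf hu).
Qed.

Lemma bx_big (R : Type) (idx : R) (op : Monoid.com_law idx) (f : T -> R) B :
  B \subset cS ->
  \big[op/idx]_(u in B) (if u == a then \big[op/idx]_(v in A) f v else f u)
  = \big[op/idx]_(u in bx B) f u.
Proof.
move=> hB; rewrite /bx; case: ifP => haB.
  rewrite (bigD1 a) //= eqxx.
  rewrite [in RHS](big_setID A) /=; congr (op _ _).
    by apply: eq_bigl => u; rewrite !inE; case: (u \in A); rewrite ?orbT ?andbF.
  apply: eq_big => [u|u /andP [_ /negPf ->] //].
  rewrite !inE; case hu: (u \in A) => /=; rewrite ?orbF; last first.
    by case: (u =P a) => [h|]; [rewrite h ha in hu|rewrite andbT].
  case huB: (u \in B) => //=.
  by have := subsetP hB _ huB; rewrite !inE hu /= orbF => ->.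
by apply: eq_bigr => u hu; case: eqP => // h; rewrite h haB in hu.
Qed.

Lemma contract_outd D x : x \notin A -> outd (gcE D) [set x] = outd D [set x].
Proof.
move=> hx; rewrite /outd count_map; apply: eq_count => e /=; rewrite !inE /gc.
case: ifP => // he; apply/eqP/eqP => h; first by rewrite -h ha in hx.
by rewrite -h he in hx.
Qed.
Lemma contract_ind D x : x \notin A -> ind (gcE D) [set x] = ind D [set x].
Proof.
move=> hx; rewrite /ind count_map; apply: eq_count => e /=; rewrite !inE /gc.
case: ifP => // he; apply/eqP/eqP => h; first by rewrite -h ha in hx.
by rewrite -h he in hx.
Qed.
Lemma contract_net D x : x \notin A -> net (gcE D) [set x] = net D [set x].
Proof. by move=> hx; rewrite /net contract_outd // contract_ind. Qed.
Lemma contract_netA D : net (gcE D) [set a] = net D A.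
Proof.
rewrite /net /outd /ind !count_map; congr (_%:Z - _%:Z)%R; apply: eq_count => e /=;
 rewrite !inE /gc; case: ifP => [|he]; rewrite ?eqxx //;
 by apply/negbTE; apply: contraFneq he => ->.
Qed.

Lemma outE_not E D : eqv D (outE E) -> all (fun e => ~~ inside e) D.
Proof.
move=> h; apply/allP => e he; case: (eqv_mem h he); rewrite mem_filter /inside.
  by case/andP.
by case/andP; rewrite andbC.
Qed.

End Contract.

Lemma outd_sum D A : outd D A = \sum_(x in A) outd D [set x].
Proof.
rewrite /outd; under eq_bigr do rewrite -sum1_count big_mkcond /=.
rewrite -sum1_count big_mkcond /= exchange_big /=; apply: eq_bigr => e _.
under eq_bigr => x _ do rewrite inE eq_sym.
case: ifP => h.
  by rewrite (bigD1 e.1) //= eqxx big1 // => x /andP [_ /negPf ->].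
by rewrite big1 // => x hx; case: eqP => // hx'; rewrite -hx' hx in h.
Qed.

Lemma ind_sum D A : ind D A = \sum_(x in A) ind D [set x].
Proof.
rewrite /ind; under eq_bigr do rewrite -sum1_count big_mkcond /=.
rewrite -sum1_count big_mkcond /= exchange_big /=; apply: eq_bigr => e _.
under eq_bigr => x _ do rewrite inE eq_sym.
case: ifP => h.
  by rewrite (bigD1 e.2) //= eqxx big1 // => x /andP [_ /negPf ->].
by rewrite big1 // => x hx; case: eqP => // hx'; rewrite -hx' hx in h.
Qed.

Lemma cut_io D A B : B \subset A -> all (fun e => ~~ inside A e) D ->
  cut D B = outd D B + ind D B.
Proof.
move=> hB; elim: D => [|e D IH] // /andP [he hD].
rewrite cut_cons IH // /outd /ind /= /cross.
move: he; rewrite /inside; have := subsetP hB e.1; have := subsetP hB e.2.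
case: (e.1 \in B); case: (e.2 \in B) => /= h2 h1 he; try lia.
Qed.

Lemma net_out D S x : good S D -> x \notin S -> net D [set x] = 0.
Proof.
move=> hg hx; rewrite /net /outd /ind.
suff -> : count (fun e => e.1 \in [set x]) D = 0.
  suff -> : count (fun e => e.2 \in [set x]) D = 0 by [].
  apply/eqP; rewrite -leqn0 leqNgt -has_count; apply/hasPn => e he.
  have /and3P [h1 h2 _] := allP hg _ he.
  by rewrite inE; apply: contraNneq hx => <-.
apply/eqP; rewrite -leqn0 leqNgt -has_count; apply/hasPn => e he.
have /and3P [h1 h2 _] := allP hg _ he.
by rewrite inE; apply: contraNneq hx => <-.
Qed.

End Graphs.

(** * Instances with stubs, and contraction of tight sets *)

Section Instances.
Variables (T : finType) (k : nat).
Hypothesis hk : 2 <= k.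
Implicit Types (E D : seq (T * T)) (A B S X : {set T}) (al be : T -> nat) (t : T -> int).

Definition ldeg E al be A : nat := cut E A + \sum_(x in A) (al x + be x).
Definition sZ t A : int := (\sum_(x in A) t x)%R.
Definition sN al A : nat := \sum_(x in A) al x.

(* [al x] counts the edges directed from outside into [x], [be x] those directed
   from [x] to the outside, and [t x] is the demanded net outdegree of [x],
   including these edges, modulo [2k].  The vertex in [X], if any, has demand 0
   and need not satisfy the degree condition: it is being lifted. *)
Record inst S X E al be t : Prop := Inst {
  i_good : good S E;
  i_X : #|X| <= 1;
  i_Xt : forall x, x \in X -> divK k (t x);
  i_par : forall x, x \in S -> exists j, t x = (Posz (ldeg E al be [set x]) + 2 * j)%R;
  i_sum : divK k (sZ t S + Posz (sN al S) - Posz (sN be S));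
  i_cut : forall A, A \subset S -> A != set0 -> A != S -> A != X ->
    2 * k - 2 + nrm k (sZ t A) <= ldeg E al be A;
  i_reg : region k (sN al S) (sN be S) }.

(** Counting its stubs, [x] has net outdegree [net D [set x] - al x + be x]. This is prescribed
    modulo [2k] and moreover kept below [2k] in absolute value, because a congruence alone gives no
    lower bound on in- and outdegrees. *)
Definition sol S E al be t D : Prop :=
  eqv D E /\ forall x, x \in S ->
    divK k (net D [set x] - (t x + Posz (al x) - Posz (be x))) /\
    `|(net D [set x] - Posz (al x) + Posz (be x))%R| < 2 * k.

Definition solv S E al be t := exists D, sol S E al be t D.

(** An edge weighs [2k] because a deleted edge has to pay for new stubs: one per crossing edge when
    the inside of a contracted set is solved, [k - 1] in [step_switch]. *)
Definition mu S E al be := #|S| + 2 * k * size E + \sum_(x in S) (al x + be x).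

Lemma sN_D al be A : \sum_(x in A) (al x + be x) = sN al A + sN be A.
Proof. by rewrite big_split. Qed.

Lemma sZ1 t x : sZ t [set x] = t x.
Proof. by rewrite /sZ big_set1. Qed.
Lemma sN1 al x : sN al [set x] = al x.
Proof. by rewrite /sN big_set1. Qed.

Lemma ldegE E al be A : ldeg E al be A = cut E A + sN al A + sN be A.
Proof. by rewrite /ldeg sN_D addnA. Qed.

Lemma ldeg_eqv E E' al be A : eqv E E' -> ldeg E al be A = ldeg E' al be A.
Proof. by move=> h; rewrite /ldeg (cut_eqv _ h). Qed.

Lemma ldeg_par S X E al be t A : inst S X E al be t -> A \subset S ->
  exists j, sZ t A = (Posz (ldeg E al be A) + 2 * j)%R.
Proof.
move=> I hA; have [j hj] := cut_par E A.
have : exists i, (sZ t A = \sum_(x in A) Posz (ldeg E al be [set x]) + 2 * i)%R.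
  rewrite /sZ; elim/big_rec2: _ => [|x u v hx [i ->]]; first by exists 0%R.
  have [i' ->] := i_par I (subsetP hA _ hx).
  by exists (i + i')%R; lia.
case=> i ->.
have -> : (\sum_(x in A) Posz (ldeg E al be [set x]) =
   \sum_(x in A) Posz (cut E [set x]) + Posz (\sum_(x in A) (al x + be x)))%R.
  rewrite (big_morph Posz PoszD (erefl (Posz 0))) -big_split /=.
  by apply: eq_bigr => x _; rewrite /ldeg big_set1 PoszD.
by exists (i - j)%R; rewrite /ldeg PoszD hj; lia.
Qed.

Lemma tight_bound E D al be t x : eqv D E ->
  divK k (net D [set x] - (t x + Posz (al x) - Posz (be x))) ->
  ldeg E al be [set x] <= 2 * k - 2 + nrm k (t x) ->
  `|(net D [set x] - Posz (al x) + Posz (be x))%R| < 2 * k.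
Proof.
move=> hD hdiv hd; apply: (@nrm_lt k hk _ (ldeg E al be [set x])).
  have := net_le D [set x]; rewrite (cut_eqv _ hD) ldegE !sN1; lia.
rewrite (@nrm_cong k hk _ (t x)) //.
by move: hdiv; congr (is_true (divK _ _)); clear; lia.
Qed.

Definition smaller S E al be :=
  forall S' X' E' al' be' t', mu S' E' al' be' < mu S E al be ->
    inst S' X' E' al' be' t' -> solv S' E' al' be' t'.

(** A tight set splits the problem: the contracted graph inherits the cut conditions, and once it is
    oriented, the arcs at [A] become stubs of an instance on [A]. Its condition [i_reg] is the upper
    bound assumed for the degree of [A]. *)
Lemma step_contract S X E al be t A :
  inst S X E al be t -> smaller S E al be ->
  A \subset S -> 1 < #|A| -> A != S -> ldeg E al be A <= 2 * k - 2 + nrm k (sZ t A) ->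
  solv S E al be t.
Proof.
move=> I IH hA hA2 hAS hd.
have [a ha] : exists a, a \in A by apply/set0Pn; rewrite -card_gt0; lia.
pose cN (f : T -> nat) u := if u == a then sN f A else f u.
pose cZ (f : T -> int) u := if u == a then sZ f A else f u.
have cNE f B : B \subset cS S A a -> sN (cN f) B = sN f (bx A a B).
  by move=> hB; rewrite /sN /cN (bx_big ha addn f hB).
have cZE f B : B \subset cS S A a -> sZ (cZ f) B = sZ f (bx A a B).
  by move=> hB; rewrite /sZ /cZ (bx_big ha +%R f hB).
have ddC B : B \subset cS S A a ->
  ldeg (gcE A a (outE A E)) (cN al) (cN be) B = ldeg E al be (bx A a B).
  by move=> hB; rewrite !ldegE !cNE // (contract_cut _ hB).
have bxS : bx A a (cS S A a) = S.
  apply/setP => u; rewrite /bx /cS setU11 !inE.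
  case hu: (u \in A); rewrite ?orbT ?orbF /=; first by rewrite (subsetP hA).
  by case: (u =P a) => // h; rewrite h ha in hu.
have hAlt : #|A| < #|S| by apply: proper_card; rewrite properEneq hAS.
have hEsz : size (inE_ A E) + size (outE A E) = size E.
  by rewrite -size_cat (perm_size (split_inside A E)).
have I1 : inst (cS S A a) (X :\: A) (gcE A a (outE A E)) (cN al) (cN be) (cZ t).
  split.
  - exact: contract_good (i_good I).
  - by apply: leq_trans (i_X I); apply: subset_leq_card; apply: subsetDl.
  - move=> x; rewrite !inE => /andP [hx hxX]; rewrite /cZ.
    by case: eqP => [h|_]; [rewrite h ha in hx|apply: (i_Xt I)].
  - move=> x hx; have hs : [set x] \subset cS S A a by rewrite sub1set.
    have := ldeg_par I (bx_sub hA ha hs).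
    by rewrite -ddC // -cZE // sZ1.
  - by rewrite cZE ?cNE // !bxS; apply: i_sum I.
  - move=> B h1 h2 h3 h4; rewrite ddC // cZE //; apply: (i_cut I).
    + exact: bx_sub.
    + exact: bx_neq0.
    + exact: bx_neqS h3.
    (* The expansion of [B] can be the exempt [X] only if [a] is not in [B], as [A] has more than
       one vertex; then [B] is [X :\: A]. *)
    + apply: contraNneq h4; rewrite /bx; case: ifP => haB hX.
        have := i_X I; rewrite -hX => h5.
        by have := subset_leq_card (subsetUr B A); lia.
      rewrite -hX; apply/eqP/setP => u; rewrite !inE andb_idl // => huB.
      have := subsetP h1 _ huB; rewrite !inE => /orP [/eqP hu|/andP [] //].
      by rewrite hu haB in huB.
  - by rewrite !cNE // !bxS; apply: i_reg I.
have [|D1 [hD1 hs1]] := IH _ _ _ _ _ _ _ I1.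
  rewrite /mu size_map (cS_card hA ha) !sN_D !cNE // bxS.
  have : 2 * k * size (outE A E) <= 2 * k * size E.
    by rewrite leq_mul2l -hEsz leq_addl orbT.
  by move: hAlt hA2; clear; lia.
have [DB [hDB hDB1]] := ori_map hD1.
have hDBn := outE_not hDB.
(* Arcs of [DB] with their head in [A] are in-stubs there, those with their tail in [A] out-stubs;
   the degree of every subset of [A] stays the same. *)
pose al2 u := al u + ind DB [set u].
pose be2 u := be u + outd DB [set u].
have al2E B : sN al2 B = sN al B + ind DB B by rewrite /sN big_split /= -ind_sum.
have be2E B : sN be2 B = sN be B + outd DB B by rewrite /sN big_split /= -outd_sum.
have crE B : B \subset A -> cut E B = cut (inE_ A E) B + outd DB B + ind DB B.
  move=> hB; rewrite (cut_eqv _ (perm_eqv (split_inside A E))) cut_cat.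
  by rewrite -(cut_eqv _ hDB) (cut_io hB hDBn) addnA.
have dd2 B : B \subset A -> ldeg (inE_ A E) al2 be2 B = ldeg E al be B.
  by move=> hB; rewrite !ldegE al2E be2E crE //; clear; lia.
have crA0 : cut (inE_ A E) A = 0.
  rewrite -(@cut_compl _ (inE_ A E) A A); last exact: good_all2 (in_good A (i_good I)).
  rewrite setDv; apply/eqP; rewrite -leqn0 leqNgt -has_count; apply/hasPn => e _.
  by rewrite /cross !inE.
have haS1 : a \in cS S A a by rewrite !inE eqxx.
have netA : net D1 [set a] = net DB A by rewrite (net_perm _ hDB1) contract_netA.
have sumA : divK k (sZ t A + Posz (sN al2 A) - Posz (sN be2 A)).
  have [h _] := hs1 a haS1; rewrite netA /cZ /cN eqxx in h.
  rewrite -divKN; move: h; congr (is_true (divK _ _)).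
  by rewrite al2E be2E /net; clear; lia.
have I2 : inst A (X :&: A) (inE_ A E) al2 be2 t.
  split.
  - exact: (in_good A (i_good I)).
  - by apply: leq_trans (i_X I); apply: subset_leq_card; apply: subsetIl.
  - by move=> x; rewrite inE => /andP [hx _]; apply: (i_Xt I).
  - move=> x hx; rewrite dd2 ?sub1set //; apply: (i_par I).
    exact: (subsetP hA).
  - exact: sumA.
  - move=> B h1 h2 h3 h4; rewrite dd2 //; apply: (i_cut I) => //.
    + exact: subset_trans hA.
    + apply: contraNneq hAS => h; rewrite eqEsubset hA /=.
      by rewrite -h.
    + apply: contraNneq h4 => h; rewrite -h; apply/eqP/esym/setIidPl; exact: h1.
  - apply: regionP => //.
    have -> : nrm k (Posz (sN be2 A) - Posz (sN al2 A)) = nrm k (sZ t A).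
      apply: nrm_cong => //; rewrite -divKN; move: sumA.
      by congr (is_true (divK _ _)); clear; lia.
    by move: hd; rewrite -dd2 // ldegE crA0.
have [|DA [hDA hs2]] := IH _ _ _ _ _ _ _ I2.
  rewrite /mu.
  have h1 : \sum_(x in A) (al2 x + be2 x) = cut E A + \sum_(x in A) (al x + be x).
    by have := dd2 A (subxx A); rewrite /ldeg crA0.
  have h2 : cut E A <= size (outE A E).
    rewrite crE // crA0 add0n -(eqv_size hDB) -(cut_io (subxx A) hDBn).
    exact: count_size.
  have h3 : \sum_(x in A) (al x + be x) <= \sum_(x in S) (al x + be x).
    rewrite [leqRHS](big_setID A) /= (setIidPr hA); exact: leq_addr.
  rewrite h1 -hEsz mulnDr.
  have : size (outE A E) <= 2 * k * size (outE A E).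
    by rewrite -{1}[size _]mul1n leq_mul2r; move: hk; clear; lia.
  by move: h2 h3 hAlt; clear; lia.
exists (DA ++ DB); split.
  apply: eqv_trans (eqv_cat hDA hDB) _; rewrite eqv_sym.
  exact/perm_eqv/split_inside.
move=> x hx; rewrite net_cat; case hxA: (x \in A).
  have [h1 h2] := hs2 x hxA; rewrite /al2 /be2 in h1 h2.
  rewrite /net in h1 h2 *; split.
    by move: h1; congr (is_true (divK _ _)); clear; lia.
  by move: h2; congr (is_true (_ < _)); clear; lia.
have hgA : good A DA.
  by apply: good_eqv _ (in_good A (i_good I)); rewrite eqv_sym.
rewrite (net_out hgA) ?hxA // add0r.
have hx1 : x \in cS S A a by rewrite !inE hxA hx orbT.
have := hs1 x hx1; rewrite (net_perm _ hDB1) contract_net ?hxA // /cZ /cN.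
by case: eqP => // h; rewrite h ha in hxA.
Qed.

End Instances.

(** Turns booleans coerced to [nat] into variables, so that [lia] meets atoms. *)
Ltac gb := repeat match goal with
  | |- context [nat_of_bool ?b] => generalize (nat_of_bool b); let n := fresh "n" in intro n
  end.

(** * Slack, reversal and lifting *)

Section Steps.
Variables (T : finType) (k : nat).
Hypothesis hk : 2 <= k.
Implicit Types (E D : seq (T * T)) (A B S X : {set T}) (al be : T -> nat) (t : T -> int).

Definition slack S E al be t := forall A, A \subset S -> 1 < #|A| -> A != S ->
  2 * k + nrm k (sZ t A) <= ldeg E al be A.

(** Degree, demand and norm of a set have the same parity, so a set that is not tight exceeds the
    bound by at least 2. *)
Lemma slackP S X E al be t : inst k S X E al be t ->
  (forall A, A \subset S -> 1 < #|A| -> A != S ->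
     ~~ (ldeg E al be A <= 2 * k - 2 + nrm k (sZ t A))) -> slack S E al be t.
Proof.
move=> I h A h1 h2 h3; have := h A h1 h2 h3; have [j hj] := ldeg_par hk I h1.
have [i hi] := nrm_par hk (sZ t A); move: hj hi.
move: (sZ t A) (ldeg E al be A) (nrm k _) hk; clear; lia.
Qed.

Lemma mk_cut S X E al be t :
  (forall x, x \in S -> [set x] != X -> [set x] != S ->
     2 * k - 2 + nrm k (t x) <= ldeg E al be [set x]) ->
  (forall A, A \subset S -> 1 < #|A| -> A != S ->
     2 * k - 2 + nrm k (sZ t A) <= ldeg E al be A) ->
  forall A, A \subset S -> A != set0 -> A != S -> A != X ->
    2 * k - 2 + nrm k (sZ t A) <= ldeg E al be A.
Proof.
move=> h1 h2 A hA; rewrite -card_gt0 => hA0 hAS hAX.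
case: (ltnP 1 #|A|) => h; first exact: h2.
have /cards1P [x hx] : #|A| == 1 by lia.
by rewrite hx sZ1; rewrite hx in hA hAX hAS; apply: h1; rewrite // -sub1set.
Qed.

Lemma inst_exempt S X E al be t x : inst k S X E al be t ->
  X \subset [set x] -> divK k (t x) -> inst k S [set x] E al be t.
Proof.
move=> [h1 h2 h3 h4 h5 h6 h7] hX ht; split=> //.
- by rewrite cards1.
- by move=> u; rewrite inE => /eqP ->.
- move=> A a1 a2 a3 a4; apply: h6 => //; apply: contraNneq a4 => h.
  by rewrite eqEcard h hX cards1 -h card_gt0.
Qed.

Lemma inst_rev S X E al be t : inst k S X E al be t ->
  inst k S X E be al (fun u => - t u)%R.
Proof.
have hs A : sZ (fun u => - t u)%R A = (- sZ t A)%R by rewrite /sZ sumrN.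
have hd A : ldeg E be al A = ldeg E al be A by rewrite !ldegE; clear; lia.
move=> [h1 h2 h3 h4 h5 h6 h7]; split=> //.
- by move=> x /h3; rewrite divKN.
- move=> x /h4 [j hj]; rewrite hd.
  by exists (- Posz (ldeg E al be [set x]) - j)%R; move: hj; clear; lia.
- rewrite hs -divKN; move: h5; congr (is_true (divK _ _)); clear; lia.
- by move=> A *; rewrite hs nrmN // hd; apply: h6.
- by move: h7; rewrite /region minnC maxnC.
Qed.

Lemma solv_rev S E al be t :
  solv k S E be al (fun u => - t u)%R -> solv k S E al be t.
Proof.
move=> [D [h1 h2]]; exists [seq (a.2, a.1) | a <- D]; split.
  rewrite /eqv; have -> : map (@unordered T) [seq (a.2, a.1) | a <- D] = map (@unordered T) D.
    by rewrite -map_comp; apply: eq_map => -[a b]; rewrite /= uo_swap.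
  exact: h1.
have hn A : net [seq (a.2, a.1) | a <- D] A = (- net D A)%R.
  by rewrite /net opprB /outd /ind !count_map.
move=> x /h2 [h3 h4]; rewrite hn; split.
  by rewrite -divKN; move: h3; congr (is_true (divK _ _)); clear; lia.
by move: h4; congr (is_true (_ < _)); clear; lia.
Qed.

Lemma mu_sym S E al be : mu k S E be al = mu k S E al be.
Proof. by rewrite /mu; congr addn; apply: eq_bigr => u _; rewrite addnC. Qed.

(** When no vertex exceeds the tight degree, the bounds on net outdegrees are automatic, so a
    reduction has to preserve only the congruences. *)
Lemma solv_cong S E al be t : (exists D, eqv D E /\ forall x, x \in S ->
    divK k (net D [set x] - (t x + Posz (al x) - Posz (be x)))) ->
  (forall x, x \in S -> ldeg E al be [set x] <= 2 * k - 2 + nrm k (t x)) ->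
  solv k S E al be t.
Proof.
move=> [D [h1 h2]] h3; exists D; split=> // x hx; split; first exact: h2.
by apply: (tight_bound hk h1 (h2 x hx)); apply: h3.
Qed.

Lemma cross3 A (x y w : T) :
  cross A (x, y) + cross A (x, w) =
  cross A (y, w) + 2 * [|| [&& x \in A, y \notin A & w \notin A]
                        | [&& x \notin A, y \in A & w \in A]].
Proof.
by rewrite /cross /=; case: (x \in A); case: (y \in A); case: (w \in A).
Qed.

(** Replacing [xy] and [xw] by [yw] costs 2 for the sets that separate [x] from both [y] and [w],
    and nothing for others. Such a set is [[set x]], exempt or with slack by hypothesis, or it has
    more than one element, because [y != w], and then it has slack 2. *)
Lemma step_lift S X E al be t (x y w : T) E0 :
  inst k S X E al be t -> smaller k S E al be -> slack S E al be t -> x \in S ->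
  X = [set x] \/ 2 * k + nrm k (t x) <= ldeg E al be [set x] ->
  y != w -> eqv E ((x, y) :: (x, w) :: E0) -> solv k S E al be t.
Proof.
move=> I IH Sl hxS hx hyw hE.
have [/and3P [_ hyS hxy] /andP [/and3P [_ hwS hxw] hg0]] : 
  [&& x \in S, y \in S & x != y] /\ [&& x \in S, w \in S & x != w] && good S E0.
  by have /andP [] := good_eqv hE (i_good I).
pose E' := (y, w) :: E0.
have dE A : ldeg E al be A = ldeg E' al be A +
   2 * [|| [&& x \in A, y \notin A & w \notin A] | [&& x \notin A, y \in A & w \in A]].
  rewrite (ldeg_eqv _ _ _ hE) /E' /ldeg !cut_cons.
  by have := cross3 A x y w; clear; gb; lia.
have [||D [hD hs]] := IH S X E' al be t.
- by rewrite /mu (eqv_size hE) /=; move: hk; clear; lia.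
- split.
  + by rewrite /good /= hyS hwS hyw.
  + exact: i_X I.
  + exact: (i_Xt I).
  + move=> u hu; have [j ->] := i_par I hu; rewrite dE.
    by eexists; rewrite PoszD -addrA PoszM -mulrDr.
  + exact: i_sum I.
  + apply: mk_cut => [u hu hX hu1|A h1 h2 h3].
      case: (u =P x) => [hux|/eqP hux].
        case: hx => [hx|]; first by rewrite hux hx eqxx in hX.
        by rewrite hux dE; move: hk; clear; case: (_ || _) => /=; lia.
      have := i_cut I; move/(_ [set u]); rewrite sub1set hu hX hu1 sZ1 dE.
      have -> : ([set u] != set0) by rewrite -card_gt0 cards1.
      move/(_ isT isT isT isT); rewrite !inE eq_sym (negPf hux) /=.
      by case: (y =P u) => [h|] //; case: (w =P u) => [h'|] //=; rewrite ?muln0 ?addn0 //;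
        rewrite h h' eqxx in hyw.
    have := Sl A h1 h2 h3; rewrite dE; move: hk; clear; case: (_ || _) => /=; lia.
  + exact: i_reg I.
have [D1 [D2 [h1 h2 h3]]] := @ori_cat _ [:: (y, w)] E0 D hD.
have [a [ha1 ha2]] : exists a, D1 = [:: a] /\ (a = (y, w) \/ a = (w, y)).
  have := eqv_size h1; case: D1 h1 h3 => [|a [|]] //= h1 _ _; exists a; split=> //.
  have := eqv_mem h1 (mem_head _ _); rewrite !inE => -[/eqP ->|/eqP h]; first by left.
  by right; case: a h {h1} => a b /= [-> ->].
have hsame D' : eqv D' [:: (x, y); (x, w)] -> 
  (forall u, net D' [set u] = net [:: a] [set u]) -> solv k S E al be t.
  move=> g1 g2; exists (D' ++ D2); split.
    by rewrite eqv_sym in hE; apply: eqv_trans hE; exact: (eqv_cat g1 h2).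
  move=> u /hs; rewrite (net_perm _ h3) !net_cat ha1 g2 //.
case: ha2 => ha.
  apply: (hsame [:: (y, x); (x, w)]); first by apply: eqv_swap; apply: eqv_refl.
  by move=> u; rewrite ha !net_cons /= !inE; clear; lia.
apply: (hsame [:: (x, y); (w, x)]); first by apply/eqv_cons/eqv_swap/eqv_refl.
by move=> u; rewrite ha !net_cons /= !inE; clear; lia.
Qed.

Lemma pair_good S E (x y : T) E0 : good S E -> eqv E ((x, y) :: E0) ->
  [/\ x \in S, y \in S, x != y & good S E0].
Proof. by move=> hg hE; have /andP [/and3P [? ? ?] ?] := good_eqv hE hg. Qed.

(** The path from outside through [x] to [y] becomes an in-stub of [y]; afterwards [xy] is oriented
    from [x] to [y]. Only sets containing [x] but not [y] lose degree. *)
Lemma step_liftstub S X E al be t (x y : T) E0 :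
  inst k S X E al be t -> smaller k S E al be -> slack S E al be t ->
  X = [set x] \/ 2 * k + nrm k (t x) <= ldeg E al be [set x] ->
  0 < al x -> eqv E ((x, y) :: E0) -> solv k S E al be t.
Proof.
move=> I IH Sl hx hal hE.
have [hxS hyS hxy hg0] := pair_good (i_good I) hE.
pose al1 u := if u == x then (al x).-1 else al u.
pose al2 u := if u == y then (al y).+1 else al1 u.
have s1 A : sN al A = sN al1 A + (x \in A).
  have /(@sum_chgN T al1 al x A) : forall u, u != x -> al1 u = al u.
    by move=> u; rewrite /al1 => /negPf ->.
  rewrite -!/(sN _ _) {2}/al1 eqxx; case: (x \in A) => /=; move: hal; clear; lia.
have s2 A : sN al2 A = sN al1 A + (y \in A).
  have /(@sum_chgN T al2 al1 y A) : forall u, u != y -> al2 u = al1 u.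
    by move=> u; rewrite /al2 => /negPf ->.
  rewrite -!/(sN _ _) {2}/al2 /al1 eqxx eq_sym (negPf hxy).
  case: (y \in A) => /=; clear; lia.
have dE A : ldeg E al be A = ldeg E0 al2 be A + 2 * ((x \in A) && (y \notin A)).
  rewrite (ldeg_eqv _ _ _ hE) !ldegE !cut_cons s1 s2 /cross /=.
  case: (x \in A); case: (y \in A) => /=; clear; lia.
have sS : sN al2 S = sN al S by rewrite s1 s2 hxS hyS.
have [||D [hD hs]] := IH S X E0 al2 be t.
- have := eqv_size hE; rewrite /mu !sN_D sS /= => ->; move: hk; clear; lia.
- split.
  + exact: hg0.
  + exact: i_X I.
  + exact: (i_Xt I).
  + move=> u hu; have [j ->] := i_par I hu; rewrite dE.
    by eexists; rewrite PoszD -addrA PoszM -mulrDr.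
  + by rewrite sS; exact: i_sum I.
  + apply: mk_cut => [u hu hX hu1|A h1 h2 h3].
      case: (u =P x) => [hux|/eqP hux].
        case: hx => [hx|]; first by rewrite hux hx eqxx in hX.
        by rewrite hux dE; move: hk; clear; case: (_ && _) => /=; lia.
      have := i_cut I; move/(_ [set u]); rewrite sub1set hu hX hu1 sZ1 dE.
      have -> : ([set u] != set0) by rewrite -card_gt0 cards1.
      by move/(_ isT isT isT isT); rewrite !inE eq_sym (negPf hux) /= muln0 addn0.
    have := Sl A h1 h2 h3; rewrite dE; move: hk; clear; case: (_ && _) => /=; lia.
  + by rewrite sS; exact: i_reg I.
exists ((x, y) :: D); split.
  by rewrite eqv_sym in hE; apply: eqv_trans (eqv_cons _ hD) hE.
move=> u /hs; rewrite net_cons /= !inE /al2 /al1.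
case: (u =P y) => [->|huy].
  rewrite eqxx (negPf hxy) => -[h1 h2]; split.
    by move: h1; congr (is_true (divK _ _)); clear; lia.
  by move: h2; congr (is_true (_ < _)); clear; lia.
rewrite [y == u]eq_sym (introF eqP huy); case: (u =P x) => [->|hux].
  rewrite eqxx => -[h1 h2]; split.
    by move: h1; congr (is_true (divK _ _)); move: hal; clear; lia.
  by move: h2; congr (is_true (_ < _)); move: hal; clear; lia.
rewrite [x == u]eq_sym (introF eqP hux) subrr add0r //.
Qed.

(** [p] and [q] count the two directions of [m] parallel edges between [x] and [y], and [w] is the
    net outdegree that [y] has so far. Giving [p - q] the sign of [w] keeps [w - (p - q)] below
    [2k]. A nonzero class has representatives of both signs below [2k] in absolute value, and
    [m >= 2k] edges realise either. *)
Lemma choose_rep (t w : int) m : `|w| < 2 * k -> nrm k t = 0 \/ 2 * k <= m ->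
  (exists j : int, t = Posz m + 2 * j)%R ->
  exists p q, [/\ p + q = m, divK k (Posz p - Posz q - t),
    `|(Posz p - Posz q)%R| < 2 * k & `|(w - (Posz p - Posz q))%R| < 2 * k].
Proof.
move=> hw hm [j hj]; have [y [hy1 hy2]] := nrm_rep hk t.
have hyk := nrm_lek hk t.
have mk (u : int) : `|u| <= m -> divK k (u - t) -> `|u| < 2 * k ->
    `|(w - u)%R| < 2 * k ->
  exists p q, [/\ p + q = m, divK k (Posz p - Posz q - t),
    `|(Posz p - Posz q)%R| < 2 * k & `|(w - (Posz p - Posz q))%R| < 2 * k].
  move=> h1 /[dup] /dvdzP [i hi] h2 h3 h4.
  have [i' hi'] : exists i', u = (Posz m + 2 * i')%R.
    by exists (j + i * Posz k)%R; move: hi hj; clear; lia.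
  exists `|(Posz m + i')%R|, `|i'|; have e1 : (Posz m + i' >= 0)%R by move: h1 hi'; clear; lia.
  have e2 : (i' <= 0)%R by move: h1 hi'; clear; lia.
  have e : (Posz `|(Posz m + i')%R| - Posz `|i'| = u)%R by move: e1 e2 hi'; clear; lia.
  by rewrite e; split=> //; move: e1 e2; clear; lia.
have hyt : divK k (y - t) by rewrite -divKN opprB.
have hyt1 : divK k (y - Posz (2 * k) - t).
  by rewrite addrAC; apply: divKB => //; apply: divKK.
have hyt2 : divK k (y + Posz (2 * k) - t).
  by rewrite addrAC; apply: divKD => //; apply: divKK.
case: (eqVneq y 0%R) => hy0.
  by apply: (mk y) => //; rewrite hy0; move: hw hk; clear; lia.
have {}hm : 2 * k <= m by case: hm => // h; move: hy2 hy0; rewrite h; clear; lia.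
case: (lerP 0 y) => hy; case: (lerP 0 w) => hw0.
- by apply: (mk y) => //; move: hy2 hyk hw hm hy hw0 hk; clear; lia.
- by apply: (mk (y - Posz (2 * k))%R) => //; move: hy0 hy2 hyk hw hm hy hw0 hk; clear; lia.
- by apply: (mk (y + Posz (2 * k))%R) => //; move: hy0 hy2 hyk hw hm hy hw0 hk; clear; lia.
- by apply: (mk y) => //; move: hy2 hyk hw hm hy hw0 hk; clear; lia.
Qed.

End Steps.

(** * Removing a vertex of demand 0 or of too large degree *)

Section Steps.
Variables (T : finType) (k : nat).
Hypothesis hk : 2 <= k.
Implicit Types (E D : seq (T * T)) (A B S X : {set T}) (al be : T -> nat) (t : T -> int).

Lemma sN_D1 al S x : x \in S -> sN al S = al x + sN al (S :\ x).
Proof. by move=> hx; rewrite /sN (big_setD1 x). Qed.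
Lemma sZ_D1 t S x : x \in S -> sZ t S = (t x + sZ t (S :\ x))%R.
Proof. by move=> hx; rewrite /sZ (big_setD1 x). Qed.

(** All edges at [x] lead to [y], so lifting would create loops. Instead [y] takes over the demand
    of [x], and the parallel edges are oriented afterwards by [choose_rep]. *)
Lemma step_merge S X E al be t (x y : T) m E0 :
  inst k S X E al be t -> smaller k S E al be -> x \in S ->
  X \subset [set x] -> X = [set x] \/ 2 * k + nrm k (t x) <= ldeg E al be [set x] ->
  al x = 0 -> be x = 0 -> 0 < m -> good (S :\ x) E0 ->
  eqv E (nseq m (x, y) ++ E0) -> solv k S E al be t.
Proof.
move=> I IH hxS hX hx hal hbe hm hg0 hE.
have [hyS hyx] : y \in S /\ y != x.
  have := good_eqv hE (i_good I); case: m hm {hE} => // m _ /andP [/and3P [? ? ?] _].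
  by rewrite eq_sym.
pose t' u := if u == y then (t y + t x)%R else t u.
pose ex B := if y \in B then x |: B else B.
have crn A : cut (nseq m (x, y)) A = m * cross A (x, y).
  by rewrite /cut count_nseq mulnC.
have exS B : B \subset S :\ x -> ex B \subset S.
  move=> hB; have h : B \subset S by apply: subset_trans hB (subsetDl _ _).
  by rewrite /ex; case: ifP => // _; rewrite subUset sub1set hxS h.
have xB B : B \subset S :\ x -> x \notin B.
  by move=> hB; apply/negP => /(subsetP hB); rewrite !inE eqxx.
have exN al1 B : al1 x = 0 -> B \subset S :\ x -> sN al1 (ex B) = sN al1 B.
  move=> h0 hB; rewrite /ex; case: ifP => // _.
  by rewrite /sN big_setU1 ?xB //= h0.
have exZ B : B \subset S :\ x -> sZ t' B = sZ t (ex B).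
  move=> hB; have := @sum_chgZ T t' t y B; rewrite -!/(sZ _ _) => ->; last first.
    by move=> u; rewrite /t' => /negPf ->.
  rewrite /ex /t' eqxx; case: ifP => _; last by rewrite addr0.
  rewrite [in RHS]/sZ big_setU1 ?xB //= -/(sZ t B); clear; lia.
have xE0 B : B \subset S :\ x -> cut E0 (x |: B) = cut E0 B.
  move=> hB; apply: eq_in_count => e he; rewrite /cross !inE.
  have /and3P [] := allP hg0 _ he; rewrite !inE => /andP [h1 _] /andP [h2 _] _.
  by rewrite (negPf h1) (negPf h2).
have exC B : B \subset S :\ x -> cut E (ex B) = cut E0 B.
  move=> hB; rewrite (cut_eqv _ hE) cut_cat crn /ex; case: ifP => hy.
    by rewrite xE0 // /cross /= !inE eqxx hy orbT muln0.
  by rewrite /cross /= hy (negPf (xB B hB)) muln0.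
have exD B : B \subset S :\ x -> ldeg E0 al be B = ldeg E al be (ex B).
  by move=> hB; rewrite !ldegE !exN // exC.
have exF : ex (S :\ x) = S by rewrite /ex !inE hyx hyS /= setD1K.
have hmx : ldeg E al be [set x] = m.
  rewrite ldegE !sN1 hal hbe !addn0 (cut_eqv _ hE) cut_cat crn /cross /= !inE eqxx.
  rewrite (negPf hyx) muln1 -[RHS]addn0; congr addn.
  by rewrite -[[set x]]setU0 xE0 ?sub0set //; apply/eqP; rewrite -leqn0 leqNgt
    -has_count; apply/hasPn => e _; rewrite /cross !inE.
have hyS' : y \in S :\ x by rewrite !inE hyx hyS.
have [||D [hD hs]] := IH (S :\ x) set0 E0 al be t'.
- rewrite /mu (eqv_size hE) size_cat size_nseq.
  rewrite (cardsD1 x S) hxS [in ltnRHS](big_setD1 x) //= hal hbe mulnDr.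
  by clear; lia.
- split=> //.
  + by rewrite cards0.
  + by move=> u; rewrite inE.
  + move=> u hu; have hs : [set u] \subset S :\ x by rewrite sub1set.
    by have := ldeg_par hk I (exS _ hs); rewrite -exD // -exZ // sZ1.
  + have := i_sum I; rewrite !(sN_D1 _ hxS) hal hbe.
    by rewrite exZ // exF.
  + move=> B h1 h2 h3 _; rewrite exD // exZ //; apply: (i_cut I).
    * exact: exS.
    * move/set0Pn: h2 => [u hu]; apply/set0Pn; exists u; rewrite /ex; case: ifP => //.
      by rewrite !inE hu orbT.
    * apply: contraNneq h3 => h; apply/eqP/setP => u; rewrite -{}h.
      rewrite /ex; case: ifP => _; rewrite !inE; case: (u =P x) => // ->.
        by rewrite (negPf (xB B h1)).
      by rewrite (negPf (xB B h1)).
    * apply/eqP => h; move/set0Pn: h2 => [u hu].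
      have : u \in ex B by rewrite /ex; case: ifP => //; rewrite !inE hu orbT.
      rewrite h => /(subsetP hX); rewrite inE => /eqP hux.
      by have := xB B h1; rewrite -hux hu.
  + by have := i_reg I; rewrite !(sN_D1 _ hxS) hal hbe.
have [hy1 hy2] := hs y hyS'.
have [|||p [q [h1 h2 h3 h4]]] := @choose_rep k hk (t x) (net D [set y] - Posz (al y) + Posz (be y))%R m.
- exact: hy2.
- case: hx => hx; [left|right]; last by move: hx; rewrite hmx; clear; lia.
  by apply: nrm0 => //; apply: (i_Xt I); rewrite hx inE.
- by have := i_par I hxS; rewrite hmx.
exists (nseq p (x, y) ++ nseq q (y, x) ++ D); split.
  rewrite eqv_sym in hE; apply: eqv_trans hE; rewrite catA; apply: eqv_cat => //.
  by rewrite /eqv map_cat !map_nseq (uo_swap y x) -h1 nseqD perm_refl.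
have nn a n A : net (nseq n a) A = (Posz n * ((a.1 \in A)%:Z - (a.2 \in A)%:Z))%R.
  rewrite /net /outd /ind !count_nseq.
  by case: (a.1 \in A); case: (a.2 \in A); clear; lia.
move=> u hu; rewrite !net_cat !nn /= !inE.
case: (u =P x) => [->|/eqP hux].
  rewrite eqxx (negPf hyx) (net_out (S := S :\ x)); last by rewrite !inE eqxx.
    rewrite hal hbe; split.
      by move: h2; congr (is_true (divK _ _)); clear; lia.
    by move: h3; congr (is_true (_ < _)); clear; lia.
  by apply: good_eqv hg0; rewrite eqv_sym.
rewrite [x == u]eq_sym (negPf hux).
have := hs u; rewrite !inE hux hu /t' => /(_ isT).
case: (u =P y) => [->|/eqP huy].
  rewrite eqxx => -[g1 g2]; split.
    have := divKB g1 h2; congr (is_true (divK _ _)); clear; lia.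
  by move: h4; congr (is_true (_ < _)); clear; lia.
by rewrite [y == u]eq_sym (negPf huy) subrr !mulr0 !add0r.
Qed.

Lemma step_iso S E al be t x :
  inst k S [set x] E al be t -> smaller k S E al be -> x \in S ->
  al x = 0 -> be x = 0 -> good (S :\ x) E -> solv k S E al be t.
Proof.
move=> I IH hxS hal hbe hg.
have hsub B : B \subset S :\ x -> B \subset S.
  by move=> hB; apply: subset_trans hB (subsetDl _ _).
have htx : divK k (t x) by apply: (i_Xt I); rewrite inE.
have [||D [hD hs]] := IH (S :\ x) set0 E al be t.
- rewrite /mu (cardsD1 x S) hxS [in ltnRHS](big_setD1 x) //= hal hbe; clear; lia.
- split=> //.
  + by rewrite cards0.
  + by move=> u; rewrite inE.
  + by move=> u; rewrite !inE => /andP [_ hu]; apply: (i_par I).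
  + have := i_sum I; rewrite !(sN_D1 _ hxS) hal hbe (sZ_D1 _ hxS) => h.
    have := divKB h htx; congr (is_true (divK _ _)); clear; lia.
  + move=> B h1 h2 h3 _; apply: (i_cut I) => //; first exact: hsub.
      by apply/eqP => h; have := subsetP h1 x; rewrite h hxS !inE eqxx => /(_ isT).
    by apply/eqP => h; have := subsetP h1 x; rewrite h !inE eqxx => /(_ isT).
  + by have := i_reg I; rewrite !(sN_D1 _ hxS) hal hbe.
exists D; split=> // u hu; case: (u =P x) => [->|/eqP hux].
  rewrite (net_out (S := S :\ x)); last by rewrite !inE eqxx.
    rewrite hal hbe; split; last by move: hk; clear; lia.
    by rewrite -divKN; move: htx; congr (is_true (divK _ _)); clear; lia.
  by apply: good_eqv hg; rewrite eqv_sym.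
by apply: hs; rewrite !inE hux hu.
Qed.

(** A stub and an edge, or edges to two different neighbours, can be lifted. If there is no such
    pair, then all edges at [x] are parallel and [x] is merged, or [x] has no edge at all. *)
Lemma step_two S X E al be t x :
  inst k S X E al be t -> smaller k S E al be -> slack k S E al be t -> x \in S ->
  1 < #|S| ->
  X \subset [set x] -> X = [set x] \/ 2 * k + nrm k (t x) <= ldeg E al be [set x] ->
  solv k S E al be t.
Proof.
move=> I IH Sl hxS hS2 hX hx.
have hsp := split_vertex x E; have hsz := nbrs_size x (i_good I).
have hrg := rest_good x (i_good I).
have hnb u := @nbrs_mem _ S x E u (i_good I).
case hl: (nbrs x E) => [|y l] in hsp hsz hnb.
  have hg : good (S :\ x) E by apply: good_eqv hrg; rewrite eqv_sym.
  have hSx0 : S :\ x != set0.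
    by rewrite -card_gt0; move: hS2; rewrite (cardsD1 x S) hxS; clear; lia.
  have hSxS : S :\ x != S.
    by apply/eqP => h; have : x \in S :\ x; [rewrite h|rewrite !inE eqxx].
  have hSxX : S :\ x != X.
    apply/eqP => h; case/set0Pn: hSx0 => u; rewrite h => hu.
    have := subsetP hX _ hu; rewrite inE => /eqP hux.
    by move: hu; rewrite -h hux !inE eqxx.
  (* No edge leaves [x], so the stubs of [S :\ x] alone number at least
     [2k - 2 + nrm k (sZ t (S :\ x))]. The upper bound on all stubs leaves at most [nrm k (t x)] for
     [x]: none if [x] is exempt, too few if [x] has slack. *)
  have := i_cut I (subsetDl _ _) hSx0 hSxS hSxX.
  rewrite ldegE (cut_compl _ (good_all2 (i_good I))) -hsz /= add0n => h1.
  have := region_le hk (i_reg I); rewrite !(sN_D1 _ hxS).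
  have h2 : nrm k (Posz (sN be S) - Posz (sN al S)) <= nrm k (t x) + nrm k (sZ t (S :\ x)).
    apply: leq_trans (nrmD hk _ _); rewrite -(sZ_D1 _ hxS).
    rewrite (@nrm_cong _ hk (Posz (sN be S) - Posz (sN al S)) (sZ t S)) //.
    by rewrite -divKN; have := i_sum I; congr (is_true (divK _ _)); clear; lia.
  move: h2; rewrite !(sN_D1 _ hxS) => h2 h3.
  have h4 : al x + be x <= nrm k (t x) by move: h1 h2 h3; clear; lia.
  case: hx => hx.
    rewrite hx in I; rewrite (nrm0 hk) in h4; last by apply: (i_Xt I); rewrite inE.
    by apply: (step_iso I IH) => //; move: h4; clear; lia.
  by move: hx; rewrite ldegE !sN1 -hsz /=; move: h4 hk; clear; lia.
have hE1 : eqv E ((x, y) :: [seq (x, u) | u <- l] ++ rest x E) by [].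
case hal: (al x) => [|p]; last first.
  by apply: (step_liftstub hk I IH Sl hx _ hE1); rewrite hal.
case hbe: (be x) => [|p]; last first.
  apply: solv_rev; apply: (step_liftstub hk (inst_rev hk I) _ _ _ _ hE1).
  - by move=> S' X' E' al' be' t'; rewrite (mu_sym k S E al be); apply: IH.
  - move=> A h1 h2 h3; rewrite /sZ sumrN nrmN // -/(sZ t A).
    by have := Sl A h1 h2 h3; rewrite !ldegE; clear; lia.
  - rewrite nrmN //; case: hx => hx; [by left|right].
    by move: hx; rewrite !ldegE; clear; lia.
  - by rewrite hbe.
case hh: (has (predC1 y) l).
  case/hasP: hh => w hw hwy; have hp := perm_to_rem hw.
  have hE2 : eqv E ((x, y) :: (x, w) :: [seq (x, u) | u <- rem w l] ++ rest x E).
    apply: eqv_trans hE1 _; apply: eqv_cons.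
    apply: (@eqv_cat _ _ ((x, w) :: _)); last exact: eqv_refl.
    exact/perm_eqv/(perm_map (pair x) hp).
  by apply: (step_lift hk I IH Sl hxS hx _ hE2); rewrite eq_sym.
have hl1 : y :: l = nseq (size l).+1 y.
  have /all_pred1P : all (pred1 y) (y :: l) => //.
  rewrite /= eqxx /=; move/negbT: hh; rewrite -all_predC.
  by apply: sub_all => u /=; rewrite negbK.
apply: (step_merge (m := (size l).+1) (x := x) (y := y) (E0 := rest x E) I IH) => //.
by move: hsp; rewrite {1}hl1 map_nseq.
Qed.

End Steps.

(** * Tight instances without zero demands, and the induction *)

Section Steps.
Variables (T : finType) (k : nat).
Hypothesis hk : 2 <= k.
Implicit Types (E D : seq (T * T)) (A B S X : {set T}) (al be : T -> nat) (t : T -> int).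

Definition addZ t (x : T) (c : int) u := if u == x then (t x + c)%R else t u.

Lemma sZ_add t x c A : sZ (addZ t x c) A = (sZ t A + if x \in A then c else 0)%R.
Proof.
rewrite /sZ (@sum_chgZ T (addZ t x c) t x A); last first.
  by move=> u; rewrite /addZ => /negPf ->.
by rewrite /addZ eqxx; case: ifP; clear; lia.
Qed.

Definition tight S E al be t :=
  forall x, x \in S -> ldeg E al be [set x] <= 2 * k - 2 + nrm k (t x).

Lemma nrm_sub1 (x : int) : nrm k (x - 1) <= (nrm k x).+1.
Proof. by have := nrmD hk x (-1); have := nrm_abs hk (-1); clear; lia. Qed.
Lemma nrm_add1 (x : int) : nrm k (x + 1) <= (nrm k x).+1.
Proof. by have := nrmD hk x 1; have := nrm_abs hk 1; clear; lia. Qed.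

(** The hypothesis is the working definition of a positive demand. The only ambiguous class, that of
    [-k], is also the class of [k]. *)
Lemma nrm_pos (x : int) : nrm k (x - 1) < nrm k x -> divK k (x - Posz (nrm k x)).
Proof.
move=> hx; have [z [hz1 hz2]] := nrm_rep hk x.
case: (lerP 0 z) => hz0; first by rewrite -hz2 (_ : Posz `|z| = z) //; lia.
have hzk : z = (- Posz k)%R.
  move: hx; rewrite (@nrm_cong _ hk (x - 1) (z - 1)); last first.
    by move: hz1; congr (is_true (divK _ _)); clear; lia.
  rewrite -hz2; have := nrm_lek hk x; rewrite -hz2.
  have [j' ->] := nrm_ex hk (z - 1).
  case: (lerP 1 j') => hj'.
    have : (1 * Posz (2 * k) <= j' * Posz (2 * k))%R by apply: ler_wpM2r.
    by move: hz0 hk; clear; lia.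
  case: (lerP j' (-1)) => hj''; last first.
    have -> : j' = 0%R by move: hj' hj''; clear; lia.
    by move: hz0; clear; lia.
  have : (j' * Posz (2 * k) <= -1 * Posz (2 * k))%R by apply: ler_wpM2r.
  by move: hz0 hk; clear; lia.
have := divKB hz1 (divKK k); rewrite -hz2 hzk; congr (is_true (divK _ _)); clear; lia.
Qed.

Lemma set1_neq0 (x : T) : [set x] != set0.
Proof. by rewrite -card_gt0 cards1. Qed.

(** The edge is oriented from [x] to [y] and deleted. Both demands move towards 0, so the bounds at
    [x] and [y] survive the loss of one degree; for larger sets degree and norm each change by at
    most 1, within the slack. *)
Lemma step_dec S E al be t (x y : T) E0 :
  inst k S set0 E al be t -> smaller k S E al be -> slack k S E al be t ->
  tight S E al be t -> eqv E ((x, y) :: E0) ->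
  nrm k (t x - 1) < nrm k (t x) -> nrm k (t y + 1) < nrm k (t y) ->
  solv k S E al be t.
Proof.
move=> I IH Sl Ti hE hx hy.
have [hxS hyS hxy hg0] := pair_good (i_good I) hE.
pose t' := addZ (addZ t x (-1)) y 1.
have hyx : y != x by rewrite eq_sym.
have tE A : sZ t' A = (sZ t A - (if x \in A then 1 else 0) + (if y \in A then 1 else 0))%R.
  by rewrite !sZ_add; case: (x \in A); case: (y \in A); clear; lia.
have dE A : ldeg E al be A = ldeg E0 al be A + ((x \in A) (+) (y \in A)).
  by rewrite (ldeg_eqv _ _ _ hE) !ldegE cut_cons /cross /=; clear; gb; lia.
have t1 u : t' u = (t u - (if x == u then 1 else 0) + (if y == u then 1 else 0))%R.
  by rewrite -(sZ1 t') tE sZ1 !inE.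
apply: (solv_cong hk _ Ti).
have [||D [hD hs]] := IH S set0 E0 al be t'.
- rewrite /mu (eqv_size hE) /=; move: hk; clear; lia.
- split.
  + exact: hg0.
  + by rewrite cards0.
  + by move=> u; rewrite inE.
  + move=> u hu; have [j hj] := i_par I hu; rewrite t1 hj dE !inE.
    case: (x =P u) => [hxu|_]; case: (y =P u) => [hyu|_] /=.
    * by rewrite hxu hyu eqxx in hxy.
    * by exists j; clear; lia.
    * by exists (j + 1)%R; clear; lia.
    * by exists j; clear; lia.
  + by rewrite tE hxS hyS; have := i_sum I; congr (is_true (divK _ _)); clear; lia.
  + apply: (mk_cut hk) => [u hu hX hu1|A h1 h2 h3].
      have := i_cut I; move/(_ [set u]); rewrite sub1set hu hX hu1 sZ1 dE.
      move/(_ isT isT isT isT); rewrite !inE t1.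
      case: (x =P u) => [hxu|_]; case: (y =P u) => [hyu|_] /=.
      * by rewrite hxu hyu eqxx in hxy.
      * by rewrite -hxu addr0 => h; move: h hx hk; clear; lia.
      * by rewrite -hyu subr0 => h; move: h hy hk; clear; lia.
      * by rewrite subr0 addr0 addn0.
    have := Sl A h1 h2 h3; rewrite dE tE.
    case: (x \in A); case: (y \in A) => /=.
    * by rewrite addn0 subrK; move: hk; clear; lia.
    * by rewrite addr0; have := nrm_sub1 (sZ t A); move: hk; clear; lia.
    * by rewrite subr0; have := nrm_add1 (sZ t A); move: hk; clear; lia.
    * by rewrite subr0 addr0; move: hk; clear; lia.
  + exact: i_reg I.
exists ((x, y) :: D); split.
  by rewrite eqv_sym in hE; apply: eqv_trans (eqv_cons _ hD) hE.
move=> u /hs [h _]; rewrite net_cons /= !inE; move: h; rewrite t1.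
by congr (is_true (divK _ _)); case: (x == u); case: (y == u); clear; lia.
Qed.

(** An out-stub serves one unit of a positive demand. Removing both keeps the bound at [x] and costs
    larger sets at most 2. *)
Lemma step_outstub S E al be t (x : T) :
  inst k S set0 E al be t -> smaller k S E al be -> slack k S E al be t ->
  tight S E al be t -> x \in S -> 0 < be x ->
  nrm k (t x - 1) < nrm k (t x) -> solv k S E al be t.
Proof.
move=> I IH Sl Ti hxS hbe hx.
pose t' := addZ t x (-1).
pose be1 u := if u == x then (be x).-1 else be u.
have s1 A : sN be A = sN be1 A + (x \in A).
  have /(@sum_chgN T be1 be x A) : forall u, u != x -> be1 u = be u.
    by move=> u; rewrite /be1 => /negPf ->.
  rewrite -!/(sN _ _) {2}/be1 eqxx; case: (x \in A) => /=; move: hbe; clear; lia.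
have tE A : sZ t' A = (sZ t A - (if x \in A then 1 else 0))%R.
  by rewrite !sZ_add; case: (x \in A); clear; lia.
have dE A : ldeg E al be A = ldeg E al be1 A + (x \in A).
  by rewrite !ldegE s1; clear; lia.
have t1 u : t' u = (t u - (if x == u then 1 else 0))%R by rewrite -(sZ1 t') tE sZ1 !inE.
have b1 u : be u = be1 u + (x == u) by rewrite -(sN1 be) s1 sN1 !inE.
apply: (solv_cong hk _ Ti).
have [||D [hD hs]] := IH S set0 E al be1 t'.
- by rewrite /mu !sN_D s1 hxS; clear; lia.
- split.
  + exact: i_good I.
  + by rewrite cards0.
  + by move=> u; rewrite inE.
  + move=> u hu; have [j hj] := i_par I hu; rewrite t1 hj dE !inE.
    by exists j; case: (x == u); clear; lia.
  + have := i_sum I; rewrite tE s1 hxS; congr (is_true (divK _ _)); clear; lia.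
  + apply: (mk_cut hk) => [u hu hX hu1|A h1 h2 h3].
      have := i_cut I; move/(_ [set u]); rewrite sub1set hu hX hu1 sZ1 dE.
      move/(_ isT isT isT isT); rewrite !inE t1.
      case: (x =P u) => [hxu|_] /=; last by rewrite subr0 addn0.
      by rewrite -hxu => h; move: h hx hk; clear; lia.
    have := Sl A h1 h2 h3; rewrite dE tE.
    case: (x \in A) => /=.
      by have := nrm_sub1 (sZ t A); move: hk; clear; lia.
    by rewrite subr0; move: hk; clear; lia.
  + by have := i_reg I; rewrite s1 hxS /region; clear; lia.
exists D; split=> // u /hs [h _]; move: h; rewrite t1 b1.
by congr (is_true (divK _ _)); case: (x == u); clear; lia.
Qed.

(* Trading the [al x] in-stubs of [x] for [k - 1] out-stubs moves the demand of
   every set containing [x] by at most the change of its degree, up to the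
   slack 2; it turns [x] into a vertex of the opposite sign. *)
Lemma step_switch S E al be t (x y : T) E0 :
  inst k S set0 E al be t -> smaller k S E al be -> slack k S E al be t ->
  tight S E al be t -> eqv E ((x, y) :: E0) -> (forall u, u \in S -> be u = 0) ->
  al x <= k - 1 ->
  nrm k (t x - 1) < nrm k (t x) -> nrm k (t y - 1) < nrm k (t y) ->
  solv k S E al be t.
Proof.
move=> I IH Sl Ti hE hbe hal hx hy.
have [hxS hyS hxy hg0] := pair_good (i_good I) hE.
have hyx : y != x by rewrite eq_sym.
(* [al x + k = al x + (k - 1) + 1]: the removed in-stubs, the new out-stubs, and the edge [xy],
   which is oriented from [y] to [x] and deleted. *)
pose t' := addZ (addZ t x (Posz (al x) + Posz k)) y (-1).
pose al1 u := if u == x then 0 else al u.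
pose be1 u := if u == x then k - 1 else be u.
have hbx := hbe x hxS.
have s1 A : sN al A = sN al1 A + (x \in A) * al x.
  have /(@sum_chgN T al1 al x A) : forall u, u != x -> al1 u = al u.
    by move=> u; rewrite /al1 => /negPf ->.
  rewrite -!/(sN _ _) {2}/al1 eqxx; case: (x \in A) => /=; clear; lia.
have s2 A : sN be1 A = sN be A + (x \in A) * (k - 1).
  have /(@sum_chgN T be1 be x A) : forall u, u != x -> be1 u = be u.
    by move=> u; rewrite /be1 => /negPf ->.
  rewrite -!/(sN _ _) {2}/be1 eqxx hbx; case: (x \in A) => /=; clear; lia.
have tE A : sZ t' A = (sZ t A + (if x \in A then Posz (al x) + Posz k else 0)
                        - (if y \in A then 1 else 0))%R.
  by rewrite !sZ_add; case: (x \in A); case: (y \in A); clear; lia.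
have dE A : ldeg E al be A + (x \in A) * (k - 1) =
    ldeg E0 al1 be1 A + ((x \in A) (+) (y \in A)) + (x \in A) * al x.
  rewrite (ldeg_eqv _ _ _ hE) !ldegE cut_cons /cross /= s1 s2.
  by clear; case: (x \in A); gb; lia.
have t1 u : t' u = (t u + (if x == u then Posz (al x) + Posz k else 0)
                        - (if y == u then 1 else 0))%R.
  by rewrite -(sZ1 t') tE sZ1 !inE.
have sb0 : sN be S = 0 by rewrite /sN big1.
apply: (solv_cong hk _ Ti).
have [||D [hD hs]] := IH S set0 E0 al1 be1 t'.
- rewrite /mu !sN_D (eqv_size hE) /= s1 s2 hxS; move: hk; clear; lia.
- split.
  + exact: hg0.
  + by rewrite cards0.
  + by move=> u; rewrite inE.
  + move=> u hu; have [j hj] := i_par I hu; rewrite t1 hj; have := dE [set u].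
    rewrite !inE; case: (x =P u) => [hxu|_]; case: (y =P u) => [hyu|_] /=.
    * by rewrite hxu hyu eqxx in hxy.
    * by move=> h; exists (j + 1 + Posz (al x))%R; move: h hk; clear; lia.
    * by move=> h; exists j; move: h; clear; lia.
    * by move=> h; exists j; move: h; clear; lia.
  + have := i_sum I; rewrite tE s2 s1 hxS hyS; congr (is_true (divK _ _)).
    by move: hk; clear; lia.
  + apply: (mk_cut hk) => [u hu hX hu1|A h1 h2 h3].
      have := i_cut I; move/(_ [set u]); rewrite sub1set hu hX hu1 sZ1.
      move/(_ isT isT isT isT); have := dE [set u]; rewrite !inE t1.
      case: (x =P u) => [hxu|_]; case: (y =P u) => [hyu|_] /=.
      * by rewrite hxu hyu eqxx in hxy.
      * rewrite -hxu subr0 => h h'.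
        (* Modulo [2k] the new demand is [z + al x - k]. Its absolute value fits the new degree by
           [z >= 1] if it is negative, and by [al x <= k - 1] otherwise. *)
        have hz1 := nrm_pos hx; set z := Posz (nrm k (t x)) in hz1.
        rewrite (@nrm_cong _ hk _ (z + (Posz (al x) + Posz k))); last first.
          by move: hz1; congr (is_true (divK _ _)); clear; lia.
        have := nrm_absB hk (z + (Posz (al x) + Posz k)).
        by move: h h' hx hal hk; rewrite /z; clear; lia.
      * by rewrite -hyu addr0 => h h'; move: h h' hy hk; clear; lia.
      * by rewrite subr0 addr0 => h h'; move: h h' hk; clear; lia.
    have := Sl A h1 h2 h3; have := dE A; rewrite tE.
    case: (x \in A); case: (y \in A) => /=.
    * have hu : nrm k (sZ t A + (Posz (al x) + Posz k) - 1) <=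
          nrm k (sZ t A) + nrm k (Posz (al x) + Posz k - 1).
        by rewrite -addrA; exact: (nrmD hk (sZ t A)).
      have := nrm_absB hk (Posz (al x) + Posz k - 1)%R.
      by move: hu hal hk; clear; lia.
    * rewrite subr0; have hu := nrmD hk (sZ t A) (Posz (al x) + Posz k)%R.
      have := nrm_absB hk (Posz (al x) + Posz k)%R.
      by move: hu hal hk; clear; lia.
    * by rewrite addr0; have := nrm_sub1 (sZ t A); move: hk; clear; lia.
    * by rewrite subr0 addr0; move: hk; clear; lia.
  (* There were no out-stubs, so now there are exactly [k - 1], which meets the bound on the smaller
     of the two counts. *)
  + by have := i_reg I; rewrite s2 s1 sb0 hxS /region; move: hk; clear; lia.
exists ((y, x) :: D); split.
  by rewrite eqv_sym in hE; apply: eqv_trans hE; apply: eqv_swap.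
move=> u hu; have [h _] := hs u hu; rewrite net_cons /= !inE; move: h; rewrite t1 /al1 /be1.
rewrite [u == x]eq_sym; case: (x =P u) => [hxu|_]; congr (is_true (divK _ _)).
  by rewrite -hxu hbx (negPf hyx); move: hk; clear; lia.
by case: (y == u); clear; lia.
Qed.

(** Without a crossing edge, the stubs of [A] and of [S :\: A] would number at least [2 (2k - 2)]
    plus both norms, more than the [2k - 2] plus the norm of the sum that the boundary allows. *)
Lemma cut_pos S X E al be t A : inst k S X E al be t -> X = set0 ->
  A \subset S -> A != set0 -> A != S -> 0 < cut E A.
Proof.
move=> I hX hA hA0 hAS; rewrite lt0n; apply/negP => /eqP h0.
have hAc0 : S :\: A != set0.
  apply: contra hAS; rewrite setD_eq0 => h; by rewrite eqEsubset hA h.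
have hAcS : S :\: A != S.
  apply/eqP => h; case/set0Pn: hA0 => u hu; have := subsetP hA _ hu.
  by rewrite -h !inE hu.
have := i_cut I hA hA0 hAS; rewrite hX hA0 => /(_ isT).
have := i_cut I (subsetDl S A) hAc0 hAcS; rewrite hX hAc0 => /(_ isT).
rewrite !ldegE (cut_compl _ (good_all2 (i_good I))) h0.
have sp (f : T -> nat) : sN f S = sN f A + sN f (S :\: A).
  by rewrite /sN (big_setID A) /= (setIidPr hA).
have sp' : (sZ t S = sZ t A + sZ t (S :\: A))%R.
  by rewrite /sZ (big_setID A) /= (setIidPr hA).
have := region_le hk (i_reg I).
rewrite (@nrm_cong _ hk (Posz (sN be S) - Posz (sN al S)) (sZ t S)); last first.
  by rewrite -divKN; have := i_sum I; congr (is_true (divK _ _)); clear; lia.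
rewrite sp'; have := nrmD hk (sZ t A) (sZ t (S :\: A)).
rewrite !sp; move: hk; clear; lia.
Qed.

Lemma modular_orientation_step S X E al be t :
  inst k S X E al be t -> smaller k S E al be -> solv k S E al be t.
Proof.
move=> I IH.
case: (leqP #|S| 1) => hS.
  exists E; split; first exact: eqv_refl.
  move=> x hx; have hS1 : S = [set x].
    by apply/esym/eqP; rewrite eqEcard sub1set hx cards1.
  have hn : net E [set x] = 0%R.
    have h := net_le E [set x].
    have : cut E [set x] = 0.
      apply/eqP; rewrite -leqn0 leqNgt -has_count; apply/hasPn => e he.
      have /and3P [] := allP (i_good I) _ he; rewrite hS1 !inE => /eqP -> /eqP ->.
      by rewrite eqxx.
    by move: h; clear; lia.
  have := i_sum I; have := i_reg I; rewrite hS1 !sN1 sZ1 => hr hd; rewrite hn.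
  split; first by rewrite -divKN; move: hd; congr (is_true (divK _ _)); clear; lia.
  by move: hr hk; rewrite /region; clear; lia.
case: (boolP [exists A : {set T}, [&& A \subset S, 1 < #|A|, A != S &
    ldeg E al be A <= 2 * k - 2 + nrm k (sZ t A)]]).
  by case/existsP=> A /and4P [h1 h2 h3 h4]; apply: (step_contract hk I IH h1).
move=> /existsPn hno.
have Sl : slack k S E al be t.
  apply: (slackP hk I) => A h1 h2 h3; have := hno A.
  by rewrite h1 h2 h3.
have [x0 hx0S] : exists x, x \in S by apply/set0Pn; rewrite -card_gt0; move: hS; clear; lia.
case: (set_0Vmem (X :&: S)) => [hXS|[x]]; last first.
  rewrite inE => /andP [hxX hxS].
  have hX : X = [set x].
    apply/eqP; rewrite eq_sym eqEcard sub1set hxX cards1; exact: i_X I.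
  by apply: (step_two hk I IH Sl hxS hS); rewrite hX //; left.
have {}I : inst k S set0 E al be t.
  case: I => h1 h2 h3 h4 h5 h6 h7; split=> //.
  - by rewrite cards0.
  - by move=> u; rewrite inE.
  - move=> A a1 a2 a3 _; apply: h6 => //; apply: contraNneq a2 => h.
    by rewrite -hXS h; apply/eqP/esym/setIidPl; rewrite -h.
case: (boolP [exists x in S, divK k (t x)]) => [/exists_inP [x hxS hd]|/exists_inPn hnz].
  have I' := inst_exempt I (sub0set [set x]) hd.
  by apply: (step_two hk I' IH Sl hxS hS) => //; left.
case: (boolP [exists x in S, 2 * k + nrm k (t x) <= ldeg E al be [set x]]).
  case/exists_inP=> x hxS hd.
  by apply: (step_two hk I IH Sl hxS hS); [rewrite sub0set|right].
move/exists_inPn => hnt.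
have Ti : tight S E al be t.
  move=> x hx; have := hnt x hx; have [j hj] := i_par I hx.
  have [i hi] := nrm_par hk (t x); move: hj hi.
  move: (t x) (ldeg E al be [set x]) (nrm k _) hk; clear; lia.
have hz x : x \in S -> 0 < nrm k (t x).
  by move=> hx; rewrite lt0n; apply: contra (hnz x hx) => /eqP /(nrm_eq0 hk).
(* The vertices of positive demand, including those of demand [k], which has both signs. *)
pose V := [set x in S | nrm k (t x - 1) < nrm k (t x)].
have hVS : V \subset S by apply/subsetP => u; rewrite inE => /andP [].
have hVc u : u \in S -> u \notin V -> nrm k (t u + 1) < nrm k (t u).
  by move=> hu; rewrite inE hu /= => h; case: (nrm_step hk (hz u hu)) => // h'; rewrite h' in h.
have pos S' E' al' be' t' : inst k S' set0 E' al' be' t' ->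
  smaller k S' E' al' be' -> slack k S' E' al' be' t' -> tight S' E' al' be' t' ->
  1 < #|S'| -> (forall u, u \in S' -> nrm k (t' u - 1) < nrm k (t' u)) ->
  solv k S' E' al' be' t'.
  move: hk; clear=> hk I IH Sl Ti hS hV.
  case: (boolP [exists x in S', 0 < be' x]) => [/exists_inP [x hx hbx]|/exists_inPn hbe].
    by apply: (step_outstub I IH Sl Ti hx hbx); apply: hV.
  have {}hbe u : u \in S' -> be' u = 0 by move/hbe; case: (be' u).
  (* Otherwise the vertices, at least two, have together [2k] in-stubs or more, but [region] allows
     at most [2k - 1]. *)
  have [x hx hal] : exists2 x, x \in S' & al' x <= k - 1.
    case: (boolP [exists x in S', al' x <= k - 1]) => [/exists_inP //|/exists_inPn h].
    have : \sum_(x in S') k <= sN al' S'.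
      by apply: leq_sum => u /h; move: hk; clear; lia.
    rewrite sum_nat_const; have := i_reg I; rewrite /region => hr.
    have : 2 * k <= #|S'| * k by rewrite leq_mul2r hS orbT.
    by move: hr hk; clear; lia.
  have [|x' [y [E0 [h1 h2 h3]]]] := @pick_edge _ E' [set x].
    apply: (cut_pos I) => //; first by rewrite sub1set.
      exact: set1_neq0.
    by apply/eqP => h; rewrite -h cards1 in hS.
  move: h1; rewrite inE => /eqP hx'; rewrite hx' in h3.
  have [_ hyS _ _] := pair_good (i_good I) h3.
  by apply: (step_switch I IH Sl Ti h3 hbe hal); apply: hV.
case: (eqVneq V S) => [hV|hV].
  by apply: (pos _ _ _ _ _ I IH Sl Ti hS) => u; rewrite -{1}hV inE => /andP [].
case: (eqVneq V set0) => [hV0|hV0]; last first.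
  have [|x [y [E0 [h1 h2 h3]]]] := @pick_edge _ E V; first exact: (cut_pos I).
  have [_ hyS _ _] := pair_good (i_good I) h3.
  apply: (step_dec I IH Sl Ti h3); first by move: h1; rewrite inE => /andP [].
  exact: hVc.
apply: solv_rev; apply: pos => //.
- exact: inst_rev I.
- by move=> S' X' E' al' be' t'; rewrite (mu_sym k S E al be); apply: IH.
- move=> A h1 h2 h3; rewrite /sZ sumrN nrmN // -/(sZ t A).
  by have := Sl A h1 h2 h3; rewrite !ldegE; clear; lia.
- by move=> u /Ti; rewrite !ldegE nrmN //; clear; lia.
move=> u hu; have -> : (- t u - 1 = - (t u + 1))%R by clear; lia.
by rewrite !nrmN //; apply: hVc => //; rewrite hV0 inE.
Qed.

Theorem modular_orientation S X E al be t : inst k S X E al be t -> solv k S E al be t.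
Proof.
have [n] := ubnP (mu k S E al be); elim: n S X E al be t => // n IHn S X E al be t hn I.
apply: (modular_orientation_step I) => S' X' E' al' be' t' hlt I'; apply: IHn I'.
exact: leq_trans hlt _.
Qed.

End Steps.

(** * Deleting a vertex by splitting off, with connected classes kept connected *)

Section Lifting.
Variable T : finType.
Implicit Types (C E D P : seq (T * T)) (A B S : {set T}) (l U : seq T).

Definition adjl E : rel T := [rel x y | ((x, y) \in E) || ((y, x) \in E)].
Definition conn S E := forall x y, x \in S -> y \in S -> connect (adjl E) x y.

Lemma adjl_sym E : connect_sym (adjl E).
Proof. by apply: sym_connect_sym => x y; rewrite /adjl /= orbC. Qed.

Lemma adjl_sub E E' : {subset E <= E'} -> subrel (connect (adjl E)) (connect (adjl E')).
Proof.
move=> h; apply: connect_sub => x y /orP [] /h hxy; apply: connect1; rewrite /adjl /= hxy //.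
by rewrite orbT.
Qed.

Lemma conn_sub S E E' : {subset E <= E'} -> conn S E -> conn S E'.
Proof. by move=> h hc x y hx hy; apply: (adjl_sub h); apply: hc. Qed.

(** [l] lists the far ends of the edges of one class at the deleted vertex, [C] is the rest of that
    class, [U] a pool of far ends of spare edges. Some [u] of the pool is joined to a [y] in [l]
    outside its component, and [l] without [y] still meets every component. If all of [l] lies in
    the component of [u], then [C] is already connected and everything left is spare. *)
Lemma absorb S C l U :
  (forall x, x \in S -> exists2 y, y \in l & connect (adjl C) x y) ->
  0 < size l <= (size U).+1 -> {subset l <= S} -> {subset U <= S} ->
  exists P U', [/\ conn S (C ++ P), good S P,
    perm_eq (l ++ U) (U' ++ map fst P ++ map snd P) & size P < size l].
Proof.
have [n] := ubnP (size l); elim: n C l U => // n IH C l U hn hd hs hlS hUS.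
case: l => [|y0 l0] // in hn hd hs hlS *; set l := y0 :: l0 in hn hd hs hlS *.
case hl0: l0 => [|y1 l1].
  exists [::], (l ++ U); split; rewrite ?cats0 //.
  move=> x y hx hy; have [a ha hxa] := hd x hx; have [b hb hyb] := hd y hy.
  move: ha hb hxa hyb; rewrite /l hl0 !inE => /eqP -> /eqP -> h1 h2.
  by apply: connect_trans h1 _; rewrite adjl_sym.
case: U => [|u U] in hs hUS *; first by rewrite /l hl0 /= in hs.
have huS : u \in S by apply: hUS; rewrite mem_head.
case hh: (has (fun y => ~~ connect (adjl C) u y) l); last first.
  exists [::], (l ++ u :: U); split; rewrite ?cats0 //.
  have hu y : y \in l -> connect (adjl C) u y.
    by move=> hy; apply: contraFT hh => h; apply/hasP; exists y.
  move=> x y hx hy; have [a ha hxa] := hd x hx; have [b hb hyb] := hd y hy.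
  apply: (@connect_trans _ _ u).
    by apply: connect_trans hxa _; rewrite adjl_sym; apply: hu.
  by apply: connect_trans (hu b hb) _; rewrite adjl_sym.
case/hasP: hh => y hy huy.
have hp := perm_to_rem hy.
have hsz : size (rem y l) = (size l).-1 by rewrite size_rem.
have hsub : {subset C <= (u, y) :: C} by move=> e he; rewrite inE he orbT.
have huyE : connect (adjl ((u, y) :: C)) u y by apply: connect1; rewrite /adjl /= mem_head.
have [|||||P [U' [h1 h2 h3 h4]]] := IH ((u, y) :: C) (rem y l) U.
- by rewrite hsz; move: hn; rewrite /l /=; clear; lia.
- move=> x hx; have [a ha hxa] := hd x hx.
  case: (a =P y) => [hay|/eqP hay].
    have [b hb hub] := hd u huS; exists b.
      have : b \in y :: rem y l by rewrite -(perm_mem hp).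
      by rewrite inE => /orP [/eqP hby|//]; rewrite -hby hub in huy.
    rewrite hay in hxa.
    apply: (@connect_trans _ _ y); first exact: (adjl_sub hsub).
    apply: (@connect_trans _ _ u); first by rewrite adjl_sym.
    exact: (adjl_sub hsub).
  exists a; last exact: (adjl_sub hsub).
  have : a \in y :: rem y l by rewrite -(perm_mem hp).
  by rewrite inE (negPf hay).
- by rewrite hsz; move: hs; rewrite /l hl0 /=; clear; lia.
- by move=> x hx; apply: hlS; apply: mem_rem hx.
- by move=> x hx; apply: hUS; rewrite inE hx orbT.
exists ((u, y) :: P), U'; split.
- apply: conn_sub h1 => e; rewrite !inE !mem_cat !inE; case: (e == _); rewrite ?orbT //=.
- rewrite /good /= huS (hlS y hy) /= -/(good S P) h2 andbT.
  by apply: contraNneq huy => ->.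
- apply/permP => a; have := permP h3 a; have := permP hp a.
  by rewrite !count_cat /=; clear; lia.
- by move: h4; rewrite hsz /= /l hl0 /=; clear; lia.
Qed.

(** Follow a walk up to its first visit of [v]. *)
Lemma dom_nbrs S (v x : T) E : good S E -> connect (adjl E) x v -> x != v ->
  exists2 y, y \in nbrs v E & connect (adjl (rest v E)) x y.
Proof.
move=> hg /connectP [p]; elim: p x => [|a p IH] x /=.
  by move=> _ ->; rewrite eqxx.
case/andP=> hxa hp hv hxv.
case: (eqVneq a v) => hav.
  exists x => //; rewrite hav in hxa; apply/mapP.
  case/orP: hxa => he; [exists (x, v)|exists (v, x)]; rewrite ?mem_filter ?he /touch /= ?eqxx ?orbT //.
  by rewrite (negPf hxv).
have [y hy hay] := IH a hp hv hav; exists y => //.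
apply: connect_trans hay; apply: connect1.
by case/orP: hxa => he; rewrite /adjl /= !mem_filter /touch /= ?he ?(negPf hxv) ?(negPf hav) ?orbT.
Qed.

Lemma elim_colours S (l : nat -> seq T) (C : nat -> seq (T * T)) (cs : seq nat) U : uniq cs ->
  (forall i, i \in cs -> [/\ 0 < size (l i), {subset l i <= S} &
     forall x, x \in S -> exists2 y, y \in l i & connect (adjl (C i)) x y]) ->
  {subset U <= S} ->
  (0 < size cs -> \sum_(i <- cs) size (l i) < 2 * size cs + size U) ->
  exists Pf U', let PP := flatten (map Pf cs) in
    [/\ forall i, i \in cs -> conn S (C i ++ Pf i) /\ good S (Pf i),
     perm_eq (flatten (map l cs) ++ U) (U' ++ map fst PP ++ map snd PP)
     & size PP + size cs <= \sum_(i <- cs) size (l i)].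
Proof.
have [n] := ubnP (size cs); elim: n cs U => // n IH cs U hn hun hl hU hsz.
case: (posnP (size cs)) => [/size0nil ->|h0].
  by exists (fun=> [::]), U; split; rewrite //= ?cats0 ?big_nil.
have {}hsz := hsz h0.
have [i hi hiU] : exists2 i, i \in cs & size (l i) <= (size U).+1.
  apply/hasP; apply: contraLR hsz => /hasPn h; rewrite -leqNgt.
  have : \sum_(i <- cs) (size U).+2 <= \sum_(i <- cs) size (l i).
    by rewrite !big_seq; apply: leq_sum => i /h; clear; lia.
  rewrite big_const_seq count_predT iter_addn_0; apply: leq_trans.
  by case: (size cs) h0 => // s _; rewrite !mulSn; clear; nia.
have [h1 h2 h3] := hl i hi.
have [|P [U1 [a1 a2 a3 a4]]] := absorb h3 _ h2 hU; first by rewrite h1.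
have hp := perm_to_rem hi.
have hsr : size (rem i cs) = (size cs).-1 by rewrite size_rem.
have hinot : i \notin rem i cs by rewrite mem_rem_uniqF.
have szp : size (l i) + size U = size U1 + (size P + size P).
  by have := perm_size a3; rewrite !size_cat !size_map.
have hsum : \sum_(j <- cs) size (l j) = size (l i) + \sum_(j <- rem i cs) size (l j).
  by rewrite (perm_big _ hp) /= big_cons.
have hlt : size (l i) + \sum_(j <- rem i cs) size (l j) < 2 * size cs + size U ->
    \sum_(j <- rem i cs) size (l j) < 2 * size (rem i cs) + size U1.
  rewrite hsr; move: (\sum_(j <- _) _) szp a4 h0 h1 => s'; clear; lia.
have [|||||Pf [U' [b1 b2 b3]]] := IH (rem i cs) U1.
- by rewrite hsr; move: hn h0; clear; lia.
- exact: rem_uniq.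
- by move=> j /mem_rem; apply: hl.
- move=> u hu; have : u \in l i ++ U by rewrite (perm_mem a3) mem_cat hu.
  by rewrite mem_cat => /orP [/h2|/hU].
- by move=> _; apply: hlt; rewrite -hsum.
pose Pf2 j := if j == i then P else Pf j.
have eqPf : map Pf2 (rem i cs) = map Pf (rem i cs).
  by apply/eq_in_map => j hj; rewrite /Pf2; case: eqP => // hji; move: hinot; rewrite -{1}hji hj.
have hPP : perm_eq (flatten (map Pf2 cs)) (P ++ flatten (map Pf (rem i cs))).
  have e : Pf2 i = P by rewrite /Pf2 eqxx.
  by have := perm_flatten (perm_map Pf2 hp); rewrite /= eqPf e.
exists Pf2, U'; split.
- move=> j hj; rewrite /Pf2; case: eqP => [->|/eqP hji]; first by [].
  by apply: b1; have := perm_mem hp j; rewrite hj inE (negPf hji) => /esym.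
- apply/permP => a; have := permP a3 a; have := permP b2 a.
  have := permP (perm_flatten (perm_map l hp)) a.
  have e1 := permP (perm_map fst hPP) a; have e2 := permP (perm_map snd hPP) a.
  by move: e1 e2; rewrite /= !map_cat !count_cat; clear; lia.
- have hszPP : size (flatten (map Pf2 cs)) = size P + size (flatten (map Pf (rem i cs))).
    by rewrite (perm_size hPP) size_cat.
  have b4 : size (flatten (map Pf (rem i cs))) + (size cs).-1
      <= \sum_(j <- rem i cs) size (l j) by rewrite -hsr.
  rewrite hszPP hsum; move: (\sum_(j <- _) _) b4 a4 h0 => s'; clear; lia.
Qed.

Lemma ends_eqv (p : pred T) E D : eqv E D ->
  count p (map fst E) + count p (map snd E) = count p (map fst D) + count p (map snd D).
Proof.
elim: E D => [|e E IH] D h.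
  by move/eqv_size: h; case: D.
have : unordered e \in map (@unordered T) D by rewrite -(perm_mem h) /= inE eqxx.
case/mapP=> e' he' heq; have hD := perm_to_rem he'.
have /IH : eqv E (rem e' D).
  by have := eqv_trans h (perm_eqv hD); rewrite /eqv /= heq perm_cons.
rewrite (permP (perm_map fst hD)) (permP (perm_map snd hD)) /=.
by case: (uo_eq heq) => -> /=; clear; lia.
Qed.

Lemma cut_set1 S E (y : T) : good S E ->
  cut E [set y] = count_mem y (map fst E) + count_mem y (map snd E).
Proof.
elim: E => [|e E IH] // /andP [/and3P [_ _ h] hg].
rewrite cut_cons (IH hg) /cross !inE /=.
case: (e.1 =P y) => [h1|_]; case: (e.2 =P y) => [h2|_] /=; try (clear; lia).
by rewrite h1 h2 eqxx in h.
Qed.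

(** Undoes a splitting-off: an arc becomes a path through [v], which alters no degree elsewhere and
    adds one to both the in- and the outdegree of [v]. *)
Definition through (v : T) (a : T * T) := [:: (a.1, v); (v, a.2)].

Lemma through_eqv v D :
  eqv (flatten (map (through v) D)) (map (pair v) (map fst D ++ map snd D)).
Proof.
elim: D => [|a D IH] //=.
apply: (@eqv_trans _ _ ((v, a.1) :: (v, a.2) :: [seq (v, y) | y <- map fst D ++ map snd D])).
  by apply: eqv_swap; apply: eqv_cons.
apply: perm_eqv; rewrite perm_cons !map_cat /=.
by rewrite -cat1s perm_catCA.
Qed.

Lemma through_outd v D y : y != v ->
  outd (flatten (map (through v) D)) [set y] = outd D [set y].
Proof.
move=> hy; elim: D => [|a D IH] //=; rewrite /outd /= in IH *; rewrite IH !inE.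
by rewrite [v == y]eq_sym (negPf hy); clear; lia.
Qed.
Lemma through_ind v D y : y != v ->
  ind (flatten (map (through v) D)) [set y] = ind D [set y].
Proof.
move=> hy; elim: D => [|a D IH] //=; rewrite /ind /= in IH *; rewrite IH !inE.
by rewrite [v == y]eq_sym (negPf hy); clear; lia.
Qed.
Lemma through_net v D S : good S D -> v \notin S ->
  net (flatten (map (through v) D)) [set v] = 0%R.
Proof.
move=> hg hv; elim: D hg => [|a D IH] //= /andP [/and3P [h1 h2 _] hg].
rewrite !net_cons IH //= !inE eqxx.
have -> : (a.1 == v) = false by apply: contraNF hv => /eqP <-.
have -> : (a.2 == v) = false by apply: contraNF hv => /eqP <-.
by clear; lia.
Qed.

End Lifting.

(** * Orienting a union of [2k - 2] connected classes with a degree bound *)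

Section TB.
Variables (T : finType).
Implicit Types (C E D P : seq (T * T)) (A B S : {set T}) (l U : seq T) (F : nat -> seq (T * T)).

Definition allE N F := flatten [seq F i | i <- iota 0 N].
Definition classes N S F := forall i, i < N -> good S (F i) /\ conn S (F i).

Lemma perm_flatten_cat (R : eqType) (f g : nat -> seq R) cs :
  perm_eq (flatten [seq f i ++ g i | i <- cs])
          (flatten [seq f i | i <- cs] ++ flatten [seq g i | i <- cs]).
Proof.
elim: cs => [|i cs IH] //=; apply/permP => a; have := permP IH a.
by rewrite !count_cat; clear; lia.
Qed.

Lemma split_all v F cs : eqv (flatten [seq F i | i <- cs])
  (map (pair v) (flatten [seq nbrs v (F i) | i <- cs]) ++ flatten [seq rest v (F i) | i <- cs]).
Proof.
elim: cs => [|i cs IH] //=; rewrite map_cat.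
apply: eqv_trans (eqv_cat (split_vertex v (F i)) IH) _; apply: perm_eqv.
by rewrite -!catA perm_cat2l perm_catCA.
Qed.

Lemma cut_flatten F cs A : cut (flatten [seq F i | i <- cs]) A = \sum_(i <- cs) cut (F i) A.
Proof.
elim: cs => [|i cs IH]; first by rewrite big_nil.
by rewrite big_cons /= cut_cat IH.
Qed.

Lemma good_flatten S F cs : (forall i, i \in cs -> good S (F i)) ->
  good S (flatten [seq F i | i <- cs]).
Proof.
elim: cs => [|i cs IH] //= h; rewrite good_cat h ?mem_head //=.
by apply: IH => j hj; apply: h; rewrite inE hj orbT.
Qed.

Lemma allE_good N S F : classes N S F -> good S (allE N F).
Proof. by move=> h; apply: good_flatten => i; rewrite mem_iota => /h []. Qed.

Lemma nbrs_pos S E v : good S E -> conn S E -> v \in S -> 1 < #|S| -> 0 < size (nbrs v E).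
Proof.
move=> hg hc hv hS.
have [x] : exists x, x \in S :\ v.
  by apply/set0Pn; rewrite -card_gt0; move: hS; rewrite (cardsD1 v) hv; clear; lia.
rewrite !inE => /andP [hxv hx].
by have [y] := dom_nbrs hg (hc x v hx hv) hxv; case: (nbrs v E).
Qed.

Lemma deg_lb N S F v : classes N S F -> v \in S -> 1 < #|S| -> N <= cut (allE N F) [set v].
Proof.
move=> h hv hS; rewrite cut_flatten -[leqLHS](size_iota 0) -sum1_size !big_seq.
apply: leq_sum => i; rewrite mem_iota => /h [hg hc].
by rewrite -(nbrs_size v hg); apply: nbrs_pos hc hv hS.
Qed.

(** [U'] lists the far ends of the edges at [v] that remain spare and can be directed at will; [q]
    paths pass through [v]. Each class forms fewer paths than it has edges at [v], so [q <= d - N]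
    for the degree [d] of [v], and at least [2N - d] edges are spare. *)
Lemma elim_vertex N S F v : classes N S F -> v \in S -> 1 < #|S| ->
  cut (allE N F) [set v] < 2 * N ->
  exists F' U', let E' := allE N F' in
   [/\ classes N (S :\ v) F', {subset U' <= S :\ v},
    2 * N <= size U' + cut (allE N F) [set v] /\
    (exists q, cut (allE N F) [set v] = size U' + 2 * q),
    forall y, y \in S :\ v ->
      cut (allE N F) [set y] = cut E' [set y] + count_mem y U'
    & forall D', eqv D' E' -> exists D0,
      [/\ eqv (D0 ++ map (pair v) U') (allE N F), net D0 [set v] = 0%R &
       forall y, y != v ->
        outd D0 [set y] = outd D' [set y] /\ ind D0 [set y] = ind D' [set y]]].
Proof.
move=> hF hv hS hd; pose cs := iota 0 N.
have hcs i : i \in cs -> good S (F i) /\ conn S (F i) by rewrite mem_iota => /hF.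
have hsum : \sum_(i <- cs) size (nbrs v (F i)) = cut (allE N F) [set v].
  by rewrite cut_flatten !big_seq; apply: eq_bigr => i /hcs [hg _]; apply: nbrs_size hg.
have [||||Pf [U' [h1 h2 h3]]] := @elim_colours T (S :\ v) (fun i => nbrs v (F i))
   (fun i => rest v (F i)) cs [::].
- exact: iota_uniq.
- move=> i /hcs [hg hc]; split.
  + exact: nbrs_pos hg hc hv hS.
  + by move=> u /(nbrs_mem hg) [hu huv]; rewrite !inE huv hu.
  + by move=> x; rewrite !inE => /andP [hxv hx]; apply: (dom_nbrs hg) => //; apply: hc.
- by [].
- by move=> _; rewrite hsum size_iota addn0.
set PP := flatten [seq Pf i | i <- cs] in h2 h3.
rewrite hsum size_iota cats0 in h2 h3.
pose R := flatten [seq rest v (F i) | i <- cs].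
pose L := flatten [seq nbrs v (F i) | i <- cs].
have hE : eqv (allE N F) (map (pair v) L ++ R) := split_all v F cs.
have hE' : perm_eq (allE N (fun i => rest v (F i) ++ Pf i)) (R ++ PP).
  exact: perm_flatten_cat.
have gR : good (S :\ v) R by apply: good_flatten => i /hcs [hg _]; apply: rest_good.
have gP : good (S :\ v) PP by apply: good_flatten => i /h1 [].
have hsz : cut (allE N F) [set v] = size U' + 2 * size PP.
  rewrite -hsum; have <- : size L = \sum_(i <- cs) size (nbrs v (F i)).
    by rewrite size_flatten /shape -map_comp sumnE big_map.
  have := perm_size h2; rewrite !size_cat !size_map -/L => ->.
  by rewrite addnn -mul2n.
exists (fun i => rest v (F i) ++ Pf i), U'; split.
- move=> i hi; have hics : i \in cs by rewrite mem_iota.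
  have [c1 c2] := h1 i hics; have [hg _] := hcs i hics.
  by split=> //; rewrite good_cat c2 rest_good.
- move=> u hu; have : u \in L by rewrite (perm_mem h2) mem_cat hu.
  case/flattenP=> l /mapP [i hi ->] hu'; have [hg _] := hcs i hi.
  by have [a1 a2] := nbrs_mem hg hu'; rewrite !inE a1 a2.
- split; last by exists (size PP).
  by move: h3 hsz hd; clear; lia.
- move=> y; rewrite !inE => /andP [hyv hy].
  rewrite (cut_eqv _ hE) (cut_eqv _ (perm_eqv hE')) !cut_cat (cut_set1 _ gP).
  have -> : cut [seq (v, u) | u <- L] [set y] = count_mem y L.
    rewrite /cut count_map; apply: eq_count => u; rewrite /cross /= !inE.
    by rewrite [v == y]eq_sym (negPf hyv).
  by rewrite (permP h2) !count_cat; clear; lia.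
move=> D' hD'; have {}hD' := eqv_trans hD' (perm_eqv hE').
have [DR [DP [d1 d2 d3]]] := ori_cat hD'.
have gDR : good (S :\ v) DR by apply: good_eqv gR; rewrite eqv_sym.
have gDP : good (S :\ v) DP by apply: good_eqv gP; rewrite eqv_sym.
exists (DR ++ flatten (map (through v) DP)); split.
- apply: (@eqv_trans _ _ (map (pair v) L ++ R)); last by rewrite eqv_sym.
  have e1 := through_eqv v DP.
  have e2 : perm_eq (map fst DP ++ map snd DP) (map fst PP ++ map snd PP).
    by apply/permP => a; rewrite !count_cat; apply: ends_eqv.
  apply: (eqv_trans (eqv_cat (eqv_cat d1 (eqv_trans e1 (perm_eqv (perm_map (pair v) e2))))
    (eqv_refl _))); apply: perm_eqv.
  rewrite -catA perm_catC perm_cat2r perm_catC.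
  by have := perm_map (pair v) h2; rewrite map_cat perm_sym.
- by rewrite net_cat (net_out gDR) ?(through_net gDP) ?inE ?eqxx.
- move=> y hy; rewrite /outd /ind !count_cat -!/(outd _ _) -!/(ind _ _).
  rewrite through_outd // through_ind // /outd /ind !(permP d3) !count_cat.
  by [].
Qed.

Lemma contract_conn S A a E : A \subset S -> a \in A -> conn S E ->
  conn (cS S A a) (gcE A a (outE A E)).
Proof.
move=> hA ha hc x y hx hy.
have gx u : u \in cS S A a -> gc A a u = u /\ u \in S.
  rewrite /gc !inE => /orP [/eqP ->|/andP [h1 h2]]; first by rewrite ha (subsetP hA).
  by rewrite (negPf h1).
have [ex hxS] := gx x hx; have [ey hyS] := gx y hy.
have := hc x y hxS hyS; rewrite -{2}ex -{2}ey => /connectP [p].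
elim: p x {hx hxS ex} => [|u p IH] x /=; first by move=> _ ->.
case/andP=> hxu hp hl; apply: connect_trans (IH u hp hl).
case hin: ((x \in A) && (u \in A)).
  by case/andP: hin => h1 h2; rewrite /gc h1 h2.
apply: connect1; rewrite /adjl /=.
case/orP: hxu => he; apply/orP; [left|right].
  apply/mapP; exists (x, u) => //; rewrite mem_filter he /inside /= hin //.
apply/mapP; exists (u, x) => //; rewrite mem_filter he /inside /= [(u \in A) && _]andbC hin //.
Qed.

Lemma gcE_all N F A a : gcE A a (outE A (allE N F)) = allE N (fun i => gcE A a (outE A (F i))).
Proof.
rewrite /allE; elim: (iota 0 N) => [|i cs IH] //=.
by rewrite /outE filter_cat /gcE map_cat -/(gcE _ _ _) -IH.
Qed.

Variable k : nat.
Hypothesis hk : 2 <= k.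
Local Notation N := (2 * k - 2).

Definition degree_bound (ty : bool) D (x : T) := k - 1 <= if ty then ind D [set x] else outd D [set x].

(** [i] is the intended in-degree of [v]. The last two bounds say that [d - N] is at most [i] and at
    most [d - i]; the paths through [v], at most [d - N] in number, therefore fit, and the spare
    edges make up the rest. *)
Definition eligible E t (ty : T -> bool) v :=
  let d := cut E [set v] in
  (d < 2 * N) && [exists i : 'I_d.+1, [&& divK k (t v - (Posz d - 2 * Posz i)),
     (if ty v then k - 1 <= i else k - 1 <= d - i), d <= i + N & i <= N]].

Lemma eligibleI E t ty v i : let d := cut E [set v] in d < 2 * N -> i <= d ->
  divK k (t v - (Posz d - 2 * Posz i)) ->
  (if ty v then k - 1 <= i else k - 1 <= d - i) -> d <= i + N -> i <= N ->
  eligible E t ty v.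
Proof.
move=> d h1 h2 h3 h4 h5 h6; rewrite /eligible h1 /=; apply/existsP.
by exists (Ordinal (h2 : i < d.+1)); rewrite h3 h4 h5 h6.
Qed.

Lemma io_deg S D v : good S D -> cut D [set v] = outd D [set v] + ind D [set v].
Proof.
move=> hg; apply: (@cut_io _ D [set v]) => //; apply/allP => e he.
have /and3P [_ _ h] := allP hg _ he; rewrite /inside !inE.
by apply: contra h => /andP [/eqP -> /eqP ->].
Qed.

(** If the required degree were below [k - 1], reversing [k] edges at [v] in its favour would keep
    the congruence modulo [2k] and produce an in-degree that makes [v] eligible; [|net| < 2k] bounds
    [d] and the other degree. *)
Lemma bad_bound S E D t ty v : good S E -> eqv D E -> N <= cut E [set v] ->
  ~~ eligible E t ty v -> divK k (net D [set v] - t v) ->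
  `|net D [set v]| < 2 * k -> degree_bound (ty v) D v.
Proof.
move=> hg hD hN hel hdiv hnet.
have hgD : good S D by apply: good_eqv hg; rewrite eqv_sym.
have hd : cut E [set v] = outd D [set v] + ind D [set v].
  by rewrite -(cut_eqv _ hD) (io_deg v hgD).
have hKK := divKK k.
move: hnet hdiv; rewrite /net /degree_bound; move: (outd D [set v]) (ind D [set v]) hd => o i hd hnet hdiv.
rewrite leqNgt; apply/negP => hlt.
case hty: (ty v) in hlt.
  apply: (negP hel); apply: (@eligibleI _ _ _ _ (i + k)); rewrite /= ?hty ?hd;
    try (move: hnet hN hlt hk; rewrite hd; clear; lia).
  have := divKB hdiv hKK; rewrite -divKN; congr (is_true (divK _ _)); clear; lia.
apply: (negP hel); apply: (@eligibleI _ _ _ _ (i - k)); rewrite /= ?hty ?hd;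
    try (move: hnet hN hlt hk; rewrite hd; clear; lia).
have := divKD hdiv hKK; rewrite -divKN; congr (is_true (divK _ _)).
by move: hnet hN hlt hk; rewrite hd; clear; lia.
Qed.

(** [3k - 2] is [2k - 2] plus the largest possible norm, so a single vertex that cannot be deleted
    never violates the cut bound. *)
Lemma bad_deg E t ty v : N <= cut E [set v] ->
  (exists j, t v = Posz (cut E [set v]) + 2 * j)%R ->
  ~~ eligible E t ty v -> 3 * k - 2 <= cut E [set v].
Proof.
move=> hN [j hj] hel; rewrite leqNgt; apply/negP => hlt.
(* the in-degree (resp. out-degree) is the representative in [k-1, 2k-2] *)
have key (c : int) : exists r : nat, [/\ k - 1 <= r, r <= N & exists q : int, (Posz r = c + q * Posz k)%R].
  have hk0 : Posz k != 0%R by move: hk; clear; lia.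
  have h1 := modz_ge0 (c - Posz (k - 1)) hk0; have h2 := ltz_mod (c - Posz (k - 1)) hk0.
  have h3 := divz_eq (c - Posz (k - 1))%R (Posz k).
  exists (k - 1 + `|((c - Posz (k - 1))%R %% Posz k)%Z|); split.
  - by clear; lia.
  - by move: h1 h2 hk; clear; lia.
  - exists (- ((c - Posz (k - 1))%R %/ Posz k)%Z)%R.
    by move: h1 h2 h3 hk; clear; lia.
case hty: (ty v).
  have [r [h1 h2 [q hq]]] := key (- j)%R.
  apply: (negP hel); apply: (@eligibleI _ _ _ _ r); rewrite /= ?hty;
    try (move: hN h1 h2 hlt hk; clear; lia).
  rewrite hj; have := dvdz_mull q (divKK k); rewrite -/(divK k _).
  by congr (is_true (divK _ _)); move: hq; clear; lia.
have [r [h1 h2 [q hq]]] := key (Posz (cut E [set v]) + j)%R.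
apply: (negP hel); apply: (@eligibleI _ _ _ _ (cut E [set v] - r)); rewrite /= ?hty;
    try (move: hN h1 h2 hlt hk; clear; lia).
rewrite hj -divKN; have := dvdz_mull q (divKK k); rewrite -/(divK k _).
by congr (is_true (divK _ _)); move: hq hN h1 h2; clear; lia.
Qed.

Definition tree_orientation_sol S z (ty : T -> bool) E (t : T -> int) D := eqv D E /\
  forall x, x \in S -> divK k (net D [set x] - t x) /\ (x != z -> degree_bound (ty x) D x).

Lemma sum_count S U : {subset U <= S} -> \sum_(y in S) count_mem y U = size U.
Proof.
elim: U => [|u U IH] h; first by rewrite big1.
under eq_bigr do rewrite /=.
rewrite big_split /= IH; last by move=> x hx; apply: h; rewrite inE hx orbT.
rewrite -[RHS]add1n; congr addn; rewrite (bigD1 u) ?h ?mem_head //= eqxx big1 // => i /andP [_ hi].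
by rewrite eq_sym (negPf hi).
Qed.

Lemma net_star v U (y : T) : y != v ->
  (net (map (pair v) U) [set y] = - Posz (count_mem y U))%R.
Proof.
move=> hy; elim: U => [|u U IH] //=; rewrite net_cons IH /= !inE.
by rewrite [v == y]eq_sym (negPf hy); clear; lia.
Qed.

Lemma net_starr v U (y : T) : y != v ->
  (net [seq (u, v) | u <- U] [set y] = Posz (count_mem y U))%R.
Proof.
move=> hy; elim: U => [|u U IH] //=; rewrite net_cons IH /= !inE.
by rewrite [v == y]eq_sym (negPf hy); clear; lia.
Qed.

Lemma net_starv v U : v \notin U -> (net (map (pair v) U) [set v] = Posz (size U))%R.
Proof.
elim: U => [|u U IH] //=; rewrite inE negb_or => /andP [h1 h2].
by rewrite net_cons IH //= !inE eqxx eq_sym (negPf h1); clear; lia.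
Qed.

Lemma net_starrv v U : v \notin U -> (net [seq (u, v) | u <- U] [set v] = - Posz (size U))%R.
Proof.
elim: U => [|u U IH] //=; rewrite inE negb_or => /andP [h1 h2].
by rewrite net_cons IH //= !inE eqxx eq_sym (negPf h1); clear; lia.
Qed.

Lemma tree_orientation_elim S F t ty z v :
  classes N S F -> 1 < #|S| -> v \in S -> v != z ->
  (forall x, x \in S -> exists j, t x = Posz (cut (allE N F) [set x]) + 2 * j)%R ->
  divK k (sZ t S) -> eligible (allE N F) t ty v ->
  (forall F' t', classes N (S :\ v) F' ->
    (forall x, x \in S :\ v -> exists j, t' x = Posz (cut (allE N F') [set x]) + 2 * j)%R ->
    divK k (sZ t' (S :\ v)) -> exists D, tree_orientation_sol (S :\ v) z ty (allE N F') t' D) ->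
  exists D, tree_orientation_sol S z ty (allE N F) t D.
Proof.
move=> hF hS hv hvz hpar hsum /andP [hd /existsP [[i hi] /= /and4P [e1 e2 e3 e4]]] IH.
have [F' [U [c1 c2 [c3 [q c4]] c5 c6]]] := elim_vertex hF hv hS hd.
set d := cut (allE N F) [set v] in hd hi e1 e2 e3 c3 c4.
(* [p] arcs leave [v] along spare edges, so that the in-degree of [v] is [i] *)
have [p [hp1 hp2]] : exists p, p <= size U /\ i + q + p = q + q + size U.
  by exists (q + size U - i); move: c3 c4 e3 e4 hd; clear; lia.
have hUv : v \notin U by apply/negP => /c2; rewrite !inE eqxx.
pose U1 := take p U; pose U2 := drop p U.
have hU12 : U = U1 ++ U2 by rewrite cat_take_drop.
have s1 : size U1 = p by rewrite size_takel.
have s2 : size U2 = size U - p by rewrite size_drop.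
have sub1 : {subset U1 <= S :\ v} by move=> x hx; apply: c2; rewrite hU12 mem_cat hx.
have sub2 : {subset U2 <= S :\ v} by move=> x hx; apply: c2; rewrite hU12 mem_cat hx orbT.
have hv1 : v \notin U1 by apply/negP => /sub1; rewrite !inE eqxx.
have hv2 : v \notin U2 by apply/negP => /sub2; rewrite !inE eqxx.
(* A spare edge directed from [v] into [y] raises what the other arcs at [y] have to achieve, and
   one directed to [v] lowers it. *)
pose t' y := (t y + Posz (count_mem y U1) - Posz (count_mem y U2))%R.
have cU y : count_mem y U = count_mem y U1 + count_mem y U2.
  by rewrite hU12 count_cat.
have sumP (f : T -> nat) A : (\sum_(x in A) Posz (f x) = Posz (\sum_(x in A) f x))%R.
  by rewrite (big_morph Posz PoszD (erefl (Posz 0))).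
have [||D' [hD' hs]] := IH F' t' c1.
- move=> x hx; have hxS : x \in S by move: hx; rewrite !inE => /andP [].
  have [j hj] := hpar x hxS; exists (j + Posz (count_mem x U1))%R.
  by rewrite /t' hj (c5 x hx) cU; clear; lia.
- have -> : (sZ t' (S :\ v) = sZ t (S :\ v) + Posz p - Posz (size U - p))%R.
    rewrite /sZ /t' sumrB big_split /= !sumP !sum_count // s1 s2.
    by [].
  have := hsum; rewrite (sZ_D1 _ hv) => h; have := divKB h e1.
  by congr (is_true (divK _ _)); move: c4 hp1 hp2; clear; lia.
have [D0 [d1 d2 d3]] := c6 D' hD'.
exists (D0 ++ map (pair v) U1 ++ [seq (u, v) | u <- U2]).
have hD : eqv (D0 ++ map (pair v) U1 ++ [seq (u, v) | u <- U2]) (allE N F).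
  apply: eqv_trans d1; apply: eqv_cat; first exact: eqv_refl.
  rewrite hU12 map_cat; apply: eqv_cat; first exact: eqv_refl.
  by elim: (U2) => [|u l IHl] //=; apply: eqv_swap.
have hg := allE_good hF.
have hgD : good S (D0 ++ map (pair v) U1 ++ [seq (u, v) | u <- U2]).
  by apply: good_eqv hg; rewrite eqv_sym.
have hnv : net (D0 ++ map (pair v) U1 ++ [seq (u, v) | u <- U2]) [set v]
   = (Posz p - Posz (size U - p))%R.
  by rewrite !net_cat d2 net_starv // net_starrv // s1 s2 add0r.
split=> // x hx; case: (eqVneq x v) => [->|hxv].
  rewrite hnv; split.
    by rewrite -divKN; move: e1; congr (is_true (divK _ _)); move: c4 hp1 hp2; clear; lia.
  move=> _; have := io_deg v hgD; rewrite (cut_eqv _ hD) -/d.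
  move: hnv; rewrite /degree_bound /net; move: e2; case: (ty v) => e2;
    move: (outd _ _) (ind _ _) => o i'; move: e2 c4 hp1 hp2; clear; lia.
have hx' : x \in S :\ v by rewrite !inE hxv hx.
have [f1 f2] := hs x hx'; have [g1 g2] := d3 x hxv; split.
  rewrite !net_cat net_star // net_starr //; move: f1; rewrite /t' /net g1 g2.
  by congr (is_true (divK _ _)); clear; lia.
move/f2; rewrite /degree_bound; case: (ty x) => h; apply: leq_trans h _.
  by rewrite -g2 /ind count_cat leq_addr.
by rewrite -g1 /outd count_cat leq_addr.
Qed.

Lemma tree_orientation n S F t ty z : #|S| <= n -> z \in S -> classes N S F ->
  (forall x, x \in S -> exists j, t x = Posz (cut (allE N F) [set x]) + 2 * j)%R ->
  divK k (sZ t S) -> exists D, tree_orientation_sol S z ty (allE N F) t D.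
Proof.
elim: n S F t ty z => [|n IH] S F t ty z hn hz hF hpar hsum.
  by move: hn; rewrite leqn0 cards_eq0 => /eqP h; rewrite h inE in hz.
have hg := allE_good hF; set E := allE N F in hg hpar *.
case: (leqP #|S| 1) => hS.
  have hS1 : S = [set z].
    by apply/esym/eqP; rewrite eqEcard sub1set hz cards1.
  exists E; split; first exact: eqv_refl.
  move=> x; rewrite hS1 inE => /eqP ->; rewrite eqxx; split=> //.
  have -> : net E [set z] = 0%R.
    have h := net_le E [set z]; have h0 : cut E [set z] = 0.
      apply/eqP; rewrite -leqn0 leqNgt -has_count; apply/hasPn => e he.
      have /and3P [] := allP hg _ he; rewrite hS1 !inE => /eqP -> /eqP ->.
      by rewrite eqxx.
    by move: h; rewrite h0; clear; lia.
  by move: hsum; rewrite hS1 sZ1 sub0r divKN.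
case: (boolP [exists v in S, (v != z) && eligible E t ty v]).
  case/exists_inP=> v hv /andP [hvz hel].
  apply: (tree_orientation_elim hF hS hv hvz hpar hsum hel) => F' t' h1 h2 h3.
  apply: IH => //; last by rewrite !inE eq_sym hvz hz.
  by move: hn; rewrite (cardsD1 v) hv; clear; lia.
move/exists_inPn => hnel.
have {}hnel v : v \in S -> v != z -> ~~ eligible E t ty v.
  by move=> h1 h2; have := hnel v h1; rewrite h2.
have hNd v : v \in S -> N <= cut E [set v] by move=> hv; apply: (deg_lb hF hv hS).
pose viol A := [&& A \subset S, z \notin A, A != set0 & cut E A < 2 * k - 2 + nrm k (sZ t A)].
have dd0 A : ldeg E (fun=> 0) (fun=> 0) A = cut E A.
  by rewrite /ldeg big1 // addn0.
case: (boolP [exists A, viol A]) => [/existsP [A0 hA0]|/existsPn hno]; last first.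
  have I : inst k S set0 E (fun=> 0) (fun=> 0) t.
    split=> //.
    - by rewrite cards0.
    - by move=> u; rewrite inE.
    - by move=> x /hpar [j hj]; exists j; rewrite dd0.
    - by rewrite /sN !big1 // addr0 subr0.
    (* A set containing [z] is replaced by its complement, which has the same cut and, as the total
       demand is 0 modulo [2k], the opposite demand. *)
    - move=> A h1 h2 h3 _; rewrite dd0.
      case hzA: (z \in A); last first.
        by have := hno A; rewrite /viol h1 hzA h2 /= -leqNgt.
      have hc : S :\: A != set0.
        by apply: contraNneq h3 => h; rewrite eqEsubset h1 -setD_eq0 h eqxx.
      have := hno (S :\: A); rewrite /viol subsetDl hc !inE hzA /= -leqNgt.
      rewrite (cut_compl _ (good_all2 hg)).
      suff -> : nrm k (sZ t (S :\: A)) = nrm k (sZ t A) by [].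
      rewrite -[RHS](nrmN hk); apply: nrm_cong => //.
      move: hsum; rewrite {1}/sZ (big_setID A) /= (setIidPr h1) -!/(sZ _ _).
      by congr (is_true (divK _ _)); clear; lia.
    - by rewrite /region /sN !big1 //; move: hk; clear; lia.
  have [D [hD hs]] := modular_orientation hk I; exists D; split=> // x hx.
  have [h1 h2] := hs x hx.
  have g1 : divK k (net D [set x] - t x).
    by move: h1; congr (is_true (divK _ _)); clear; lia.
  split=> // hxz; apply: (bad_bound hg hD (hNd x hx) (hnel x hx hxz) g1).
  by move: h2; congr (is_true (_ < _)); clear; lia.
have [A /minsetP [hA hmin] _] := minset_exists hA0.
case/and4P: (hA) => hAS hzA hA0' hAv.
have [a ha] : exists a, a \in A by apply/set0Pn.
have hA2 : 1 < #|A|.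
  rewrite ltnNge; apply/negP => h1; have hA1 : A = [set a].
    by apply/esym/eqP; rewrite eqEcard sub1set ha cards1.
  have haS := subsetP hAS _ ha; have haz : a != z by apply: contraNneq hzA => <-.
  have := bad_deg (hNd a haS) (hpar a haS) (hnel a haS haz).
  by move: hAv; rewrite hA1 sZ1; have := nrm_lek hk (t a); move: hk; clear; lia.
pose cZ u := if u == a then sZ t A else t u.
have cZE B : B \subset cS S A a -> sZ cZ B = sZ t (bx A a B).
  by move=> hB; rewrite /sZ /cZ (bx_big ha +%R t hB).
have bxS : bx A a (cS S A a) = S.
  apply/setP => u; rewrite /bx /cS setU11 !inE.
  case hu: (u \in A); rewrite ?orbT ?orbF /=; first by rewrite (subsetP hAS).
  by case: (u =P a) => // h; rewrite h ha in hu.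
pose F1 i := gcE A a (outE A (F i)).
have hF1 : classes N (cS S A a) F1.
  by move=> i /hF [h1 h2]; split; [apply: contract_good|apply: contract_conn].
have hE1 : allE N F1 = gcE A a (outE A E) by rewrite gcE_all.
have parE B : B \subset S -> exists j, (sZ t B = Posz (cut E B) + 2 * j)%R.
  move=> hB; have [j ->] := cut_par E B.
  have : exists i, (sZ t B = \sum_(x in B) Posz (cut E [set x]) + 2 * i)%R.
    rewrite /sZ; elim/big_rec2: _ => [|x u v hx [i ->]]; first by exists 0%R.
    have [i' ->] := hpar x (subsetP hB _ hx).
    by exists (i + i')%R; clear; lia.
  by case=> i ->; exists (i - j)%R; clear; lia.
have [||||D1 [hD1 hs1]] := IH (cS S A a) F1 cZ ty z _ _ hF1.
- rewrite (cS_card hAS ha); have := subset_leq_card hAS.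
  by move: hn hA2; clear; lia.
- by rewrite !inE hzA hz orbT.
- move=> x hx; have hs : [set x] \subset cS S A a by rewrite sub1set.
  by have := parE _ (bx_sub hAS ha hs); rewrite -cZE // sZ1 hE1 (contract_cut _ hs).
- by rewrite cZE // bxS.
rewrite hE1 in hD1; have [DB [hDB hDB1]] := ori_map hD1.
have hDBn := outE_not hDB.
pose al u := ind DB [set u]; pose be u := outd DB [set u].
have alE B : sN al B = ind DB B by rewrite /sN -ind_sum.
have beE B : sN be B = outd DB B by rewrite /sN -outd_sum.
have crE B : B \subset A -> cut E B = cut (inE_ A E) B + outd DB B + ind DB B.
  move=> hB; rewrite (cut_eqv _ (perm_eqv (split_inside A E))) cut_cat.
  by rewrite -(cut_eqv _ hDB) (cut_io hB hDBn) addnA.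
have dd2 B : B \subset A -> ldeg (inE_ A E) al be B = cut E B.
  by move=> hB; rewrite !ldegE alE beE crE //; clear; lia.
have crA0 : cut (inE_ A E) A = 0.
  rewrite -(@cut_compl _ (inE_ A E) A A); last exact: good_all2 (in_good A hg).
  rewrite setDv; apply/eqP; rewrite -leqn0 leqNgt -has_count; apply/hasPn => e _.
  by rewrite /cross !inE.
have netA : net D1 [set a] = net DB A by rewrite (net_perm _ hDB1) contract_netA.
have sumA : divK k (sZ t A + Posz (sN al A) - Posz (sN be A)).
  have [h _] := hs1 a (setU11 _ _); rewrite netA /cZ eqxx in h.
  rewrite -divKN; move: h; congr (is_true (divK _ _)).
  by rewrite alE beE /net; clear; lia.
have I : inst k A set0 (inE_ A E) al be t.
  split.
  - exact: (in_good A hg).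
  - by rewrite cards0.
  - by move=> x; rewrite inE.
  - move=> x hx; rewrite dd2 ?sub1set //; apply: hpar; exact: (subsetP hAS).
  - exact: sumA.
  - move=> B h1 h2 h3 _; rewrite dd2 // leqNgt; apply/negP => h4.
    suff hB : viol B by rewrite (hmin B hB h1) eqxx in h3.
    rewrite /viol h2 h4 (subset_trans h1 hAS) /= andbT.
    by apply: contra hzA; apply: (subsetP h1).
  - apply: regionP => //.
    have -> : nrm k (Posz (sN be A) - Posz (sN al A)) = nrm k (sZ t A).
      apply: nrm_cong => //; rewrite -divKN; move: sumA.
      by congr (is_true (divK _ _)); clear; lia.
    by move: hAv; rewrite -dd2 // ldegE crA0; clear; lia.
have [DA [hDA hs2]] := modular_orientation hk I.
have hD : eqv (DA ++ DB) E.
  apply: eqv_trans (eqv_cat hDA hDB) _; rewrite eqv_sym.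
  exact/perm_eqv/split_inside.
exists (DA ++ DB); split=> // x hx; case hxA: (x \in A).
  have [h1 h2] := hs2 x hxA; rewrite /al /be in h1 h2.
  have g1 : divK k (net (DA ++ DB) [set x] - t x).
    by rewrite net_cat; move: h1; congr (is_true (divK _ _)); rewrite /net; clear; lia.
  (* Eligibility was excluded in the whole graph, so [bad_bound] is applied to the combined
     orientation rather than to the one inside [A]. *)
  split=> // hxz; apply: (bad_bound hg hD (hNd x hx) (hnel x hx hxz) g1).
  by rewrite net_cat; move: h2; congr (is_true (_ < _)); rewrite /net; clear; lia.
have hgA : good A DA by apply: good_eqv (in_good A hg); rewrite eqv_sym.
have hx1 : x \in cS S A a by rewrite !inE hxA hx orbT.
have [h1 h2] := hs1 x hx1; split.
  rewrite net_cat (net_out hgA) ?hxA // add0r.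
  move: h1; rewrite (net_perm _ hDB1) contract_net ?hxA // /cZ.
  by case: eqP => // h; rewrite h ha in hxA.
have eI : ind D1 [set x] = ind DB [set x].
  by rewrite -(@contract_ind _ A a ha DB x) ?hxA //; apply: (permP hDB1).
have eO : outd D1 [set x] = outd DB [set x].
  by rewrite -(@contract_outd _ A a ha DB x) ?hxA //; apply: (permP hDB1).
move/h2; rewrite /degree_bound eI eO; case: (ty x) => h; apply: leq_trans h _.
  by rewrite /ind count_cat leq_addl.
by rewrite /outd count_cat leq_addl.
Qed.

End TB.

(** * Components, bridges and spanning trees of multigraphs *)

Section Multi.
Variable G : mgraph.
Implicit Types (F P Q B R : {set edge G}) (e g h : edge G) (u v x y a b : G) (A X : {set G}).

Lemma ends_pair e : exists p : G * G, ends e == [set p.1; p.2].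
Proof.
have := ends_card e; case/andP; rewrite card_gt0 => /set0Pn [u hu] h2.
have := h2; rewrite leq_eqVlt ltnS => /orP [/cards2P [a [b [_ ->]]]|h1].
  by exists (a, b).
exists (u, u); rewrite /= setUid eq_sym eqEcard sub1set hu cards1; exact: h1.
Qed.
(** A fixed ordering of the ends, with both entries equal for a loop; it translates between edges of
    [G] and lists of pairs. *)
Definition ep e : G * G := xchoose (ends_pair e).
Lemma epE e : ends e = unordered (ep e).
Proof. exact/eqP/(xchooseP (ends_pair e)). Qed.

Local Notation con F := (connect (adj F)).

Lemma adj_sym F : connect_sym (adj F).
Proof. by apply: sym_connect_sym => u v; rewrite /adj /= setUC. Qed.

Lemma adj1 F e : e \in F -> con F (ep e).1 (ep e).2.
Proof. by move=> he; apply: connect1; apply/exists_inP; exists e; rewrite ?epE. Qed.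

Lemma adjP F u v : adj F u v -> exists2 e, e \in F & (ep e = (u, v) \/ ep e = (v, u)).
Proof.
case/exists_inP=> e he /eqP h; exists e => //; rewrite epE in h.
by case: (@uo_eq _ (u, v) (ep e)); [rewrite h|left|right].
Qed.

Lemma con_gen F (r : rel G) : reflexive r -> symmetric r -> transitive r ->
  (forall e, e \in F -> r (ep e).1 (ep e).2) -> forall u v, con F u v -> r u v.
Proof.
move=> hr hs ht h u v /connectP [p]; elim: p u => [|w p IH] u /=; first by move=> _ ->.
case/andP=> /adjP [e he hew] hp hl; apply: (ht w); last exact: IH.
by have := h e he; case: hew => -> //=; rewrite hs.
Qed.

Lemma con_sub F F' : (forall e, e \in F -> con F' (ep e).1 (ep e).2) ->
  forall u v, con F u v -> con F' u v.
Proof.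
move=> h; apply: con_gen => //; first exact: adj_sym.
exact: connect_trans.
Qed.

Lemma con_mono F F' u v : F \subset F' -> con F u v -> con F' u v.
Proof. by move=> h; apply: con_sub => e he; apply: adj1; apply: (subsetP h). Qed.

Definition joined F g := con F (ep g).1 (ep g).2.

Lemma joined_mono F F' g : F \subset F' -> joined F g -> joined F' g.
Proof. exact: con_mono. Qed.

Lemma con_remove F h u v : con F u v ->
  [\/ con (F :\ h) u v, con (F :\ h) u (ep h).1 /\ con (F :\ h) (ep h).2 v
    | con (F :\ h) u (ep h).2 /\ con (F :\ h) (ep h).1 v].
Proof.
case/connectP=> p; elim: p u => [|w p IH] u /=; first by move=> _ ->; apply: Or31.
case/andP=> /adjP [e he hew] hp hl; have {IH} := IH w hp hl.
case: (eqVneq e h) => [heh|hne].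
  rewrite heh in hew; case: hew => -> /= [h1|[h1 h2]|[h1 h2]].
  - by apply: Or32; split.
  - by apply: Or32; split.
  - by apply: Or31.
  - by apply: Or33; split.
  - by apply: Or31.
  - by apply: Or33; split.
have huw : con (F :\ h) u w.
  have := @adj1 (F :\ h) e; rewrite !inE hne he => /(_ isT).
  by case: hew => -> //=; rewrite adj_sym.
case=> [h1|[h1 h2]|[h1 h2]]; [apply: Or31|apply: Or32; split|apply: Or33; split] => //;
  exact: connect_trans huw _.
Qed.

Lemma con_add F g : joined F g -> forall u v, con (g |: F) u v = con F u v.
Proof.
move=> hj u v; apply/idP/idP; last by apply: con_mono; apply: subsetUr.
apply: con_sub => e; rewrite !inE => /orP [/eqP ->|he] //; exact: adj1.
Qed.

Lemma con_eq_joined F F' g : F \subset F' -> F' \subset g |: F -> joined F g ->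
  forall u v, con F' u v = con F u v.
Proof.
move=> h1 h2 hj u v; apply/idP/idP; last exact: con_mono.
by rewrite -(con_add hj); apply: con_mono.
Qed.

Definition cls F u := [set v | con F u v].
Definition comps F := [set cls F u | u : G].

Lemma cls_eq F u v : (cls F u == cls F v) = con F u v.
Proof.
apply/eqP/idP => [h|h].
  by have : v \in cls F v; [rewrite inE|rewrite -h inE].
by apply/setP => w; rewrite !inE; apply: (same_connect (@adj_sym F)).
Qed.

Lemma mem_comps F A : reflect (exists u, A = cls F u) (A \in comps F).
Proof.
apply: (iffP imsetP) => [[u _ ->]|[u ->]]; first by exists u.
by exists u.
Qed.

Definition fuse F A := \bigcup_(u in A) cls F u.

Lemma fuse_cls F F' u : (forall x y, con F x y -> con F' x y) ->
  fuse F' (cls F u) = cls F' u.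
Proof.
move=> h; apply/setP => w; apply/bigcupP/idP => [[x]|hw].
  by rewrite !inE => /h hx hw; apply: connect_trans hx hw.
by exists u => //; rewrite inE.
Qed.

Lemma fuse_comps F F' : (forall x y, con F x y -> con F' x y) ->
  fuse F' @: comps F = comps F'.
Proof.
move=> h; rewrite /comps -imset_comp; apply: eq_imset => u /=; exact: fuse_cls.
Qed.

Lemma comps_mono F F' : (forall x y, con F x y -> con F' x y) ->
  #|comps F'| <= #|comps F|.
Proof. by move=> h; rewrite -(fuse_comps h); apply: leq_imset_card. Qed.

Lemma comps_eq F F' : (forall x y, con F x y = con F' x y) -> #|comps F| = #|comps F'|.
Proof. by move=> h; apply/eqP; rewrite eqn_leq !comps_mono // => x y; rewrite h. Qed.

Lemma comps_bridge F g : g \in F -> ~~ joined (F :\ g) g -> #|comps F| < #|comps (F :\ g)|.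
Proof.
move=> hg hj.
have h x y : con (F :\ g) x y -> con F x y by apply: con_mono; apply: subsetDl.
rewrite -(fuse_comps h) ltn_neqAle leq_imset_card andbT; apply/imset_injP => hinj.
move: hj; rewrite /joined -cls_eq; apply/negP; rewrite negbK; apply/eqP; apply: hinj.
- by apply/mem_comps; exists (ep g).1.
- by apply/mem_comps; exists (ep g).2.
by rewrite !fuse_cls //; apply/eqP; rewrite cls_eq; apply: adj1.
Qed.

Lemma comps_remove F g : #|comps (F :\ g)| <= #|comps F|.+1.
Proof.
have h x y : con (F :\ g) x y -> con F x y by apply: con_mono; apply: subsetDl.
pose b := cls (F :\ g) (ep g).2.
have hb : b \in comps (F :\ g) by apply/mem_comps; exists (ep g).2.
rewrite (cardsD1 b) hb add1n ltnS -(fuse_comps h).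
rewrite -(card_in_imset (f := fuse F) (D := comps (F :\ g) :\ b)).
  by apply: subset_leq_card; apply: imsetS; apply: subsetDl.
move=> A A'; rewrite !inE => /andP [hA /mem_comps [u hu]] /andP [hA' /mem_comps [v hv]].
move: hA hA'; rewrite hu hv !fuse_cls // /b !cls_eq => n1 n2 /eqP; rewrite cls_eq => huv.
apply/eqP; rewrite cls_eq; case: (con_remove g huv) => [//|[_ h2]|[h2 _]].
  by rewrite adj_sym h2 in n2.
by rewrite h2 in n1.
Qed.

Lemma comps_removes F P : #|comps (F :\: P)| <= #|comps F| + #|P|.
Proof.
have [n] := ubnP #|P|; elim: n P => // n IH P hn.
case: (set_0Vmem P) => [->|[g hg]]; first by rewrite setD0 cards0 addn0.
have hP : #|P| = #|P :\ g|.+1 by rewrite (cardsD1 g P) hg.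
have -> : F :\: P = (F :\: (P :\ g)) :\ g.
  by apply/setP => e; rewrite !inE; case: (e =P g) => [->|]; rewrite ?hg.
apply: leq_trans (comps_remove _ _) _; rewrite hP addnS ltnS; apply: IH.
by move: hn; rewrite hP.
Qed.

Lemma comps_bridges F P : P \subset F -> (forall g, g \in P -> ~~ joined (F :\ g) g) ->
  #|comps F| + #|P| <= #|comps (F :\: P)|.
Proof.
have [n] := ubnP #|P|; elim: n F P => // n IH F P hn hPF hP.
case: (set_0Vmem P) => [->|[g hg]]; first by rewrite setD0 cards0 addn0.
have hc : #|P| = #|P :\ g|.+1 by rewrite (cardsD1 g P) hg.
have -> : F :\: P = (F :\ g) :\: (P :\ g).
  by apply/setP => e; rewrite !inE; case: (e =P g) => [->|]; rewrite ?hg.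
have h1 := comps_bridge (subsetP hPF _ hg) (hP g hg).
have : #|comps (F :\ g)| + #|P :\ g| <= #|comps (F :\ g :\: (P :\ g))|.
  apply: IH; first by move: hn; rewrite hc.
    by apply: setSD.
  move=> e; rewrite !inE => /andP [_ he]; apply: contra (hP e he).
  by apply: joined_mono; apply: setSD; apply: subsetDl.
by rewrite hc; move: h1; clear; lia.
Qed.

Lemma comps_connected F : connected F -> #|comps F| <= 1.
Proof.
move=> h; apply/card_le1_eqP => A A' /mem_comps [u ->] /mem_comps [v ->].
by apply/eqP; rewrite cls_eq; apply: h.
Qed.

Lemma connected_comps F : #|comps F| <= 1 -> connected F.
Proof.
move=> /card_le1_eqP h u v; rewrite -cls_eq; apply/eqP; apply: h; apply/mem_comps;
 by [exists u|exists v].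
Qed.

(** The edges between the parts of a vertex partition, where the partition is given by the
    components of [R]. *)
Definition between R := [set e | ~~ joined R e].

Lemma between_lb R F : connected F -> #|comps R| <= #|F :&: between R|.+1.
Proof.
move=> hF; have h1 := comps_removes F (F :&: between R).
have h2 := comps_connected hF.
suff h3 : #|comps R| <= #|comps (F :\: (F :&: between R))| by move: h1 h2 h3; clear; lia.
apply: comps_mono; apply: con_sub => e; rewrite !inE => /andP [h he].
by move: h; rewrite he /= negbK.
Qed.

Definition connb F := [forall u, forall v, con F u v].
Lemma connbP F : reflect (connected F) (connb F).
Proof.
apply: (iffP forallP) => [h u v|h u]; last by apply/forallP => v; apply: h.
by have /forallP := h u.
Qed.

Lemma spanning_tree_exists F : connected F ->
  exists2 P : {set edge G}, P \subset F & spanning_tree P.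
Proof.
move=> /connbP hF; have [P /minsetP [/connbP hP hmin] hPF] := minset_exists hF.
exists P => //; split=> // n vs es hn [hvs hes hesP hends].
pose o j : 'I_n := Ordinal (ltn_pmod j hn).
have oS j : ordS (o j) = o j.+1.
  by apply: val_inj; rewrite /= -addn1 modnDml addn1.
(* Walking round the cycle from [vs (o 1)] to [vs (o n) = vs (o 0)] avoids the edge [es (o 0)],
   which could then be dropped from the minimal [P]. For a loop the walk is trivial. *)
have h1 j : 0 < j -> j <= n -> con (P :\ es (o 0)) (vs (o 1)) (vs (o j)).
  elim: j => // j IH _ hj; case: (posnP j) => [->|hj0]; first exact: connect0.
  apply: connect_trans (IH hj0 (ltnW hj)) _; apply: connect1.
  apply/exists_inP; exists (es (o j)); last by rewrite hends oS.
  rewrite !inE hesP andbT; apply/negP => /eqP /hes /(congr1 val) /=.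
  by rewrite mod0n modn_small // => h; rewrite h in hj0.
have hon : o n = o 0 by apply: val_inj; rewrite /= modnn mod0n.
have h2 : con (P :\ es (o 0)) (vs (o 1)) (vs (o 0)).
  by have := h1 n hn (leqnn n); rewrite hon.
have h3 : joined (P :\ es (o 0)) (es (o 0)).
  have := hends (o 0); rewrite epE oS -[RHS]/(unordered (vs (o 0), vs (o 1))).
  by rewrite /joined => /esym /uo_eq [] -> //=; rewrite adj_sym.
have h4 : connb (P :\ es (o 0)).
  apply/connbP => u v; rewrite -(con_add h3) setD1K //; exact: hP.
have := hmin _ h4 (subsetDl _ _) => /setP /(_ (es (o 0))).
by rewrite !inE eqxx hesP.
Qed.

(** A minimal [P] joining the ends of [g] is a path; with [g] it forms a cycle, on which the other
    edges bypass each edge. *)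
Lemma path_edges F g : joined F g -> g \notin F -> exists P : {set edge G},
  [/\ P \subset F, joined P g & forall h, h \in P -> joined ((g |: F) :\ h) h].
Proof.
move=> hj hg.
have [P /minsetP [hP hmin] hPF] := @minset_exists _ (fun P : {set edge G} => joined P g) F hj.
exists P; split=> // h hh.
have hgh : g != h by apply: contraNneq hg => ->; apply: (subsetP hPF).
have hnot : ~~ joined (P :\ h) g.
  apply/negP => hc; have := hmin _ hc (subsetDl _ _) => /setP /(_ h).
  by rewrite !inE eqxx hh.
have hsub : P :\ h \subset (g |: F) :\ h.
  by apply: setSD; apply: subset_trans hPF (subsetUr _ _).
have hgJ : con ((g |: F) :\ h) (ep g).1 (ep g).2.
  by apply: adj1; rewrite !inE hgh eqxx.
case: (con_remove h hP) => [hc|[h1 h2]|[h1 h2]].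
- by rewrite /joined hc in hnot.
- rewrite /joined; apply: (@connect_trans _ _ (ep g).1).
    by rewrite adj_sym; apply: con_mono h1.
  by apply: connect_trans hgJ _; rewrite adj_sym; apply: con_mono h2.
- rewrite /joined; apply: (@connect_trans _ _ (ep g).2); first exact: con_mono h2.
  rewrite adj_sym in hgJ; apply: connect_trans hgJ _; exact: con_mono h1.
Qed.

End Multi.

(** * Tree packing by recolouring, and maximum cuts *)

Section Packing.
Variable G : mgraph.
Implicit Types (F P Q B R : {set edge G}) (e g h : edge G) (u v x y a b : G) (A X : {set G}).
Local Notation con F := (connect (adj F)).

Section Colouring.
Variables (N : nat) (B : {set edge G}).
Implicit Type c : {ffun edge G -> 'I_N}.

Definition col c i := [set e in B | c e == i].
Definition red c g := (g \in B) && joined (col c (c g) :\ g) g.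
Definition recol c g (j : 'I_N) : {ffun edge G -> 'I_N} :=
  [ffun e => if e == g then j else c e].
(** Recolouring an edge that is redundant in its class disconnects nothing. So [total], the number
    of pairs connected within the classes, never decreases along moves; it plays the part of the
    rank in matroid union. *)
Definition move_rel : rel {ffun edge G -> 'I_N} :=
  [rel c c' | [exists g, exists j, red c g && (c' == recol c g j)]].
Definition npairs F := #|[set p : G * G | con F p.1 p.2]|.
Definition total c := \sum_(i < N) npairs (col c i).

Lemma npairs_mono F F' : (forall u v, con F u v -> con F' u v) -> npairs F <= npairs F'.
Proof. by move=> h; apply: subset_leq_card; apply/subsetP => p; rewrite !inE; apply: h. Qed.

Lemma npairs_lt F F' u v : (forall u v, con F u v -> con F' u v) ->
  con F' u v -> ~~ con F u v -> npairs F < npairs F'.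
Proof.
move=> h h1 h2; apply: proper_card; apply/properP; split.
  by apply/subsetP => p; rewrite !inE; apply: h.
by exists (u, v); rewrite inE.
Qed.

Lemma recol_sub c g j i : col c i :\ g \subset col (recol c g j) i.
Proof.
apply/subsetP => e; rewrite !inE ffunE => /andP [h1 /andP [h2 h3]].
by rewrite (negPf h1) h2.
Qed.
Lemma recol_sup c g j i : col (recol c g j) i \subset g |: (col c i :\ g).
Proof.
apply/subsetP => e; rewrite !inE ffunE; case: (e =P g) => //= _.
Qed.
Lemma recol_own c g j : g \in B -> g \in col (recol c g j) j.
Proof. by move=> hg; rewrite inE ffunE hg !eqxx. Qed.

Lemma recol_ge c g j i : red c g ->
  forall u v, con (col c i) u v -> con (col (recol c g j) i) u v.
Proof.
case/andP=> hg hr u v; case: (eqVneq i (c g)) => [->|hi].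
  rewrite (con_eq_joined (F := col c (c g) :\ g) (g := g)) // ?subsetDl //.
    by apply: con_mono; apply: recol_sub.
  by apply/subsetP => e; rewrite !inE; case: (e == g).
apply: con_mono; apply: subset_trans (recol_sub c g j i).
apply/subsetP => e; rewrite !inE => /andP [h1 h2]; rewrite h1 h2 !andbT.
by apply: contraNneq hi => <-; rewrite eq_sym.
Qed.

Variable c0 : {ffun edge G -> 'I_N}.
Hypothesis hmax : forall c, total c <= total c0.

Lemma reach_total c : connect move_rel c0 c -> total c = total c0.
Proof.
move=> hc; apply/eqP; rewrite eqn_leq hmax /=.
case/connectP: hc => p hp ->; elim: p c0 hp => [|c1 p IH] c' //=.
case/andP=> /existsP [g /existsP [j /andP [hr /eqP hc1]]] hp.
apply: leq_trans (IH c1 hp); rewrite hc1.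
by apply: leq_sum => i _; apply: npairs_mono; apply: recol_ge.
Qed.

(** Otherwise giving [g] the colour [j] would merge two components and raise [total] above its
    maximum. *)
Lemma red_joined c g j : connect move_rel c0 c -> red c g -> j != c g ->
  joined (col c j) g.
Proof.
move=> hc hr hj; apply: contraT => hn.
have hstep : connect move_rel c0 (recol c g j).
  apply: connect_trans hc (connect1 _); apply/existsP; exists g; apply/existsP; exists j.
  by rewrite hr eqxx.
have := reach_total hstep; rewrite -(reach_total hc) => /eqP; rewrite eq_sym eqn_leq => /andP [_].
rewrite leqNgt => /negP; case; rewrite /total (bigD1 j) //= [ltnRHS](bigD1 j) //=.
rewrite -addSn; apply: leq_add.
  apply: npairs_lt hn; first exact: recol_ge.
  by apply: adj1; apply: recol_own; case/andP: hr.
by apply: leq_sum => i _; apply: npairs_mono; apply: recol_ge.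
Qed.

(** The edges that become redundant after some moves. Their components form the partition to which
    the packing condition is applied. *)
Definition reds := [set g | [exists c, connect move_rel c0 c && red c g]].

Lemma redsI c g : connect move_rel c0 c -> red c g -> g \in reds.
Proof. by move=> h1 h2; rewrite inE; apply/existsP; exists c; rewrite h1. Qed.

(* every edge of the fundamental cycle of a redundant edge becomes redundant *)
Lemma red_span c g j : connect move_rel c0 c -> red c g ->
  joined ((col c j :\ g) :&: reds) g.
Proof.
move=> hc hr; have [hgB hgj] := andP hr.
have fin F c' : connect move_rel c0 c' -> joined F g -> g \notin F ->
    g |: F \subset col c' j -> F \subset col c j :\ g -> joined ((col c j :\ g) :&: reds) g.
  move=> hc' hF hgF hsub hsub2.
  have [P [h1 h2 h3]] := path_edges hF hgF.
  apply: joined_mono h2; apply/subsetP => h hh; rewrite in_setI (subsetP hsub2) ?(subsetP h1) //=.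
  have hhc : h \in col c' j by apply: (subsetP hsub); rewrite inE (subsetP h1) ?orbT.
  apply: (redsI hc'); move: (hhc); rewrite inE /red => /andP [-> /eqP ->] /=.
  by apply: joined_mono (h3 h hh); apply: setSD.
case: (eqVneq j (c g)) => hj.
  apply: (fin (col c j :\ g) c) => //.
  - by rewrite hj.
  - by rewrite !inE eqxx.
  - by apply/subsetP => e; rewrite !inE => /orP [/eqP ->|/andP [] //]; rewrite hgB hj eqxx.
have hg : g \notin col c j by rewrite inE negb_and eq_sym hj orbT.
have hD : col c j :\ g = col c j.
  by apply/setP => e; rewrite in_setD1; case: (e =P g) => // ->; rewrite (negPf hg).
apply: (fin (col c j) (recol c g j)) => //.
- apply: connect_trans hc (connect1 _); apply/existsP; exists g; apply/existsP; exists j.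
  by rewrite hr eqxx.
- exact: red_joined.
- by rewrite subUset sub1set recol_own //= -{1}hD recol_sub.
- by rewrite hD.
Qed.

(** By [red_span] the recoloured edge is bypassed in every colour by edges of [reds], so a move
    changes none of these components. *)
Lemma reach_span c j : connect move_rel c0 c ->
  forall u v, con (col c j :&: reds) u v = con (col c0 j :&: reds) u v.
Proof.
case/connectP=> p; elim/last_ind: p c => [|p c1 IH] c /=; first by move=> _ ->.
rewrite rcons_path last_rcons => /andP [hp hl] -> u v.
have hc1 : connect move_rel c0 (last c0 p) by apply/connectP; exists p.
rewrite -(IH _ hp erefl); case/existsP: hl => g /existsP [i /andP [hr /eqP hc]].
have hspan := red_span j hc1 hr; set c2 := last c0 p in hc1 hr hc hspan *.
have hg : g \in reds := redsI hc1 hr.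
rewrite (con_eq_joined (F := (col c2 j :\ g) :&: reds) (g := g)) //; last first.
- apply/subsetP => e; rewrite in_setI => /andP [h1 h2]; rewrite in_setU1.
  have := subsetP (recol_sup c2 g i j) e; rewrite -hc => /(_ h1).
  by rewrite in_setU1 in_setI h2 andbT.
- by apply: setSI; rewrite hc; apply: recol_sub.
rewrite [RHS](con_eq_joined (F := (col c2 j :\ g) :&: reds) (g := g)) //.
- by apply: setSI; apply: subsetDl.
- apply/subsetP => e; rewrite in_setI => /andP [h1 h2].
  by rewrite in_setU1 in_setI in_setD1 h1 h2; case: (e == g).
Qed.

(** An edge of [reds] is redundant after some moves; there [red_span] joins its ends in colour [j],
    and [reach_span] carries this back to [c0]. *)
Lemma reds_span j u v : con (col c0 j :&: reds) u v = con reds u v.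
Proof.
apply/idP/idP; first by apply: con_mono; apply: subsetIr.
apply: con_sub => g; rewrite inE => /existsP [c /andP [hc hr]].
have := joined_mono (setSI _ (subsetDl _ _)) (red_span j hc hr).
by rewrite /joined (reach_span j hc).
Qed.

Hypothesis hB : N * (#|comps reds| - 1) <= #|B :&: between reds|.

(** Every colour is connected inside each component of [reds], and its edges between these
    components are bridges. So no colour has more than [#|comps reds| - 1] such edges and a
    disconnected one has fewer, against [hB]. *)
Lemma max_connected j : connected (col c0 j).
Proof.
move=> u0 v0; pose bt i := col c0 i :&: between reds.
have h1 i : #|comps (col c0 i)| + #|bt i| <= #|comps reds|.
  apply: leq_trans (comps_bridges _ _) _; first exact: subsetIl.
    move=> g; rewrite !inE => /andP [/andP [hgB hci] hg]; apply: contra hg => hj.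
    have hr : red c0 g by rewrite /red hgB (eqP hci).
    apply: adj1; exact: redsI (connect0 _ _) hr.
  apply: leq_trans (_ : #|comps (col c0 i :&: reds)| <= _); last first.
    by rewrite (comps_eq (reds_span i)).
  apply: comps_mono => x y; apply: con_mono; apply/subsetP => e.
  rewrite in_setI => /andP [h2 h3]; rewrite in_setD h2 andbT /bt in_setI h2 inE negbK.
  exact: adj1.
have hpart : #|B :&: between reds| = \sum_(i < N) #|bt i|.
  rewrite -sum1_card (partition_big (fun e => c0 e) predT) //=.
  apply: eq_bigr => i _; rewrite -sum1_card; apply: eq_bigl => e.
  by rewrite !inE andbAC.
have hc1 i : 0 < #|comps (col c0 i)|.
  by apply/card_gt0P; exists (cls (col c0 i) u0); apply/mem_comps; exists u0.
apply: (connected_comps _ u0 v0); rewrite leqNgt; apply/negP => hj.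
have : \sum_(i < N) #|bt i| < \sum_(i < N) (#|comps reds| - 1).
  rewrite (bigD1 j) //= [ltnRHS](bigD1 j) //= -addSn; apply: leq_add.
    move: (h1 j) hj; move: #|bt j| #|comps reds| #|comps (col c0 j)|; clear; lia.
  apply: leq_sum => i _; move: (h1 i) (hc1 i).
  move: #|bt i| #|comps reds| #|comps (col c0 i)|; clear; lia.
by rewrite sum_nat_const card_ord -hpart ltnNge hB.
Qed.

End Colouring.

(** The sufficiency part of the theorem of Nash-Williams and Tutte, with connected classes in place
    of trees. *)
Lemma tree_packing N B : 0 < N ->
  (forall R, N * (#|comps R| - 1) <= #|B :&: between R|) ->
  exists c : edge G -> 'I_N, forall j, connected [set e in B | c e == j].
Proof.
case: N => // N _ h.
pose c1 : {ffun edge G -> 'I_N.+1} := [ffun=> ord0].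
have [c0 _ hc0] := arg_maxnP (i0 := c1) (P := predT) (total B) isT.
exists c0 => j; apply: (@max_connected N.+1 B c0); last exact: h.
by move=> c; apply: hc0.
Qed.

Definition crossing X e := cross X (ep e).

Lemma cls_cross R e : \sum_(A in comps R) crossing A e = 2 * (~~ joined R e).
Proof.
have hm u A : A \in comps R -> (u \in A) = (A == cls R u).
  case/mem_comps=> w ->; rewrite inE cls_eq; by [].
set a := cls R (ep e).1; set b := cls R (ep e).2.
have ha : a \in comps R by apply/mem_comps; exists (ep e).1.
have hb : b \in comps R by apply/mem_comps; exists (ep e).2.
have hab : (a == b) = joined R e by rewrite /a /b cls_eq.
transitivity (\sum_(A in comps R) ((A == a) (+) (A == b))).
  by apply: eq_bigr => A hA; rewrite /crossing /cross !hm.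
rewrite -hab; case: (eqVneq a b) => [->|hne] /=.
  by rewrite big1 // => A _; rewrite addbb.
rewrite (bigD1 a) //= (bigD1 b) /=; last by rewrite hb eq_sym.
rewrite eqxx (negPf hne) eq_sym (negPf hne) eqxx big1 //.
by move=> A /andP [/andP [_ h1] h2]; rewrite (negPf h1) (negPf h2).
Qed.

(* A maximum cut keeps at least half of the edges between the parts of any
   vertex partition, since moving one part across the cut gains nothing. *)
Lemma maxcut_between Q X R :
  (forall X', #|[set e in Q | crossing X' e]| <= #|[set e in Q | crossing X e]|) ->
  #|Q :&: between R| <= 2 * #|[set e in Q | crossing X e] :&: between R|.
Proof.
move=> hmax; set C := [set e in Q | crossing X e].
have hA A : \sum_(e in Q) (crossing A e && ~~ crossing X e) <=
            \sum_(e in Q) (crossing A e && crossing X e).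
  (* The symmetric difference: exactly the edges crossing [A] change between cut and non-cut. *)
  pose X' := (X :\: A) :|: (A :\: X).
  have hX' e : crossing X' e = crossing X e (+) crossing A e.
    rewrite /crossing /cross !inE; case: (_ \in X); case: (_ \in A);
    case: (_ \in X); case: (_ \in A) => //.
  have hs Y : #|[set e in Q | crossing Y e]| = \sum_(e in Q) crossing Y e.
    rewrite -sum1_card big_mkcond [RHS]big_mkcond; apply: eq_bigr => e _.
    by rewrite !inE; case: (e \in Q); case: (crossing Y e).
  have := hmax X'; rewrite !hs => h.
  have e1 : \sum_(e in Q) crossing X' e + \sum_(e in Q) (crossing A e && crossing X e)
          = \sum_(e in Q) crossing X e + \sum_(e in Q) (crossing A e && ~~ crossing X e).
    rewrite -!big_split /=; apply: eq_bigr => e _; rewrite hX'.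
    by case: (crossing X e); case: (crossing A e).
  by move: h e1; clear; lia.
have : \sum_(A in comps R) \sum_(e in Q) (crossing A e && ~~ crossing X e) <=
              \sum_(A in comps R) \sum_(e in Q) (crossing A e && crossing X e).
  by apply: leq_sum => A _; apply: hA.
rewrite exchange_big /= [leqRHS]exchange_big /=.
have e1 : \sum_(e in Q) \sum_(A in comps R) (crossing A e && ~~ crossing X e)
   = 2 * #|(Q :\: C) :&: between R|.
  rewrite -sum1_card big_distrr /= [LHS]big_mkcond [RHS]big_mkcond; apply: eq_bigr => e _.
  rewrite !inE; case: (e \in Q) => //=; rewrite ?andbF //.
  case hc: (crossing X e) => /=; first by rewrite big1 // => A _; rewrite andbF.
  under eq_bigr do rewrite andbT; rewrite cls_cross.
  by case: (joined R e).
have e2 : \sum_(e in Q) \sum_(A in comps R) (crossing A e && crossing X e)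
   = 2 * #|C :&: between R|.
  rewrite -sum1_card big_distrr /= [LHS]big_mkcond [RHS]big_mkcond; apply: eq_bigr => e _.
  rewrite !inE; case: (e \in Q) => //=; rewrite ?andbF //.
  case hc: (crossing X e) => /=; last by rewrite big1 // => A _; rewrite andbF.
  under eq_bigr do rewrite andbT; rewrite cls_cross.
  by case: (joined R e).
rewrite e1 e2 => h.
have -> : #|Q :&: between R| = #|(Q :\: C) :&: between R| + #|C :&: between R|.
  have h1 : #|C :&: between R| <= #|Q :&: between R|.
    by apply: subset_leq_card; apply: setSI; apply/subsetP => e; rewrite inE => /andP [].
  have -> : (Q :\: C) :&: between R = (Q :&: between R) :\: C.
    by apply/setP => e; rewrite !inE; case: (e \in Q); case: (crossing X e); rewrite ?andbF ?andbT.
  rewrite cardsD.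
  have -> : Q :&: between R :&: C = C :&: between R.
    by apply/setP => e; rewrite !inE; case: (e \in Q); case: (crossing X e); rewrite ?andbF ?andbT.
  by rewrite subnK.
by move: h; clear; lia.
Qed.

Lemma family_sum (J : finType) (Tr : J -> {set edge G}) (D : {set J}) Q :
  (forall i j, i \in D -> j \in D -> i != j -> [disjoint Tr i & Tr j]) ->
  \sum_(i in D) #|Q :&: Tr i| <= #|Q|.
Proof.
move=> hd.
have hc (C : {set edge G}) : #|C| = \sum_e (e \in C).
  by rewrite -sum1_card big_mkcond; apply: eq_bigr => e _; case: ifP.
under eq_bigr do rewrite hc.
rewrite hc exchange_big /=; apply: leq_sum => e _.
case: (boolP (e \in Q)) => hQ; last first.
  by rewrite big1 // => i _; rewrite in_setI (negPf hQ).
case: (boolP [exists i in D, e \in Tr i]) => [/exists_inP [i hi hei]|/exists_inPn hno].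
  rewrite (bigD1 i) //= big1 ?addn0 ?leq_b1 // => j /andP [hj hji].
  rewrite in_setI; case hej: (e \in Tr j); rewrite ?andbF //=.
  by have := hd i j hi hj; rewrite eq_sym hji => /(_ isT) /pred0P /(_ e) /=; rewrite hei hej.
by rewrite big1 // => i hi; rewrite in_setI (negPf (hno i hi)) andbF.
Qed.

Lemma family_hit (J : finType) (Tr : J -> {set edge G}) Q :
  (forall i j, i != j -> [disjoint Tr i & Tr j]) ->
  #|[set j | ~~ [disjoint Q & Tr j]]| <= #|Q|.
Proof.
move=> hd; set W := [set j | _].
apply: leq_trans (_ : \sum_(i in W) #|Q :&: Tr i| <= _); last first.
  by apply: family_sum => i j _ _; apply: hd.
rewrite -sum1_card; apply: leq_sum => i; rewrite inE -setI_eq0 -card_gt0; exact.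
Qed.

Lemma between_family (J : finType) (Tr : J -> {set edge G}) (D : {set J}) Q R :
  (forall i, i \in D -> Tr i \subset Q /\ connected (Tr i)) ->
  (forall i j, i \in D -> j \in D -> i != j -> [disjoint Tr i & Tr j]) ->
  #|D| * (#|comps R| - 1) <= #|Q :&: between R|.
Proof.
move=> hT hd; apply: leq_trans (family_sum (Q :&: between R) hd).
rewrite -sum_nat_const; apply: leq_sum => i /hT [hQ hc].
have := between_lb R hc; have -> : Q :&: between R :&: Tr i = Tr i :&: between R.
  by rewrite setIC setIA (setIidPl hQ).
by move: #|comps R| #|_|; clear; lia.
Qed.

End Packing.

Lemma subset_of_card (U : finType) (A : {set U}) a : a <= #|A| ->
  exists2 C : {set U}, C \subset A & #|C| = a.
Proof.
move=> h; exists [set x in take a (enum A)].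
  by apply/subsetP => x; rewrite inE => /mem_take; rewrite mem_enum.
rewrite cardsE; move/card_uniqP: (take_uniq a (enum_uniq A)) => ->.
by rewrite size_takel // -cardE.
Qed.

(** * Degree sums over the two parts, and residues modulo [k] *)

Section Finish.
Variable G : mgraph.
Implicit Types (F P Q : {set edge G}) (e : edge G) (v : G).

Lemma degE F v : deg F v = \sum_(e in F) (((ep e).1 == v) + ((ep e).2 == v)).
Proof.
rewrite /deg -!sum1_card !(big_mkcond (fun e => e \in _)) -big_split /=.
apply: eq_bigr => e _; rewrite !inE; case: (e \in F) => //=.
rewrite epE /unordered !inE [v == _]eq_sym [v == (ep e).2]eq_sym.
have -> : ([set (ep e).1; (ep e).2] == [set v]) = ((ep e).1 == v) && ((ep e).2 == v).
  apply/eqP/andP => [h|[/eqP -> /eqP ->]]; last by rewrite setUid.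
  by rewrite -!in_set1 -h !inE !eqxx orbT.
by case: (_ == v); case: (_ == v).
Qed.

Lemma deg_union F F' v : [disjoint F & F'] -> deg (F :|: F') v = deg F v + deg F' v.
Proof.
move=> h; rewrite !degE (big_setID F) /=; congr (_ + _); apply: eq_bigl => e;
  by have := pred0P h e; rewrite !inE /=; case: (e \in F); case: (e \in F').
Qed.

Lemma deg_mono F F' v : F \subset F' -> deg F v <= deg F' v.
Proof.
move=> h; rewrite !degE [leqRHS](big_setID F) /= (setIidPr h); exact: leq_addr.
Qed.

Variable X : {set G}.

(** The number of edges of [F] inside [X] minus the number inside [~: X]: half of the difference
    between the degree sums of the two sides. *)
Definition sgn F : int :=
  (\sum_(e in F) (Posz ((ep e).1 \in X) + Posz ((ep e).2 \in X) - 1))%R.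

Lemma sgn_union F F' : [disjoint F & F'] -> sgn (F :|: F') = (sgn F + sgn F')%R.
Proof.
move=> h; rewrite /sgn (big_setID F) /=; congr (_ + _)%R; apply: eq_bigl => e;
  by have := pred0P h e; rewrite !inE /=; case: (e \in F); case: (e \in F').
Qed.

Lemma sum_eqv1 (A : {set G}) (x : G) : \sum_(v in A) (x == v) = (x \in A).
Proof.
case: (boolP (x \in A)) => hx.
  by rewrite (bigD1 x) //= eqxx big1 // => v /andP [_ /negPf]; rewrite eq_sym => ->.
by rewrite big1 // => v hv; apply/eqP; rewrite eqb0; apply: contraNneq hx => ->.
Qed.

Lemma deg_sum F (A : {set G}) :
  \sum_(v in A) deg F v = \sum_(e in F) (((ep e).1 \in A) + ((ep e).2 \in A)).
Proof.
under eq_bigr do rewrite degE.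
by rewrite exchange_big /=; apply: eq_bigr => e _; rewrite big_split /= !sum_eqv1.
Qed.

Lemma deg_sgn F : (Posz (\sum_(v in X) deg F v) =
  Posz (\sum_(v in ~: X) deg F v) + 2 * sgn F)%R.
Proof.
rewrite !deg_sum /sgn !(big_morph Posz PoszD (erefl (Posz 0))) big_distrr /= -big_split /=.
apply: eq_bigr => e _; rewrite !inE.
by case: ((ep e).1 \in X); case: ((ep e).2 \in X).
Qed.

Lemma sgn_in F : (forall e, e \in F -> ends e \subset X) -> sgn F = Posz #|F|.
Proof.
move=> h; rewrite /sgn -sum1_card (big_morph Posz PoszD (erefl (Posz 0))).
apply: eq_bigr => e /h; rewrite epE subUset !sub1set => /andP [-> ->]; by [].
Qed.

Lemma sgn_out F : (forall e, e \in F -> ends e \subset ~: X) -> sgn F = (- Posz #|F|)%R.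
Proof.
move=> h; rewrite /sgn -sum1_card (big_morph Posz PoszD (erefl (Posz 0))) -sumrN.
by apply: eq_bigr => e /h; rewrite epE subUset !sub1set !inE => /andP [/negPf -> /negPf ->].
Qed.

Lemma sgn0 F : (forall e, e \in F -> crossing X e) -> sgn F = 0%R.
Proof.
move=> h; rewrite /sgn big1 // => e /h; rewrite /crossing /cross.
by case: (_ \in X); case: (_ \in X).
Qed.

Lemma not_crossing e : ~~ crossing X e -> ends e \subset X \/ ends e \subset ~: X.
Proof.
rewrite epE /crossing /cross !subUset !sub1set !inE.
by case: (_ \in X); case: (_ \in X) => //= _; [left|right].
Qed.

Lemma in_not_crossing e : ends e \subset X -> ~~ crossing X e.
Proof. by rewrite epE /crossing /cross subUset !sub1set => /andP [-> ->]. Qed.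
Lemma out_not_crossing e : ends e \subset ~: X -> ~~ crossing X e.
Proof.
by rewrite epE /crossing /cross subUset !sub1set !inE => /andP [/negPf -> /negPf ->].
Qed.

Lemma in_out_false e : ends e \subset X -> ends e \subset ~: X -> False.
Proof.
by rewrite epE !subUset !sub1set !inE => /andP [-> _] /andP [].
Qed.

Variable k : nat.
Hypothesis hk : 2 <= k.

(** On subsets of [I], [sgn] takes all values from [-#|IY|] to [#|IX|], at least [k] consecutive
    integers, so every residue occurs. The proof aims at the value [r - #|IY|]. *)
Lemma choose_inside (I : {set edge G}) (c : int) :
  (forall e, e \in I -> ~~ crossing X e) -> k - 1 <= #|I| ->
  exists2 I' : {set edge G}, I' \subset I & exists q : int, sgn I' = (c + q * Posz k)%R.
Proof.
move=> hI hc; pose IX := [set e in I | ends e \subset X].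
pose IY := [set e in I | ends e \subset ~: X].
have hIXY : #|I| = #|IX| + #|IY|.
  rewrite -cardsUI; have -> : IX :&: IY = set0.
    apply/setP => e; rewrite !inE; apply/negP => /andP [/andP [_ h1] /andP [_ h2]].
    exact: in_out_false h1 h2.
  rewrite cards0 addn0; congr #|pred_of_set _|; apply/setP => e; rewrite !inE.
  case he: (e \in I) => //=; apply/esym/orP; exact: not_crossing (hI e he).
have hk0 : Posz k != 0%R by move: hk; clear; lia.
have h1 := modz_ge0 (c + Posz #|IY|) hk0; have h2 := ltz_mod (c + Posz #|IY|) hk0.
have h3 := divz_eq (c + Posz #|IY|)%R (Posz k).
set r := ((c + Posz #|IY|)%R %% Posz k)%Z in h1 h2 h3.
set q := ((c + Posz #|IY|)%R %/ Posz k)%Z in h3.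
have hr : (`|r| <= #|IX| + #|IY|)%N by move: h1 h2 hc hIXY hk; clear; lia.
case: (leqP #|IY| `|r|) => hle.
  have [C hC1 hC2] := @subset_of_card _ IX (`|r| - #|IY|) ltac:(move: hr hle; clear; lia).
  exists C; first by apply: subset_trans hC1 _; apply/subsetP => e; rewrite inE => /andP [].
  exists (- q)%R; rewrite sgn_in; last by move=> e /(subsetP hC1); rewrite inE => /andP [].
  by rewrite hC2; move: h1 h3 hle; clear; lia.
have [C hC1 hC2] := @subset_of_card _ IY (#|IY| - `|r|) (leq_subr _ _).
exists C; first by apply: subset_trans hC1 _; apply/subsetP => e; rewrite inE => /andP [].
exists (- q)%R; rewrite sgn_out; last by move=> e /(subsetP hC1); rewrite inE => /andP [].
by rewrite hC2; move: h1 h3 hle; clear; lia.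
Qed.

(** A list of arcs forgets which edge an arc comes from; [o] restores a direction for each single
    edge, also among parallel ones. *)
Lemma ori_edges (es : seq (edge G)) D : uniq es -> eqv D (map (@ep G) es) ->
  exists o : edge G -> G * G, (forall e, e \in es -> unordered (o e) = ends e) /\ perm_eq D (map o es).
Proof.
elim: es D => [|e es IH] D /=.
  move=> _ /eqv_size/size0nil ->; exists (@ep G); split=> //.
case/andP=> he hu h.
have : unordered (ep e) \in map (@unordered G) D by rewrite (perm_mem h) /= inE eqxx.
case/mapP=> a ha heq; have hD := perm_to_rem ha.
have /(IH _ hu) [o [h1 h2]] : eqv (rem a D) (map (@ep G) es).
  have hD' : perm_eq (a :: rem a D) D by rewrite perm_sym.
  by have := eqv_trans (perm_eqv hD') h; rewrite /eqv /= heq perm_cons.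
exists (fun e' => if e' == e then a else o e'); split.
  move=> e'; rewrite inE; case: eqP => [->|_] /=; first by rewrite epE heq.
  exact: h1.
rewrite eqxx; apply: perm_trans hD _; rewrite perm_cons.
rewrite (eq_in_map _ o es).1 // => e' he' /=; case: eqP => // h'; by move: he; rewrite -h' he'.
Qed.

Lemma Zk_eq (a b : int) : (exists q : int, a = b + q * Posz k)%R -> (a%:~R = b%:~R :> 'Z_k)%R.
Proof.
move=> [q ->]; rewrite rmorphD rmorphM /= -[(Posz k)%:~R%R]/(k%:R)%R.
by rewrite pchar_Zp // mulr0 addr0.
Qed.

Lemma Zk_dvd (a b : int) : (a%:~R = b%:~R :> 'Z_k)%R -> exists q : int, (a = b + q * Posz k)%R.
Proof.
move=> h; have hk0 : Posz k != 0%R by move: hk; clear; lia.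
have h1 := modz_ge0 (a - b) hk0; have h2 := ltz_mod (a - b) hk0.
have h3 := divz_eq (a - b)%R (Posz k).
set r := ((a - b)%R %% Posz k)%Z in h1 h2 h3.
exists ((a - b)%R %/ Posz k)%Z.
suff : r = 0%R by move: h3; clear; lia.
have : (r%:~R = 0 :> 'Z_k)%R.
  have -> : r = ((a - b) + (- ((a - b)%R %/ Posz k)%Z) * Posz k)%R by move: h3; clear; lia.
  rewrite rmorphD rmorphB /= h subrr add0r rmorphM /= -[(Posz k)%:~R%R]/(k%:R)%R.
  by rewrite pchar_Zp // mulr0.
case: r h1 h2 {h3} => // n _ h2 /(congr1 val) /=.
rewrite -[((Posz n)%:~R)%R]/(n%:R)%R val_Zp_nat // modn_small; first by move=> ->.
by move: h2; clear; lia.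
Qed.

End Finish.

(** * From orientations to factors *)

Section Final.
Variable G : mgraph.
Implicit Types (F P Q H : {set edge G}) (e : edge G) (v : G).

Lemma conn_enum F : connected F -> conn [set: G] [seq ep e | e <- enum F].
Proof.
move=> h u v _ _; have := h u v; apply: connect_sub => x y /adjP [e he hxy].
apply: connect1; rewrite /adjl /=.
have hm : ep e \in [seq ep e | e <- enum F] by apply: map_f; rewrite mem_enum.
by case: hxy => hxy; rewrite hxy in hm; rewrite hm ?orbT.
Qed.

Lemma tree_connectedI m (J : eqType) (Tr : J -> {set edge G}) (s : seq J) F :
  size s = m -> uniq s ->
  (forall j, j \in s -> connected (Tr j) /\ Tr j \subset F) ->
  (forall i j, i \in s -> j \in s -> i != j -> [disjoint Tr i & Tr j]) ->
  tree_connected m F.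
Proof.
case: m => [|m] hs hu hc hd.
  by exists (fun i : 'I_0 => set0); split=> [[]|[]].
case: s => [|j0 s'] // in hs hu hc hd *; set s := j0 :: s' in hs hu hc hd *.
have hin (i : 'I_m.+1) : nth j0 s i \in s by apply: mem_nth; rewrite hs.
have hT (i : 'I_m.+1) : exists P : {set edge G}, P \subset Tr (nth j0 s i) /\ spanning_tree P.
  have [h1 _] := hc _ (hin i); have [P hP1 hP2] := spanning_tree_exists h1.
  by exists P.
have [P hP] := fin_all_exists hT.
exists P; split=> [i|i j hij].
  have [h1 h2] := hP i; split=> //; apply: subset_trans h1 _.
  by have [_ ] := hc _ (hin i).
have [h1 _] := hP i; have [h2 _] := hP j.
apply: disjointWl h1 _; apply: disjointWr h2 _; apply: hd => //.
by rewrite nth_uniq ?hs.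
Qed.

Lemma sum_cr_crossing (X A : {set G}) (E : seq (G * G)) :
  all (cross X) E -> A = X \/ A = ~: X -> \sum_(v in A) cut E [set v] = size E.
Proof.
move=> hE hA; elim: E hE => [|e E IH] /=; first by rewrite big1.
case/andP=> he /IH {}IH.
rewrite big_split /= IH -add1n; congr addn.
have hne : e.1 != e.2 by apply: contraTneq he => h; rewrite /cross h addbb.
transitivity (\sum_(v in A) ((e.1 == v) + (e.2 == v))).
  apply: eq_bigr => v _; rewrite /cross !inE.
  by case: (e.1 =P v) => [h1|_]; case: (e.2 =P v) => [h2|_] //; rewrite h1 h2 eqxx in hne.
rewrite big_split /= !sum_eqv1; move: he; rewrite /cross.
by case: hA => ->; rewrite ?inE; case: (e.1 \in X); case: (e.2 \in X).
Qed.

Lemma count_sum (U : eqType) (p : pred U) (s : seq U) : count p s = \sum_(e <- s) p e.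
Proof. by elim: s => [|a s IH]; rewrite ?big_nil // big_cons /= IH. Qed.

Variables (k : nat) (X : {set G}).
Hypothesis hk : 2 <= k.
Local Notation N := (2 * k - 2).

(* A bipartite factor is the set of edges oriented from [X] to its complement. *)
Lemma bipartite_factor (z : G) (Qs : nat -> {set edge G}) (g : G -> 'Z_k) :
  (forall i, i < N -> connected (Qs i) /\ forall e, e \in Qs i -> crossing X e) ->
  (forall i j, i < N -> j < N -> i != j -> [disjoint Qs i & Qs j]) ->
  (\sum_(v in X) g v = \sum_(v in ~: X) g v)%R ->
  exists F F' : {set edge G}, [/\ [disjoint F & F'],
    F :|: F' = \bigcup_(i < N) Qs i, forall v, ((deg F v)%:R = g v)%R
    & forall v, v != z -> k - 1 <= deg F' v].
Proof.
move=> hQ hdis hg.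
pose F i := [seq ep e | e <- enum (Qs i)].
pose es := flatten [seq enum (Qs i) | i <- iota 0 N].
have hes e : e \in es = [exists i : 'I_N, e \in Qs i].
  apply/flattenP/existsP => [[s /mapP [i hi ->]]|[i hi]].
    by rewrite mem_enum => he; rewrite mem_iota in hi; exists (Ordinal (hi : i < N)).
  exists (enum (Qs i)); last by rewrite mem_enum.
  by apply/mapP; exists (nat_of_ord i) => //; rewrite mem_iota add0n ltn_ord.
have hu : uniq es.
  suff gen s : uniq s -> (forall i, i \in s -> i < N) ->
      uniq (flatten [seq enum (Qs i) | i <- s]).
    by apply: gen; [apply: iota_uniq|move=> i; rewrite mem_iota].
  elim: s => [|i s IH] // /andP [his hus] hs /=.
  have hs' j : j \in s -> j < N by move=> hj; apply: hs; rewrite inE hj orbT.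
  rewrite cat_uniq enum_uniq IH //= andbT.
  apply/hasPn => e /flattenP [s' /mapP [j hj ->]]; rewrite !mem_enum => he.
  have hij : i != j by apply: contraNneq his => ->.
  apply/negP => he'; have := pred0P (hdis i j (hs i (mem_head _ _)) (hs' j hj) hij) e.
  by rewrite /= he he'.
have hE : allE N F = map (@ep G) es by rewrite /allE /es map_flatten -map_comp.
have hcrE : all (cross X) (allE N F).
  rewrite hE all_map; apply/allP => e; rewrite hes => /existsP [i he] /=.
  by have [_ h] := hQ i (ltn_ord i); apply: h.
have hF : classes N [set: G] F.
  move=> i hi; have [h1 h2] := hQ i hi; split; last exact: conn_enum.
  apply/allP => e' /mapP [e]; rewrite mem_enum => he ->; rewrite !inE /=.
  by apply: contraTneq (h2 e he) => h; rewrite /crossing /cross h addbb.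
have hgood := allE_good hF.
pose d v := cut (allE N F) [set v].
pose gh v := nat_of_ord (g v).
(* The net outdegree of a vertex with outdegree [gh v] in [X], or with in-degree [gh v] on the other
   side. *)
pose t v := (if v \in X then 2 * Posz (gh v) - Posz (d v) else Posz (d v) - 2 * Posz (gh v))%R.
have ghE v : ((gh v)%:R = g v)%R by rewrite /gh natr_Zp.
have hsum : divK k (sZ t [set: G]).
  have -> : sZ t [set: G] = (2 * (Posz (\sum_(v in X) gh v) - Posz (\sum_(v in ~: X) gh v)))%R.
    rewrite /sZ (big_setID X) /= setTI setTD.
    have e1 : (\sum_(v in X) t v = 2 * Posz (\sum_(v in X) gh v) - Posz (size (allE N F)))%R.
      rewrite -(sum_cr_crossing hcrE (or_introl erefl)) !(big_morph Posz PoszD (erefl (Posz 0))).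
      by rewrite big_distrr /= -sumrB; apply: eq_bigr => v; rewrite /t => ->.
    have e2 : (\sum_(v in ~: X) t v = Posz (size (allE N F)) - 2 * Posz (\sum_(v in ~: X) gh v))%R.
      rewrite -(sum_cr_crossing hcrE (or_intror erefl)) !(big_morph Posz PoszD (erefl (Posz 0))).
      by rewrite big_distrr /= -sumrB; apply: eq_bigr => v; rewrite inE /t => /negPf ->.
    by rewrite e1 e2; clear; lia.
  have [|q hq] := @Zk_dvd k hk (Posz (\sum_(v in X) gh v)) (Posz (\sum_(v in ~: X) gh v)).
    rewrite -![((Posz _)%:~R)%R]/(_%:R)%R !natr_sum.
    by rewrite (eq_bigr g) // [RHS](eq_bigr g).
  by apply/dvdzP; exists q; rewrite hq; clear; lia.
(* Edges outside the factor are directed into [X], so the bound [k - 1] is asked of in-degrees on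
   [X] and of outdegrees elsewhere. *)
have [||D [hD hs]] := @tree_orientation G k hk #|[set: G]| [set: G] F t (fun v => v \in X) z (leqnn _) (in_setT z) hF.
- move=> x _; rewrite /t -/(d x); case: (x \in X).
    by exists (Posz (gh x) - Posz (d x))%R; clear; lia.
  by exists (- Posz (gh x))%R; clear; lia.
- exact: hsum.
have hgD : good [set: G] D by apply: good_eqv hgood; rewrite eqv_sym.
have hDe := hD; rewrite hE in hDe; have [o [ho1 ho2]] := ori_edges hu hDe.
have hcr e : e \in es -> ((o e).1 \in X) (+) ((o e).2 \in X).
  move=> he; have : crossing X e.
    by move: he; rewrite hes => /existsP [i he]; have [_ h] := hQ i (ltn_ord i); apply: h.
  by rewrite /crossing (@cross_uo _ X (ep e) (o e)) // ho1 // epE.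
have heq e v : e \in es -> ((ep e).1 == v) + ((ep e).2 == v) = ((o e).1 == v) + ((o e).2 == v).
  by move=> he; have := ho1 e he; rewrite epE => /uo_eq [] -> //=; rewrite addnC.
have degO (p : pred (edge G)) v : deg [set e in es | p e] v =
    \sum_(e <- es | p e) (((o e).1 == v) + ((o e).2 == v)).
  rewrite degE [RHS]big_mkcond (big_uniq _ hu) /= -big_mkcondr /=.
  apply: eq_big => [e|e]; first by rewrite inE.
  by rewrite inE => /andP [he _]; apply: heq.
have outE' v : outd D [set v] = \sum_(e <- es) ((o e).1 == v).
  by rewrite /outd (permP ho2) count_map count_sum; apply: eq_bigr => e _; rewrite /= inE.
have inE' v : ind D [set v] = \sum_(e <- es) ((o e).2 == v).
  by rewrite /ind (permP ho2) count_map count_sum; apply: eq_bigr => e _; rewrite /= inE.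
pose p1 e := (o e).1 \in X.
have dF v : deg [set e in es | p1 e] v = if v \in X then outd D [set v] else ind D [set v].
  rewrite degO outE' inE' big_mkcond /=; case hv: (v \in X); rewrite !big_seq;
  apply: eq_bigr => e he; have := hcr e he; rewrite /p1.
    case h1: ((o e).1 \in X); case h2: ((o e).2 \in X) => //= _.
      by case: ((o e).2 =P v) => [h|]; rewrite ?addn0 //; rewrite -h h2 in hv.
    by case: ((o e).1 =P v) => [h|] //; rewrite -h h1 in hv.
  case h1: ((o e).1 \in X); case h2: ((o e).2 \in X) => //= _.
    by case: ((o e).1 =P v) => [h|] //; rewrite -h h1 in hv.
  by case: ((o e).2 =P v) => [h|] //; rewrite -h h2 in hv.
have dF' v : deg [set e in es | ~~ p1 e] v = if v \in X then ind D [set v] else outd D [set v].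
  rewrite degO outE' inE' big_mkcond /=; case hv: (v \in X); rewrite !big_seq;
  apply: eq_bigr => e he; have := hcr e he; rewrite /p1.
    case h1: ((o e).1 \in X); case h2: ((o e).2 \in X) => //= _.
      by case: ((o e).2 =P v) => [h|] //; rewrite -h h2 in hv.
    by case: ((o e).1 =P v) => [h|] //; rewrite -h h1 in hv.
  case h1: ((o e).1 \in X); case h2: ((o e).2 \in X) => //= _.
    by case: ((o e).1 =P v) => [h|] //; rewrite -h h1 in hv.
  by case: ((o e).2 =P v) => [h|]; rewrite ?addn0 //; rewrite -h h2 in hv.
exists [set e in es | p1 e], [set e in es | ~~ p1 e]; split.
- rewrite -setI_eq0; apply/eqP/setP => e; rewrite !inE; case: (p1 e); rewrite ?andbF //.
- apply/setP => e; rewrite !inE -andb_orr orbN andbT hes.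
  by apply/existsP/bigcupP => [[i hi]|[i _ hi]]; exists i.
- move=> v; rewrite dF -ghE; have [h _] := hs v (in_setT v).
  have hdv : d v = outd D [set v] + ind D [set v] by rewrite /d -(cut_eqv _ hD) (io_deg v hgD).
  rewrite -![(_%:R)%R]/((Posz _)%:~R)%R; apply: Zk_eq => //.
  move: h; rewrite /t /net hdv => /dvdzP [q].
  by case: (v \in X) => hq; [exists q|exists (- q)%R]; move: hq; clear; lia.
- move=> v hv; rewrite dF'; have [_ h] := hs v (in_setT v); have := h hv.
  by rewrite /degree_bound; case: (v \in X).
Qed.

(** The trees [hs] make [H] tree-connected and the trees [ms] its complement. Edges of [I], inside
    the parts, balance the degree sums; then the sets [qs], which lie in the cut, supply the
    remaining degrees by [bipartite_factor]. *)
Lemma finish m m0 (z : G) (f : G -> 'Z_k) (hf : compatible_wrt f X)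
  (J : eqType) (Tr : J -> {set edge G}) (hs ms qs : seq J) (I : {set edge G}) :
  size hs = m -> size ms = m0 -> size qs = N -> uniq (hs ++ ms ++ qs) ->
  (forall j, j \in hs ++ ms ++ qs -> connected (Tr j)) ->
  (forall i j, i \in hs ++ ms ++ qs -> j \in hs ++ ms ++ qs -> i != j ->
     [disjoint Tr i & Tr j]) ->
  (forall j e, j \in qs -> e \in Tr j -> crossing X e) ->
  (forall j, j \in hs ++ ms -> [disjoint I & Tr j]) ->
  (forall e, e \in I -> ~~ crossing X e) ->
  k - 1 <= #|I| \/ (forall e, ~~ crossing X e -> e \in I) ->
  exists H : {set edge G},
     [/\ tree_connected m H,
         (forall v : G, (deg H v)%:R%R = f v),
         tree_connected m0 (~: H)
       & forall v : G, v != z -> deg H v + (k - 1) <= deg [set: edge G] v].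
Proof.
move=> s1 s2 s3 hu hcon hdis hcr hIT hI hor.
have hinh j : j \in hs -> j \in hs ++ ms ++ qs by move=> h; rewrite mem_cat h.
have hinm j : j \in ms -> j \in hs ++ ms ++ qs by move=> h; rewrite !mem_cat h orbT.
have hinq j : j \in qs -> j \in hs ++ ms ++ qs by move=> h; rewrite !mem_cat h !orbT.
move: (hu); rewrite cat_uniq => /and3P [hu1 hu2]; rewrite cat_uniq => /and3P [hu3 hu4 hu5].
have nhm j : j \in hs -> j \in ms -> False.
  by move=> h1 h2; move/hasPn: hu2 => /(_ j); rewrite mem_cat h2 h1 => /(_ isT).
have nhq j : j \in hs -> j \in qs -> False.
  by move=> h1 h2; move/hasPn: hu2 => /(_ j); rewrite mem_cat h2 orbT h1 => /(_ isT).
have nmq j : j \in ms -> j \in qs -> False.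
  by move=> h1 h2; move/hasPn: hu4 => /(_ j h2); rewrite h1.
pose U (s : seq J) := [set e | has (fun j => e \in Tr j) s].
have UP s e : reflect (exists2 j, j \in s & e \in Tr j) (e \in U s).
  by rewrite inE; apply: hasP.
have dU s s' : {subset s <= hs ++ ms ++ qs} -> {subset s' <= hs ++ ms ++ qs} ->
    (forall j, j \in s -> j \in s' -> False) -> [disjoint U s & U s'].
  move=> h1 h2 h3; rewrite -setI_eq0; apply/eqP/setP => e; rewrite in_setI in_set0.
  apply/negP => /andP [/UP [i hi hei] /UP [j hj hej]].
  have hij : i != j by apply/eqP => hij; rewrite -hij in hj; apply: h3 hi hj.
  by have := pred0P (hdis i j (h1 i hi) (h2 j hj) hij) e; rewrite /= hei hej.
have dI s : {subset s <= hs ++ ms} -> [disjoint I & U s].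
  move=> h; rewrite -setI_eq0; apply/eqP/setP => e; rewrite in_setI in_set0.
  apply/negP => /andP [heI /UP [j hj hej]].
  by have := pred0P (hIT j (h j hj)) e; rewrite /= heI hej.
have sh : {subset hs <= hs ++ ms} by move=> j h; rewrite mem_cat h.
have sm : {subset ms <= hs ++ ms} by move=> j h; rewrite mem_cat h orbT.
pose H0 := U hs.
(* [s] is the value that [sgn] must have on [H], modulo [k]. If every edge inside the parts is
   available, compatibility says that [s] itself is attained. *)
have [s hsX] : exists s : int, (\sum_(v in X) f v - \sum_(v in ~: X) f v = (2 * s)%:~R)%R /\
    ((forall e, ~~ crossing X e -> e \in I) -> exists2 I' : {set edge G}, I' \subset I & sgn X I' = s).
  case: hf => [[x hx hfx]|[y hy hfy]].
    exists (Posz x); split.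
      by rewrite -hfx opprB addrC subrK -[(2 * Posz x)%R]/(Posz (2 * x)).
    move=> hall; have [C hC1 hC2] := subset_of_card hx.
    exists C; last by rewrite sgn_in ?hC2 // => e /(subsetP hC1); rewrite inE.
    apply/subsetP => e /(subsetP hC1); rewrite inE => h; apply: hall.
    exact: in_not_crossing.
  exists (- Posz y)%R; split.
    by rewrite hfy addrC addrA addNr add0r mulrN rmorphN /= -[(2 * Posz y)%R]/(Posz (2 * y)).
  move=> hall; have [C hC1 hC2] := subset_of_card hy.
  exists C; last by rewrite sgn_out ?hC2 // => e /(subsetP hC1); rewrite inE.
  apply/subsetP => e /(subsetP hC1); rewrite inE => h; apply: hall.
  exact: out_not_crossing.
case: hsX => hsX hall.
have [I' hI' [q hq]] : exists2 I' : {set edge G}, I' \subset I &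
    exists q : int, (sgn X H0 + sgn X I' = s + q * Posz k)%R.
  case: hor => [hge|hin].
    have [I' h1 [q h2]] := choose_inside hk (s - sgn X H0)%R hI hge.
    by exists I' => //; exists q; rewrite h2; clear; lia.
  have [I' h1 h2] := hall hin; exists I' => //; exists 0%R.
  (* All edges inside the parts are in [I], which the trees [hs] avoid; so these trees lie in the
     cut and contribute 0. *)
  rewrite h2 sgn0 ?mul0r ?addr0 ?add0r // => e he; apply: contraT => /hin heI.
  by have := pred0P (dI hs sh) e; rewrite /= heI he.
have dHI : [disjoint H0 & I'].
  by rewrite disjoint_sym; apply: disjointWl hI' (dI hs sh).
pose W := H0 :|: I'.
pose g v := (f v - (deg W v)%:R)%R.
have hg : (\sum_(v in X) g v = \sum_(v in ~: X) g v)%R.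
  rewrite /g !sumrB -!natr_sum; apply/eqP; rewrite -subr_eq0; apply/eqP.
  have -> : forall a b c d : 'Z_k, (a - b - (c - d) = (a - c) - (b - d))%R.
    by move=> a b c d; rewrite !opprB addrACA [RHS]addrACA [(- b - c)%R]addrC.
  rewrite hsX -![(_%:R)%R]/((Posz _)%:~R)%R -rmorphB /= deg_sgn addrAC subrr add0r.
  apply/eqP; rewrite subr_eq0; apply/eqP; apply: Zk_eq => //.
  by exists (- 2 * q)%R; rewrite /W sgn_union // hq; clear; lia.
have hN0 : 0 < N by move: hk; clear; lia.
have [j0 _] : exists j0, j0 \in qs.
  by case: (qs) s3 => [|j0 qs'] //= h; [move: h hN0; clear; lia|exists j0; rewrite mem_head].
have hnth i : i < N -> nth j0 qs i \in qs by move=> hi; apply: mem_nth; rewrite s3.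
have [||F [F' [f1 f2 f3 f4]]] := @bipartite_factor z (fun i => Tr (nth j0 qs i)) g _ _ hg.
- move=> i hi; split; first by apply: hcon; apply: hinq; apply: hnth.
  by move=> e he; apply: hcr he; apply: hnth.
- move=> i j hi hj hij; apply: hdis; try by apply: hinq; apply: hnth.
  by rewrite nth_uniq ?s3.
have hQU : \bigcup_(i < N) Tr (nth j0 qs i) \subset U qs.
  apply/subsetP => e /bigcupP [i _ he]; apply/UP; exists (nth j0 qs i) => //.
  exact: hnth.
have hFQ : F \subset U qs by apply: subset_trans hQU; rewrite -f2 subsetUl.
have hF'Q : F' \subset U qs by apply: subset_trans hQU; rewrite -f2 subsetUr.
have dIq : [disjoint I' & U qs].
  rewrite -setI_eq0; apply/eqP/setP => e; rewrite in_setI in_set0.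
  apply/negP => /andP [/(subsetP hI') /hI heI /UP [j hj hej]].
  by rewrite (hcr j e hj hej) in heI.
have dWq : [disjoint W & U qs].
  rewrite -setI_eq0 setIUl setU_eq0 !setI_eq0 dIq andbT; exact: dU.
have dWF : [disjoint W & F] by apply: disjointWr hFQ dWq.
exists (W :|: F); split.
- apply: (@tree_connectedI m J Tr hs) => // [j hj|i j hi hj]; last by apply: hdis; apply: hinh.
  split; first by apply: hcon; apply: hinh.
  apply/subsetP => e he; rewrite in_setU in_setU; apply/orP; left; apply/orP; left.
  by apply/UP; exists j.
- by move=> v; rewrite deg_union // natrD f3 /g addrC subrK.
- apply: (@tree_connectedI m0 J Tr ms) => // [j hj|i j hi hj]; last by apply: hdis; apply: hinm.
  split; first by apply: hcon; apply: hinm.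
  apply/subsetP => e he; have heU : e \in U ms by apply/UP; exists j.
  rewrite in_setC !in_setU !negb_or -andbA; apply/and3P; split.
  + have := pred0P (dU hs ms _ _ nhm) e => /=; rewrite heU andbT => -> //.
  + apply/negP => /(subsetP hI') heI; have := pred0P (dI ms sm) e.
    by rewrite /= heI heU.
  + apply/negP => /(subsetP hFQ) heF; have := pred0P (dU ms qs hinm hinq nmq) e.
    by rewrite /= heU heF.
- move=> v hv; have d2 : [disjoint W :|: F & F'].
    rewrite -setI_eq0 setIUl setU_eq0 !setI_eq0 f1 andbT.
    exact: disjointWr hF'Q dWq.
  apply: leq_trans (_ : deg (W :|: F :|: F') v <= _); last by apply: deg_mono; apply: subsetT.
  by rewrite [leqRHS]deg_union // leq_add2l; apply: f4.
Qed.

Lemma bipartite_crossing e : #|ends e :&: X| = 1 -> #|ends e :&: ~: X| = 1 -> crossing X e.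
Proof.
move=> h1 h2; apply: contraT => /not_crossing [] h.
  move: h2; rewrite (_ : _ :&: _ = set0) ?cards0 //; apply/eqP; rewrite -setD_eq0 in h.
  by rewrite -setDE.
move: h1; rewrite (_ : _ :&: _ = set0) ?cards0 //; apply/eqP.
by rewrite setI_eq0 -[X]setCK -subsets_disjoint.
Qed.

End Final.

(** * The bipartite and the general case *)

Section Main.
Variables (G : mgraph) (z : G) (k : nat) (hk : 2 <= k) (f : G -> 'Z_k).
Variables (m m0 : nat).
Local Notation N := (2 * k - 2).
Local Notation goal := (exists H : {set edge G},
     [/\ tree_connected m H,
         (forall v : G, (deg H v)%:R%R = f v),
         tree_connected m0 (~: H)
       & forall v : G, v != z -> deg H v + (k - 1) <= deg [set: edge G] v]).

Lemma bipartite_case : compatible f -> bipartite G ->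
  tree_connected (m + m0 + 2 * k - 2) [set: edge G] -> goal.
Proof.
move=> hf [X hX] [Tr [hT hd]].
have hcr e : crossing X e by have [h1 h2] := hX e; apply: bipartite_crossing.
set n := m + m0 + 2 * k - 2 in Tr hT hd.
have hn : n = m + (m0 + N) by rewrite /n; move: hk; clear; lia.
pose s := enum 'I_n; have hs : size s = n by rewrite size_enum_ord.
have hcat : take m s ++ take m0 (drop m s) ++ drop m0 (drop m s) = s.
  by rewrite !cat_take_drop.
apply: (@finish G k X hk m m0 z f (hf X) 'I_n Tr (take m s) (take m0 (drop m s))
   (drop m0 (drop m s)) set0); rewrite ?hcat.
- by rewrite size_takel // hs hn; clear; lia.
- by rewrite size_takel // size_drop hs hn; clear; lia.
- by rewrite !size_drop hs hn; clear; lia.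
- exact: enum_uniq.
- by move=> j _; have [_ []] := hT j.
- by move=> i j _ _; apply: hd.
- by move=> j e _ _; apply: hcr.
- by move=> j _; rewrite -setI_eq0 set0I.
- by move=> e; rewrite inE.
- by right=> e; rewrite hcr.
Qed.

Lemma general_case : compatible f ->
  tree_connected (m + m0 + 4 * k - 4) [set: edge G] -> goal.
Proof.
move=> hf [Tr [hT hd]].
set n := m + m0 + 4 * k - 4 in Tr hT hd.
have hn : n = m + m0 + 2 * N by rewrite /n; move: hk; clear; lia.
have hcon j : connected (Tr j) by have [_ []] := hT j.
have hN0 : 0 < N by move: hk; clear; lia.
have [Qi _ hQi] : exists2 C : {set 'I_n}, C \subset [set: 'I_n] & #|C| = 2 * N.
  by apply: subset_of_card; rewrite cardsT card_ord hn leq_addl.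
have hQc : #|~: Qi| = m + m0.
  by have := cardsC Qi; rewrite hQi card_ord; move: hn; clear; lia.
pose Q := \bigcup_(j in Qi) Tr j.
have hTQ j : j \in Qi -> Tr j \subset Q by move=> hj; apply: bigcup_sup.
have [X _ hX] := arg_maxnP (i0 := set0 : {set G}) (P := predT)
   (fun X => #|[set e in Q | crossing X e]|) isT.
have {}hX X' : #|[set e in Q | crossing X' e]| <= #|[set e in Q | crossing X e]| by apply: hX.
pose Iq := [set e in Q | ~~ crossing X e].
case: (leqP (k - 1) #|Iq|) => hIq.
  pose B := [set e in Q | crossing X e].
  have [c hc] : exists c : edge G -> 'I_N, forall j, connected [set e in B | c e == j].
    apply: tree_packing => // R.
    (* With [c] components, the [2N] trees have at least [2N (c - 1)] edges between them, and the
       maximum cut keeps half of these, as packing [N] trees requires. *)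
    have h1 := @between_family G 'I_n Tr Qi Q R (fun i hi => conj (hTQ i hi) (hcon i))
      (fun i j _ _ => hd i j).
    have := leq_trans h1 (maxcut_between R hX).
    by rewrite hQi -mulnA leq_mul2l.
  pose Tr' (j : 'I_n + 'I_N) := match j with inl i => Tr i | inr i => [set e in B | c e == i] end.
  have hBQ : B \subset Q by apply/subsetP => e; rewrite inE => /andP [].
  have dQ j : j \notin Qi -> [disjoint Tr j & Q].
    move=> hj; rewrite -setI_eq0; apply/eqP/setP => e; rewrite in_setI in_set0.
    apply/negP => /andP [h1 /bigcupP [i hi h2]].
    have hij : j != i by apply: contraNneq hj => ->.
    by have := pred0P (hd j i hij) e; rewrite /= h1 h2.
  pose s := [seq (inl i : 'I_n + 'I_N) | i <- enum (~: Qi)].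
  pose qs := [seq (inr i : 'I_n + 'I_N) | i <- enum 'I_N].
  have hss : size s = m + m0 by rewrite size_map -cardE hQc.
  have inl_inj : injective (fun i : 'I_n => inl i : 'I_n + 'I_N) by move=> a b [].
  have inr_inj : injective (fun i : 'I_N => inr i : 'I_n + 'I_N) by move=> a b [].
  have sP j : j \in s -> exists2 i, i \notin Qi & j = inl i.
    by case/mapP=> i; rewrite mem_enum inE => hi ->; exists i.
  have qP j : j \in qs -> exists i, j = inr i by case/mapP=> i _ ->; exists i.
  have dTB i j : i \notin Qi -> [disjoint Tr i & [set e in B | c e == j]].
    move=> /dQ; apply: disjointWr; apply: subset_trans hBQ.
    by apply/subsetP => e; rewrite inE => /andP [].
  have hcat : take m s ++ drop m s ++ qs = s ++ qs by rewrite catA cat_take_drop.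
  apply: (@finish G k X hk m m0 z f (hf X) ('I_n + 'I_N)%type Tr' (take m s) (drop m s) qs Iq);
    rewrite ?hcat ?cat_take_drop.
  - by rewrite size_takel // hss leq_addr.
  - by rewrite size_drop hss addKn.
  - by rewrite size_map size_enum_ord.
  - have us : uniq s by rewrite map_inj_uniq ?enum_uniq.
    have uq : uniq qs by rewrite map_inj_uniq ?enum_uniq.
    rewrite cat_uniq us uq andbT /=.
    by apply/hasPn => j /qP [i ->]; apply/negP => /sP [i' _].
  - by move=> j; rewrite mem_cat => /orP [/sP [i _ ->]|/qP [i ->]] /=.
  - move=> i j; rewrite !mem_cat => /orP [/sP [a ha ->]|/qP [a ->]] /orP [/sP [b hb ->]|/qP [b ->]] hab /=.
    + exact: hd.
    + exact: dTB.
    + by rewrite disjoint_sym; apply: dTB.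
    + rewrite -setI_eq0; apply/eqP/setP => e; rewrite !inE; apply/negP.
      move=> /andP [/andP [_ /eqP h1] /andP [_ /eqP h2]]; rewrite -h1 -h2 eqxx in hab.
      by [].
  - by move=> j e /qP [i ->] /=; rewrite !inE => /andP [/andP []].
  - move=> j /sP [i hi ->] /=; rewrite disjoint_sym; apply: disjointWr (dQ i hi).
    by apply/subsetP => e; rewrite inE => /andP [].
  - by move=> e; rewrite inE => /andP [].
  - by left.
(* At most [k - 2] trees of [Qi] have an edge inside a part, so at least
   [4k - 4 - (k - 2) >= 2k - 2] of them lie in the cut. *)
pose W1 := [set j | ~~ [disjoint Iq & Tr j]].
have hW1 : #|W1| <= #|Iq| := family_hit Iq hd.
have hGd : N <= #|Qi :\: W1|.
  rewrite cardsD hQi; move: (subset_leq_card (subsetIr Qi W1)) hW1 hIq hk.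
  by move: #|Qi :&: W1| #|W1| #|Iq|; clear; lia.
have [Qs hQs1 hQs2] := subset_of_card hGd.
have hQcr j e : j \in Qs -> e \in Tr j -> crossing X e.
  move=> hj he; have := subsetP hQs1 _ hj; rewrite in_setD inE negbK => /andP [hdis hjQ].
  apply: contraT => hnc; have := pred0P hdis e; rewrite /= he andbT inE hnc andbT.
  by rewrite (subsetP (hTQ j hjQ)).
pose Ia := [set e | ~~ crossing X e].
(* [I] is drawn from all edges of [G] inside the parts and may spoil any of the trees outside [Qs],
   but at most [k - 1] of them; of the trees, [m + m0 + (4k - 4) - (2k - 2) - (k - 1) >= m + m0]
   remain. *)
have [I [hI1 hI2 hI3]] : exists I : {set edge G}, [/\ I \subset Ia, #|I| <= k - 1 &
    k - 1 <= #|I| \/ (forall e, ~~ crossing X e -> e \in I)].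
  case: (leqP (k - 1) #|Ia|) => h.
    by have [I h1 h2] := subset_of_card h; exists I; rewrite h2; split=> //; left.
  by exists Ia; split; [|exact: ltnW|right=> e; rewrite inE].
pose W := [set j | ~~ [disjoint I & Tr j]].
have hW : #|W| <= #|I| := family_hit I hd.
have hrest : m + m0 <= #|~: (W :|: Qs)|.
  have := cardsC (W :|: Qs); rewrite card_ord cardsU hQs2; move: hn hW hI2 hk.
  by move: #|W| #|W :&: Qs| #|~: (W :|: Qs)| #|I|; clear; lia.
have [HM hHM1 hHM2] := subset_of_card hrest.
have hsz : size (enum HM) = m + m0 by rewrite -cardE.
have hHM j : j \in HM -> j \notin W /\ j \notin Qs.
  by move=> /(subsetP hHM1); rewrite in_setC in_setU negb_or => /andP.
have hcat : take m (enum HM) ++ drop m (enum HM) ++ enum Qs = enum HM ++ enum Qs.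
  by rewrite catA cat_take_drop.
apply: (@finish G k X hk m m0 z f (hf X) 'I_n Tr (take m (enum HM)) (drop m (enum HM))
   (enum Qs) I); rewrite ?hcat ?cat_take_drop.
- by rewrite size_takel // hsz leq_addr.
- by rewrite size_drop hsz addKn.
- by rewrite -cardE.
- rewrite cat_uniq !enum_uniq /= andbT; apply/hasPn => j; rewrite !mem_enum => h.
  by apply/negP => /hHM [_]; rewrite h.
- by move=> j _.
- by move=> i j _ _; apply: hd.
- by move=> j e; rewrite mem_enum; apply: hQcr.
- by move=> j; rewrite mem_enum => /hHM [h _]; move: h; rewrite inE negbK.
- by move=> e /(subsetP hI1); rewrite inE.
- exact: hI3.
Qed.

End Main.

Theorem theorem8p3 (m m0 : nat) (G : mgraph) (z : G) (k : nat) (hk : 2 <= k)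
    (f : G -> 'Z_k) (hf : compatible f) :
  (tree_connected (m + m0 + 4 * k - 4) [set: edge G] ->
   exists H : {set edge G},
     [/\ tree_connected m H,
         (forall v : G, (deg H v)%:R%R = f v),
         tree_connected m0 (~: H)
       & forall v : G, v != z -> deg H v + (k - 1) <= deg [set: edge G] v]) /\
  (bipartite G ->
   tree_connected (m + m0 + 2 * k - 2) [set: edge G] ->
   exists H : {set edge G},
     [/\ tree_connected m H,
         (forall v : G, (deg H v)%:R%R = f v),
         tree_connected m0 (~: H)
       & forall v : G, v != z -> deg H v + (k - 1) <= deg [set: edge G] v]).
Proof.
split; first exact: general_case.
exact: bipartite_case.
Qed.
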